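(* Let $T>0$ and let $u$ and $v$ be solutions of the Benjamin equation $$u_t+\mathcal H\partial_x^2u+\partial_x^3u+uu_x=0,\qquad (x,t)\in\mathbb R\times[0,T],$$ such that $$u,v\in C([0,T];H^s(\mathbb R))\cap C^1((0,T);H^{s-3}(\mathbb R)),\qquad s>7/2 .$$ If there exists a nonempty open set $I\subset\mathbb R$ such that $$u(x,0)=v(x,0)\quad\text{and}\quad \partial_tu(x,0)=\partial_tv(x,0)\qquad\text{for all }x\in I,$$ then $u\equiv v$ (on $\mathbb R\times[0,T]$). In particular, if $u(x,0)=0$ and $\partial_tu(x,0)=0$ for all $x\in I$, then $u\equiv0$.
   Context: Solutions are real-valued. The Hilbert transform is $\mathcal Hf=(-i\,\mathrm{sgn}(\xi)\hat f(\xi))^\vee$, where $\hat f(\xi)=\int_{\mathbb R}e^{-i\xi x}f(x)\,dx$, and $H^s(\mathbb R)$ is the $L^2$-based Sobolev space. The derivative $\partial_tu(\cdot,0)$ is the time derivative at $t=0$ (one-sided, an element of $H^{s-3}(\mathbb R)$), so that the equation holds at $t=0$: $\partial_tu(\cdot,0)=-(\mathcal H\partial_x^2u+\partial_x^3u+uu_x)(\cdot,0)$. *)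

(* Defs.v *)
From HB Require Import structures.
From mathcomp Require Import all_boot all_order all_algebra.
From mathcomp Require Import all_classical all_reals all_analysis.
From mathcomp Require Import complex.

Set Implicit Arguments.
Unset Strict Implicit.
Unset Printing Implicit Defensive.

Import Order.TTheory GRing.Theory Num.Theory.
Import numFieldNormedType.Exports.

Local Open Scope classical_set_scope.
Local Open Scope ring_scope.
Local Open Scope complex_scope.

Section FourierPlancherel.
Context {R : realType}.
Local Notation mu := (@lebesgue_measure R).

Definition cintegral (D : set R) (f : R -> R[i]) : R[i] :=
  (\int[mu]_(x in D) complex.Re (f x)) +i*
  (\int[mu]_(x in D) complex.Im (f x)).

Definition cexpi (a : R) : R[i] := cos a +i* sin a.

Definition L2C (f : R -> R[i]) : Prop :=
  (fun x => complex.Re (f x)) \in Lfun mu 2%:E /\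
  (fun x => complex.Im (f x)) \in Lfun mu 2%:E.

Definition L2normC (f : R -> R[i]) : \bar R :=
  'N[mu]_(2%:E) [(fun x => (ComplexField.Normc.normc (f x))%:E)]%E.

Definition fourier_trunc (n : nat) (f : R -> R[i]) (xi : R) : R[i] :=
  cintegral `[- n%:R, n%:R] (fun x => cexpi (- (xi * x)) * f x).

Definition ifourier_trunc (n : nat) (g : R -> R[i]) (x : R) : R[i] :=
  ((2 * pi)^-1)%:C *
  cintegral `[- n%:R, n%:R] (fun xi => cexpi (xi * x) * g xi).

(* The Fourier transform of f in L^2, as the limit in L^2 of the integrals over
   [-n, n]; it is determined only up to a.e. equality, and xget picks a
   representative.  When f is also integrable, it is a.e. equal to the
   integral of e^{-i xi x} f(x) over R. *)
Definition fourier (f : R -> R[i]) : R -> R[i] :=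
  xget (fun=> 0) [set g | L2C g /\
    L2normC (fun xi => fourier_trunc n f xi - g xi) @[n --> \oo] --> 0%E].

Definition ifourier (g : R -> R[i]) : R -> R[i] :=
  xget (fun=> 0) [set f | L2C f /\
    L2normC (fun x => ifourier_trunc n g x - f x) @[n --> \oo] --> 0%E].

Definition fourierR (f : R -> R) : R -> R[i] := fourier (fun x => (f x)%:C).

(* For real f the inverse transform below is a.e. real; Re only changes the
   codomain. *)
Definition hilbert (f : R -> R) (x : R) : R :=
  complex.Re (ifourier (fun xi => (0 -i* 1) * (Num.sg xi)%:C * fourierR f xi) x).

End FourierPlancherel.

Section Sobolev.
Context {R : realType}.
Local Notation mu := (@lebesgue_measure R).

Definition sobolev_norm (s : R) (f : R -> R) : \bar R :=
  L2normC (fun xi => ((1 + xi ^+ 2) `^ (s / 2))%:C * fourierR f xi).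

(* The real-valued functions in H^s(R), for s >= 0 (for negative s the
   requirement that f be in L^2 is too strong). *)
Definition sobolev (s : R) (f : R -> R) : Prop :=
  f \in Lfun mu 2%:E /\ (sobolev_norm s f < +oo)%E.

(* For s > 1/2 every class in H^s(R) has exactly one continuous member, and
   pointwise values of the class refer to that member. *)
Definition sobolev_rep (s : R) (f : R -> R) : Prop :=
  sobolev s f /\ continuous f.

(* Curves t |-> u t, with u t x the value at time t and position x. *)

Definition sobolev_curve (s : R) (J : set R) (u : R -> R -> R) : Prop :=
  forall t, J t -> sobolev_rep s (u t).

Definition sobolev_continuous (s : R) (J : set R) (u : R -> R -> R) : Prop :=
  forall t0, J t0 ->
    sobolev_norm s (fun x => u t x - u t0 x) @[t --> within J (nbhs t0)] --> 0%E.

(* Derivative in the norm of H^s of a curve defined on J; it is one-sided when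
   t0 is an endpoint of J. *)
Definition is_sobolev_derive (s : R) (J : set R) (u : R -> R -> R) (t0 : R)
    (du : R -> R) : Prop :=
  sobolev_norm s (fun x => (u t x - u t0 x) / (t - t0) - du x)
    @[t --> within J t0^'] --> 0%E.

End Sobolev.

(* u is a solution with u in C([0,T]; H^s) and C^1((0,T); H^{s-3}), and ut is
   its time derivative, one-sided at t = 0.  As s - 3 > 1/2, the functions u t
   are of class C^3 and their x-derivatives are classical.  The equation is an
   identity in H^{s-3}, whence the a.e. quantifier. *)
Record benjamin_solution (R : realType) (T s : R) (u ut : R -> R -> R) : Prop :=
  BenjaminSolution {
    benjamin_mem : sobolev_curve s `[0, T] u ;
    benjamin_continuous : sobolev_continuous s `[0, T] u ;
    benjamin_derive_mem : sobolev_curve (s - 3) `[0, T[ ut ;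
    benjamin_derive : forall t : R, t \in `[0, T[ ->
      is_sobolev_derive (s - 3) `[0, T] u t (ut t) ;
    benjamin_derive_continuous : sobolev_continuous (s - 3) `]0, T[ ut ;
    benjamin_equation : forall t : R, t \in `[0, T[ ->
      {ae (@lebesgue_measure R), forall x,
        ut t x + hilbert ((u t)^`(2))%classic x + ((u t)^`(3))%classic x
          + u t x * ((u t)^`())%classic x = 0}
  }.

(* Main.v *)
Require Import Defs.
From mathcomp Require Import all_boot all_order all_algebra.
From mathcomp Require Import all_classical all_reals all_analysis.
From mathcomp Require Import complex measurable_realfun lebesgue_integral_under.
From mathcomp Require Import ring lra.

(* At t = 0 the two equations, subtracted on I, leave only the nonlocal term:
   f = u_xx - v_xx and its Hilbert transform both vanish on I.  Such an f is 0.
   Indeed, for x in I the duality between the Poisson kernel and its conjugate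
   gives, as the height of the kernel tends to 0, \int f(y) / (y - x) dy = 0.
   Expanding 1 / (y - x) in powers of 1 / (y - x0) around a fixed x0 in I, all
   moments of f(y) / (y - x0) with respect to z = 1 / (y - x0), which ranges over
   a bounded set since f = 0 near x0, vanish; by the Weierstrass theorem the
   continuous function z f(x0 + 1/z) may be used as a test function, which yields
   \int (f(y) / (y - x0))^2 dy = 0.  Hence u(0) = v(0), and the energy estimate
   d/dt ||u - v||^2 <= 3 C ||u - v||^2 together with Gronwall's inequality gives
   u = v at all times.

   On real functions the Fourier transform is replaced throughout by the Hartley
   transform \int cas(x y) f(y) dy with cas = cos + sin, which is real and, up to
   the factor 2 pi, an involution.  In terms of it d/dx is the multiplication by
   - x composed with the reflection x |-> - x, and the Hilbert transform is the
   multiplication by sgn(x) composed with the same reflection. *)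

Set Implicit Arguments.
Unset Strict Implicit.
Unset Printing Implicit Defensive.
Import Order.TTheory GRing.Theory Num.Theory.
Import numFieldNormedType.Exports.
Local Open Scope classical_set_scope.
Local Open Scope ring_scope.

(** * Integrable and square integrable functions *)

Section Integrals.
Context {R : realType}.
Notation mu := (@lebesgue_measure R).
Implicit Types (f g h : R -> R) (a b c : R).

(** The classical proof of the unique continuation step reads f + i Hf, with Hf the Hilbert
    transform, as the boundary value of a function holomorphic in a half-plane; the moments avoid
    complex function theory and ask of f only that it be bounded, continuous and in L^2. The
    threshold s > 7/2 says that (1 + x^2)^(3 - s) is integrable. By Cauchy-Schwarz, x^k times the
    transform of u(t) is then integrable for k <= 3, so that u(t) has three classical derivatives,
    and u, u_x, u_xx are bounded in terms of the H^s norm; this also yields the constant C of the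
    energy estimate. Transforms on L^2 are representatives chosen by [xget], hence their identities
    hold almost everywhere only; pointwise equalities are recovered from continuity. Hartley
    inversion rests on the Abel weight exp(- e |x|), which turns the divergent integrals of products
    of cas into the Poisson kernel. The same weight with an extra factor sgn produces the conjugate
    kernel, so one computation serves both inversion and unique continuation. *)

Definition L1 f : Prop := mu.-integrable setT (EFin \o f).
(** Measurability is a separate conjunct because a function with integrable square need not be
    measurable. *)
Definition L2 f : Prop := measurable_fun setT f /\ L1 (fun x => f x ^+ 2).

Lemma aeS (P Q : R -> Prop) : (forall x, P x -> Q x) ->
  {ae mu, forall x, P x} -> {ae mu, forall x, Q x}.
Proof.
move=> PQ; apply: filterS; first exact: (ae_filter_ringOfSetsType mu).
exact: PQ.
Qed.

Lemma aeS2 (P Q S : R -> Prop) : (forall x, P x -> Q x -> S x) ->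
  {ae mu, forall x, P x} -> {ae mu, forall x, Q x} -> {ae mu, forall x, S x}.
Proof.
move=> PQS; apply: filterS2; first exact: (ae_filter_ringOfSetsType mu).
exact: PQS.
Qed.

Lemma aeT (P : R -> Prop) : (forall x, P x) -> {ae mu, forall x, P x}.
Proof. by move=> h; apply: (aeS _ (ae_eq_refl mu setT (fun=> 0 : R))) => x _. Qed.

Lemma L1_measurable f : L1 f -> measurable_fun setT f.
Proof. by move=> /integrableP[/measurable_EFinP]. Qed.

Lemma L1_emeasurable f : L1 f -> measurable_fun setT (EFin \o f).
Proof. by move=> /integrableP[]. Qed.

Lemma le_L1 f g : measurable_fun setT f -> L1 g ->
  (forall x, `|f x| <= g x) -> L1 f.
Proof.
move=> mf ig fg; apply: (le_integrable _ _ _ ig) => //.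
  exact/measurable_EFinP.
by move=> x _ /=; rewrite lee_fin (le_trans (fg x))// ler_norm.
Qed.

Lemma L1D f g : L1 f -> L1 g -> L1 (fun x => f x + g x).
Proof. by move=> f1 g1; exact: (integrableD measurableT f1 g1). Qed.

Lemma L1B f g : L1 f -> L1 g -> L1 (fun x => f x - g x).
Proof. by move=> f1 g1; exact: (integrableB measurableT f1 g1). Qed.

Lemma L1Z c f : L1 f -> L1 (fun x => c * f x).
Proof. by move=> f1; exact: (integrableZl measurableT c f1). Qed.

Lemma L1N f : L1 f -> L1 (fun x => - f x).
Proof.
move=> /(L1Z (-1)); congr L1; apply/funext => x; exact: mulN1r.
Qed.

Lemma L1_norm f : L1 f -> L1 (fun x => `|f x|).
Proof. exact: integrable_norm. Qed.

Lemma L1M_bounded c g f : measurable_fun setT g -> (forall x, `|g x| <= c) ->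
  L1 f -> L1 (fun x => g x * f x).
Proof.
move=> mg gc f1; apply: (@le_L1 _ (fun x => c * `|f x|)).
- by apply: measurable_funM => //; exact: L1_measurable.
- exact/L1Z/L1_norm.
- by move=> x; rewrite normrM ler_wpM2r.
Qed.

Lemma L1_0 : L1 (fun=> 0).
Proof. exact: (integrable0 mu setT). Qed.

Lemma intD f g : L1 f -> L1 g ->
  \int[mu]_x (f x + g x) = \int[mu]_x f x + \int[mu]_x g x.
Proof. by move=> f1 g1; rewrite RintegralD. Qed.

Lemma intB f g : L1 f -> L1 g ->
  \int[mu]_x (f x - g x) = \int[mu]_x f x - \int[mu]_x g x.
Proof. by move=> f1 g1; rewrite RintegralB. Qed.

Lemma intZ c f : L1 f -> \int[mu]_x (c * f x) = c * \int[mu]_x f x.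
Proof. by move=> f1; rewrite RintegralZl. Qed.

Lemma intN f : L1 f -> \int[mu]_x (- f x) = - \int[mu]_x f x.
Proof.
by move=> f1; rewrite -mulN1r -intZ//; apply: eq_Rintegral => x _; rewrite mulN1r.
Qed.

Lemma int0 : \int[mu]_x (0 : R) = 0.
Proof. by rewrite /Rintegral integral0. Qed.

Lemma le_int f g : L1 f -> L1 g -> (forall x, f x <= g x) ->
  \int[mu]_x f x <= \int[mu]_x g x.
Proof. by move=> f1 g1 fg; exact: le_Rintegral. Qed.

Lemma int_ge0 f : (forall x, 0 <= f x) -> 0 <= \int[mu]_x f x.
Proof. by move=> f0; exact: Rintegral_ge0. Qed.

Lemma le_norm_int f : L1 f -> `|\int[mu]_x f x| <= \int[mu]_x `|f x|.
Proof. by move=> f1; exact: le_normr_Rintegral. Qed.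

Lemma intE f : L1 f -> (\int[mu]_x (f x)%:E)%E = (\int[mu]_x f x)%:E.
Proof. by move=> f1; rewrite fineK//; exact: integrable_fin_num. Qed.

Lemma ae_eq_int f g : measurable_fun setT f -> measurable_fun setT g ->
  {ae mu, forall x, f x = g x} -> \int[mu]_x f x = \int[mu]_x g x.
Proof.
move=> mf mg fg; congr fine; apply: ae_eq_integral => //.
- exact/measurable_EFinP.
- exact/measurable_EFinP.
- by apply: (aeS _ fg) => x /= ->.
Qed.

Lemma ae_eq_L1 f g : measurable_fun setT g ->
  {ae mu, forall x, f x = g x} -> L1 f -> L1 g.
Proof.
move=> mg fg /integrableP[mf lf]; apply/integrableP; split.
  exact/measurable_EFinP.
rewrite (le_lt_trans _ lf)// le_eqVlt; apply/orP; left; apply/eqP.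
apply: ae_eq_integral => //.
- by apply: measurableT_comp => //; exact/measurable_EFinP.
- exact: measurableT_comp.
- by apply: (aeS _ fg) => x /= ->.
Qed.

Lemma ge0_L1 f c : measurable_fun setT f -> (forall x, 0 <= f x) ->
  (\int[mu]_x (f x)%:E <= c%:E)%E -> L1 f.
Proof.
move=> mf f0 fc; apply/integrableP; split; first exact/measurable_EFinP.
under eq_integral do rewrite /= ger0_norm ?f0//.
by rewrite (le_lt_trans fc)// ltry.
Qed.

Lemma int_eq0_ae f : L1 f -> (forall x, 0 <= f x) -> \int[mu]_x f x = 0 ->
  {ae mu, forall x, f x = 0}.
Proof.
move=> f1 f0 if0.
have if0' : (\int[mu]_x `|(f x)%:E| = 0)%E.
  under eq_integral do rewrite /= ger0_norm ?f0//.
  by rewrite intE// if0.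
have mf : measurable_fun setT (EFin \o f).
  apply/measurable_EFinP.
  apply: L1_measurable f1.
have := (ae_eq_integral_abs mu measurableT mf).1 if0'.
by apply: aeS => x fx; apply: EFin_inj; exact: fx.
Qed.

Lemma dominated_cvg_int (fn : nat -> R -> R) f g :
  (forall n, measurable_fun setT (fn n)) -> measurable_fun setT f -> L1 g ->
  {ae mu, forall x, fn n x @[n --> \oo] --> f x} ->
  (forall n x, `|fn n x| <= g x) ->
  L1 f /\ \int[mu]_x fn n x @[n --> \oo] --> \int[mu]_x f x.
Proof.
move=> mfn mf g1 fnf fng.
have [] := @dominated_convergence _ _ _ mu setT measurableT
  (fun n => EFin \o fn n) (EFin \o f) (EFin \o g).
- by move=> n; apply/measurable_EFinP; exact: mfn.
- by apply/measurable_EFinP; exact: mf.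
- by apply: (aeS _ fnf) => x fx _; apply: cvg_EFin => //; exact: nearW.
- exact: g1.
- by apply: aeT => x n _; rewrite /= lee_fin.
move=> f1 _ cvgi; split; first exact: f1.
apply: fine_cvg; rewrite fineK//; exact: integrable_fin_num.
Qed.

(** Replaces dominated convergence where no majorant is at hand: for the mass of the Poisson kernel,
    the Bessel inequality and the completeness of L^2. *)
Lemma fatou_int (fn : nat -> R -> R) f c :
  (forall n, L1 (fn n)) -> (forall n x, 0 <= fn n x) ->
  measurable_fun setT f -> (forall x, 0 <= f x) ->
  {ae mu, forall x, fn n x @[n --> \oo] --> f x} ->
  (forall n, \int[mu]_x fn n x <= c) -> L1 f /\ \int[mu]_x f x <= c.
Proof.
move=> fn1 fn0 mf f0 fnf ifn.
suff H : (\int[mu]_x (f x)%:E <= c%:E)%E.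
  have f1 := ge0_L1 mf f0 H; split => //.
  by rewrite -lee_fin -intE.
have -> : (\int[mu]_x (f x)%:E = \int[mu]_x limn_einf (fun n => (fn n x)%:E))%E.
  apply: ae_eq_integral => //.
  - exact/measurable_EFinP.
  - apply: measurableT_comp => //; apply: measurable_fun_limn_esup => n.
    by apply: measurableT_comp => //; exact: L1_emeasurable.
  - apply: (aeS _ fnf) => x fx _.
    have H : (fn n x)%:E @[n --> \oo] --> (f x)%:E.
      by apply: cvg_EFin => //; exact: nearW.
    rewrite is_cvg_limn_einfE//; last by apply/cvg_ex; exists (f x)%:E.
    by apply/esym/cvg_lim.
apply: le_trans; first apply: fatou => //.
- by move=> n; exact: L1_emeasurable.
- by move=> n x _; rewrite lee_fin.
rewrite limn_einf_lim; apply: lime_le.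
  exact: is_cvg_einfs.
near=> n; rewrite /einfs; apply: le_trans (_ : ((\int[mu]_x fn n x)%:E <= _)%E).
  by rewrite -intE//; apply: ereal_inf_lbound; exists n => //=.
by rewrite lee_fin.
Unshelve. all: by end_near. Qed.

End Integrals.

(** * Double integrals and the reflection x |-> - x *)

Section Fubini.
Context {R : realType}.
Notation mu := (@lebesgue_measure R).
Notation RM := (measurableTypeR R).

(** Tonelli makes the integrals of the positive and of the negative part measurable in x; their
    difference is measurable whatever its value where both are infinite. *)
Lemma measurable_int_kernel (F : RM * RM -> R) : measurable_fun setT F ->
  measurable_fun setT (fun x : R => \int[mu]_y F (x, y)).
Proof.
move=> mF; apply: measurableT_comp => //=.
have mF' : measurable_fun setT (EFin \o F) by exact/measurable_EFinP.
have mp := measurable_fun_fubini_tonelli_F (m2 := mu) _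
  (measurable_funepos mF') (fun z => funepos_ge0 _ z).
have mn := measurable_fun_fubini_tonelli_F (m2 := mu) _
  (measurable_funeneg mF') (fun z => funeneg_ge0 _ z).
apply: eq_measurable_fun (emeasurable_funB mp mn) => x _.
rewrite /= [RHS]integralE; congr (_ - _)%E; apply: eq_integral => y _.
- exact: (congr1 (@^~ y) (esym (funepos_comp (EFin \o F) (pair x)))).
- exact: (congr1 (@^~ y) (esym (funeneg_comp (EFin \o F) (pair x)))).
Qed.

(** The product integrand is dominated by c |f(x)| |g(y)|, which is integrable on the plane. *)
Lemma fubini_bounded (f g : R -> R) (k : RM * RM -> R) c : L1 f -> L1 g ->
  measurable_fun setT k -> (forall z, `|k z| <= c) ->
  \int[mu]_x (f x * \int[mu]_y (k (x, y) * g y)) =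
  \int[mu]_y (g y * \int[mu]_x (k (x, y) * f x)).
Proof.
move=> f1 g1 mk kc.
have mf := L1_measurable f1; have mg := L1_measurable g1.
have mkx x : measurable_fun setT (fun y : R => k (x, y)) by exact: measurableT_comp.
have mky y : measurable_fun setT (fun x : R => k (x, y)) by exact: measurableT_comp.
have kg1 x : L1 (fun y => k (x, y) * g y) by exact: (L1M_bounded (c := c)).
have kf1 y : L1 (fun x => k (x, y) * f x) by exact: (L1M_bounded (c := c)).
pose F (z : RM * RM) := f z.1 * (k z * g z.2).
have mF : measurable_fun setT F.
  apply: measurable_funM; first exact: measurableT_comp.
  by apply: measurable_funM => //; exact: measurableT_comp.
have iF : (mu \x mu)%E.-integrable setT (EFin \o F).
  apply/integrable12ltyP; first exact/measurable_EFinP.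
  have H x : (\int[mu]_y `|(EFin \o F) (x, y)| <=
      (`|f x| * (c * \int[mu]_y `|g y|))%:E)%E.
    have kg1' := L1_norm (kg1 x).
    under eq_integral do rewrite /F /= normrM.
    rewrite intE; last exact: L1Z.
    rewrite lee_fin intZ// ler_wpM2l// -intZ; last exact: L1_norm.
    apply: le_int => //; first exact/L1Z/L1_norm.
    by move=> y; rewrite normrM ler_wpM2r.
  have fg1 : L1 (fun x => `|f x| * (c * \int[mu]_y `|g y|)).
    have := L1Z (c * \int[mu]_y `|g y|) (L1_norm f1).
    by congr L1; apply/funext => x; rewrite mulrC.
  apply: le_lt_trans (_ : (\int[mu]_x (`|f x| * (c * \int[mu]_y `|g y|))%:E < +oo)%E).
    apply: ge0_le_integral => //.
    - by move=> x _; exact: integral_ge0.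
    - apply: (measurable_fun_fubini_tonelli_F (m2 := mu) (abse \o (EFin \o F))) => [|z].
        by apply: measurableT_comp => //; exact/measurable_EFinP.
      exact: abse_ge0.
    - exact: L1_emeasurable fg1.
  by rewrite intE// ltry.
have := Fubini iF.
rewrite (_ : (fun x => _) = fun x => (f x * \int[mu]_y (k (x, y) * g y))%:E)%E; last first.
  apply/funext => x; rewrite -[RHS]/(EFin _) -intZ// -intE//.
  exact: L1Z.
rewrite [in RHS](_ : (fun y => _) = fun y => (g y * \int[mu]_x (k (x, y) * f x))%:E)%E; last first.
  apply/funext => y; rewrite -[RHS]/(EFin _) -intZ// -intE; last exact: L1Z.
  by apply: eq_integral => x _; rewrite /F /= mulrCA mulrA mulrC.
by move=> H; congr fine.
Qed.

Lemma tonelli_real (k : RM * RM -> R) : measurable_fun setT k -> (forall z, 0 <= k z) ->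
  (\int[mu]_x \int[mu]_y (k (x, y))%:E = \int[mu]_y \int[mu]_x (k (x, y))%:E)%E.
Proof.
move=> mk k0.
by apply: (@fubini_tonelli _ _ _ _ _ mu mu (EFin \o k)) => //; exact/measurable_EFinP.
Qed.

Lemma ge0_int_opp (g : R -> \bar R) : measurable_fun setT g ->
  (forall x, 0 <= g x)%E -> (\int[mu]_x g (- x)%R = \int[mu]_x g x)%E.
Proof.
move=> mg g0; have mN : measurable_fun setT (-%R : RM -> RM) by exact: oppr_measurable.
transitivity (\int[pushforward mu (-%R : RM -> RM)]_y g y)%E; last first.
  by apply: eq_measure_integral => //= A mA AS; exact: lebesgue_measureN.
by rewrite (@ge0_integral_pushforward _ _ RM RM R (-%R : RM -> RM) mN mu setT g).
Qed.

Lemma int_opp (f : R -> R) : measurable_fun setT f ->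
  \int[mu]_x f (- x) = \int[mu]_x f x.
Proof.
move=> mf.
suff H (g : R -> \bar R) : measurable_fun setT g -> (forall x, 0 <= g x)%E ->
    (\int[mu]_x g (- x)%R = \int[mu]_x g x)%E.
  have mf' : measurable_fun setT (EFin \o f) by exact/measurable_EFinP.
  congr fine; rewrite integralE [in RHS]integralE.
  rewrite -(H ((EFin \o f)^\+)%E)//; last exact: measurable_funepos.
  rewrite -(H ((EFin \o f)^\-)%E)//; last exact: measurable_funeneg.
  congr (_ - _)%E; apply: eq_integral => x _.
  - exact: (congr1 (@^~ x) (funepos_comp (EFin \o f) (@GRing.opp R))).
  - exact: (congr1 (@^~ x) (funeneg_comp (EFin \o f) (@GRing.opp R))).
exact: ge0_int_opp.
Qed.

Lemma L1_opp (f : R -> R) : L1 f -> L1 (fun x => f (- x)).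
Proof.
move=> f1; have mf := L1_measurable f1.
have mfo : measurable_fun setT (fun x : R => f (- x)) by exact: measurableT_comp.
apply/integrableP; split; first exact/measurable_EFinP.
suff -> : (\int[mu]_x `|(f (- x))%:E| = \int[mu]_x `|(f x)%:E|)%E.
  by case/integrableP: f1.
apply: (ge0_int_opp (g := fun x => `|(f x)%:E|%E)) => //.
by apply: measurableT_comp => //; exact/measurable_EFinP.
Qed.

End Fubini.

(** * Inequalities and convergence in L^2 *)

Section L2theory.
Context {R : realType}.
Notation mu := (@lebesgue_measure R).
Implicit Types (f g h : R -> R) (a b c : R).

Lemma le_L2 f g : measurable_fun setT f -> L2 g ->
  (forall x, `|f x| <= `|g x|) -> L2 f.
Proof.
move=> mf [mg g2] fg; split => //; apply: le_L1 g2 _.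
  exact: measurable_funX.
move=> x; rewrite ger0_norm ?sqr_ge0// -(real_normK (num_real (f x))).
by rewrite -(real_normK (num_real (g x))) ler_sqr ?nnegrE.
Qed.

Lemma L2M f g : L2 f -> L2 g -> L1 (fun x => f x * g x).
Proof.
move=> [mf f2] [mg g2]; apply: le_L1 (L1D f2 g2) _; first exact: measurable_funM.
move=> x; rewrite ler_norml; apply/andP; split; nra.
Qed.

Lemma L2Z c f : L2 f -> L2 (fun x => c * f x).
Proof.
move=> [mf f2]; split; first exact: measurable_funM.
have := L1Z (c ^+ 2) f2; congr L1; apply/funext => x; exact/esym/exprMn.
Qed.

Lemma L2D f g : L2 f -> L2 g -> L2 (fun x => f x + g x).
Proof.
move=> f2 g2; split; first by apply: measurable_funD; [case: f2|case: g2].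
have := L1D (L1D (proj2 f2) (proj2 g2)) (L1Z 2 (L2M f2 g2)).
congr L1; apply/funext => x; ring.
Qed.

Lemma L2N f : L2 f -> L2 (fun x => - f x).
Proof. by move=> /(L2Z (-1)); congr L2; apply/funext => x; rewrite mulN1r. Qed.

Lemma L2B f g : L2 f -> L2 g -> L2 (fun x => f x - g x).
Proof. by move=> f2 g2; apply: L2D => //; exact: L2N. Qed.

Lemma L2_0 : L2 (fun=> 0 : R).
Proof.
split; first exact: measurable_cst.
by have := @L1_0 R; congr L1; apply/funext => x; rewrite expr0n.
Qed.

Lemma L2M_bounded c g f : measurable_fun setT g -> (forall x, `|g x| <= c) ->
  L2 f -> L2 (fun x => g x * f x).
Proof.
move=> mg gc f2; apply: le_L2 (L2Z c f2) _.
  by apply: measurable_funM => //; case: f2.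
move=> x; rewrite !normrM ler_wpM2r// (le_trans (gc x))// ler_norm//.
Qed.

Lemma L2_opp f : L2 f -> L2 (fun x => f (- x)).
Proof.
move=> [mf f2]; split; first exact: measurableT_comp.
exact: (L1_opp f2).
Qed.

Lemma L2_bounded_L1 c f : measurable_fun setT f -> (forall x, `|f x| <= c) ->
  L1 f -> L2 f.
Proof. by move=> mf fc f1; split => //; exact: (L1M_bounded mf fc f1). Qed.

Lemma ae_eq_L2 f g : measurable_fun setT g ->
  {ae mu, forall x, f x = g x} -> L2 f -> L2 g.
Proof.
move=> mg fg [mf f2]; split => //; apply: ae_eq_L1 f2; first exact: measurable_funX.
by apply: aeS fg => x ->.
Qed.

Lemma int_sqr_ge0 f : 0 <= \int[mu]_x f x ^+ 2.
Proof. by apply: int_ge0 => x; exact: sqr_ge0. Qed.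

(** The quadratic t |-> int (f + t g)^2 is nonnegative; its value at the minimum t = - C / B is (A B
    - C^2) / B. *)
Lemma cauchy_schwarz_sqr f g : L2 f -> L2 g ->
  (\int[mu]_x (f x * g x)) ^+ 2 <= (\int[mu]_x f x ^+ 2) * (\int[mu]_x g x ^+ 2).
Proof.
move=> f2 g2; set A := \int[mu]_x f x ^+ 2; set B := \int[mu]_x g x ^+ 2.
set C := \int[mu]_x (f x * g x).
have A0 : 0 <= A by exact: int_sqr_ge0.
have B0 : 0 <= B by exact: int_sqr_ge0.
have H t : 0 <= A + 2 * t * C + t ^+ 2 * B.
  have -> : A + 2 * t * C + t ^+ 2 * B = \int[mu]_x (f x + t * g x) ^+ 2.
    rewrite -(intZ (t ^+ 2) (proj2 g2)) -(intZ (2 * t) (L2M f2 g2)).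
    rewrite -intD; [|by case: f2|exact: L1Z (L2M f2 g2)].
    rewrite -intD; last 2 first.
    - by apply: L1D; [case: f2|exact: L1Z (L2M f2 g2)].
    - by apply: L1Z; case: g2.
    by apply: eq_Rintegral => x _; ring.
  exact: (int_sqr_ge0 (fun x => f x + t * g x)).
have [B_0|B_n0] := eqVneq B 0.
  rewrite B_0 mulr0; have [C0|Cn0] := eqVneq C 0; first by rewrite C0 expr0n.
  (* With B = 0 the quadratic is affine, and at this t it would equal - 1. *)
  have := H (- (A + 1) / (2 * C)); rewrite B_0 mulr0 addr0.
  have -> : 2 * (- (A + 1) / (2 * C)) * C = - (A + 1) by field.
  lra.
have Bp : 0 < B by rewrite lt_def B_n0.
have := H (- C / B).
have -> : A + 2 * (- C / B) * C + (- C / B) ^+ 2 * B = (A * B - C ^+ 2) / B by field.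
by rewrite pmulr_lge0 ?invr_gt0// subr_ge0.
Qed.

Lemma cauchy_schwarz f g : L2 f -> L2 g ->
  `|\int[mu]_x (f x * g x)| <=
  Num.sqrt (\int[mu]_x f x ^+ 2) * Num.sqrt (\int[mu]_x g x ^+ 2).
Proof.
move=> f2 g2; rewrite -sqrtrM ?int_sqr_ge0// -sqrtr_sqr ler_wsqrtr//.
exact: cauchy_schwarz_sqr.
Qed.

(** Takes the place of the triangle inequality, since L^2 limits are stated through integrals of
    squares rather than norms. *)
Lemma int_sqrD_le f g : L2 f -> L2 g ->
  \int[mu]_x (f x + g x) ^+ 2 <=
  2 * (\int[mu]_x f x ^+ 2 + \int[mu]_x g x ^+ 2).
Proof.
move=> f2 g2; rewrite -intD; [|by case: f2|by case: g2].
rewrite -intZ; last by apply: L1D; [case: f2|case: g2].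
apply: le_int; first by case: (L2D f2 g2).
  by apply: L1Z; apply: L1D; [case: f2|case: g2].
move=> x /=; rewrite -subr_ge0 (_ : _ - _ = (f x - g x) ^+ 2) ?sqr_ge0//; ring.
Qed.

Lemma int_sqrB_le f g h : L2 f -> L2 g -> L2 h ->
  \int[mu]_x (f x - g x) ^+ 2 <=
  2 * (\int[mu]_x (h x - f x) ^+ 2 + \int[mu]_x (h x - g x) ^+ 2).
Proof.
move=> f2 g2 h2.
rewrite (_ : \int[mu]_x (f x - g x) ^+ 2 =
    \int[mu]_x ((f x - h x) + (h x - g x)) ^+ 2); last first.
  by apply: eq_Rintegral => x _; ring.
apply: le_trans (int_sqrD_le (L2B f2 h2) (L2B h2 g2)) _.
rewrite (_ : \int[mu]_x (h x - f x) ^+ 2 = \int[mu]_x (f x - h x) ^+ 2)//.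
by apply: eq_Rintegral => x _; ring.
Qed.

Lemma int_sqr_eq0 f : L2 f -> \int[mu]_x f x ^+ 2 = 0 -> {ae mu, forall x, f x = 0}.
Proof.
move=> [mf f2] /(int_eq0_ae f2 (fun x => sqr_ge0 _)).
by apply: aeS => x /eqP; rewrite sqrf_eq0 => /eqP.
Qed.

Section filter.
Context {T : Type} {F : set_system T} {FF : ProperFilter F}.
Implicit Types fn gn : T -> R -> R.

Lemma cvg2_unique fn f g : (\forall n \near F, L2 (fn n)) -> L2 f -> L2 g ->
  \int[mu]_x (fn n x - f x) ^+ 2 @[n --> F] --> 0 ->
  \int[mu]_x (fn n x - g x) ^+ 2 @[n --> F] --> 0 ->
  {ae mu, forall x, f x = g x}.
Proof.
move=> fn2 f2 g2 ff fg.
suff : \int[mu]_x (f x - g x) ^+ 2 = 0.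
  move=> /(int_sqr_eq0 (L2B f2 g2)); apply: aeS => x /eqP.
  by rewrite subr_eq0 => /eqP.
apply/eqP; rewrite eq_le (int_sqr_ge0 (fun x => f x - g x)) andbT.
have : 2 * (\int[mu]_x (fn n x - f x) ^+ 2 + \int[mu]_x (fn n x - g x) ^+ 2)
    @[n --> F] --> (2 * (0 + 0) : R).
  by apply: cvgMl_tmp; apply: cvgD.
rewrite addr0 mulr0 => H.
apply: (cvgr_to_ge H).
by apply: filterS fn2 => n fn2; exact: int_sqrB_le.
Qed.

(** Write fn gn - f g = (fn - f)(gn - g) + (fn - f) g + f (gn - g) and apply Cauchy-Schwarz to each
    term. The filter is arbitrary because limits are taken both along truncations n and along times
    t. *)
Lemma cvg2_inner fn f gn g : (\forall n \near F, L2 (fn n) /\ L2 (gn n)) -> L2 f -> L2 g ->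
  \int[mu]_x (fn n x - f x) ^+ 2 @[n --> F] --> 0 ->
  \int[mu]_x (gn n x - g x) ^+ 2 @[n --> F] --> 0 ->
  \int[mu]_x (fn n x * gn n x) @[n --> F] --> \int[mu]_x (f x * g x).
Proof.
move=> fgn2 f2 g2 ff gg.
have Sf := cvg_comp _ _ ff (@sqrt_continuous R 0).
have Sg := cvg_comp _ _ gg (@sqrt_continuous R 0).
rewrite sqrtr0 in Sf Sg.
set nf := fun n => Num.sqrt (\int[mu]_x (fn n x - f x) ^+ 2) in Sf.
set ng := fun n => Num.sqrt (\int[mu]_x (gn n x - g x) ^+ 2) in Sg.
pose A := Num.sqrt (\int[mu]_x f x ^+ 2).
pose B := Num.sqrt (\int[mu]_x g x ^+ 2).
apply/subr_cvg0; apply: norm_cvg0.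
apply: (@squeeze_cvgr _ _ _ _ (fun=> 0) (fun n => nf n * ng n + nf n * B + A * ng n)).
- apply: filterS fgn2 => n [fn2 gn2]; rewrite normr_ge0/=.
  have df := L2B fn2 f2; have dg := L2B gn2 g2.
  rewrite -intB; [|exact: L2M|exact: L2M].
  rewrite (_ : \int[mu]_x _ = \int[mu]_x ((fn n x - f x) * (gn n x - g x) +
      (fn n x - f x) * g x + f x * (gn n x - g x))); last first.
    by apply: eq_Rintegral => x _; ring.
  rewrite intD; [|by apply: L1D; exact: L2M|exact: L2M].
  rewrite intD; [|exact: L2M|exact: L2M].
  apply: le_trans (ler_normD _ _) _; apply: lerD; last exact: cauchy_schwarz.
  apply: le_trans (ler_normD _ _) _; apply: lerD; exact: cauchy_schwarz.
- exact: cvg_cst.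
- rewrite (_ : nbhs 0 = nbhs (0 * 0 + 0 * B + A * 0)); last by rewrite !mul0r mulr0 !addr0.
  apply: cvgD; first apply: cvgD.
  + exact: cvgM.
  + exact: cvgMr_tmp.
  + exact: cvgMl_tmp.
Qed.

Lemma cvg2_norm fn f : (\forall n \near F, L2 (fn n)) -> L2 f ->
  \int[mu]_x (fn n x - f x) ^+ 2 @[n --> F] --> 0 ->
  \int[mu]_x fn n x ^+ 2 @[n --> F] --> \int[mu]_x f x ^+ 2.
Proof.
move=> fn2 f2 ff; have := @cvg2_inner fn f fn f; apply => //.
by apply: filterS fn2.
Qed.

End filter.
End L2theory.

(** * Integration over intervals and half-lines *)

Section OneDim.
Context {R : realType}.
Notation mu := (@lebesgue_measure R).
Implicit Types (f g h : R -> R) (a b c x y z e : R).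

Definition box a b : R -> R := \1_(`[a, b]%classic).

Lemma boxE a b x : box a b x = (a <= x <= b)%R%:R.
Proof. by rewrite /box indicE mem_setE in_itv. Qed.

Lemma measurable_box a b : measurable_fun setT (box a b).
Proof. exact: measurable_indic. Qed.

Lemma box_ge0 a b x : 0 <= box a b x.
Proof. by rewrite boxE ler0n. Qed.

Lemma box_le1 a b x : box a b x <= 1.
Proof. by rewrite boxE lern1 leq_b1. Qed.

Lemma norm_box_le1 a b x : `|box a b x| <= 1.
Proof. by rewrite ger0_norm ?box_ge0// box_le1. Qed.

Lemma int_box a b f :
  \int[mu]_(x in `[a, b]) f x = \int[mu]_x (box a b x * f x).
Proof.
rewrite Rintegral_mkcond; apply: eq_Rintegral => x _.
by rewrite patch_indic /= mulrC.
Qed.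

Lemma L1_box a b : L1 (box a b).
Proof.
apply/integrable_indic_itv.
Qed.

Lemma L2_box a b : L2 (box a b).
Proof.
exact: (L2_bounded_L1 (@measurable_box a b) (@norm_box_le1 a b) (@L1_box a b)).
Qed.

Lemma L1_box_continuous a b f : continuous f -> L1 (fun x => box a b x * f x).
Proof.
move=> cf.
have : mu.-integrable `[a, b] (EFin \o f).
  apply: continuous_compact_integrable; first exact: segment_compact.
  exact: continuous_subspaceT.
rewrite integrable_mkcond//; congr (mu.-integrable _ _).
apply/funext => x; rewrite /= restrict_EFin/= patch_indic /= mulrC//.
Qed.

Lemma aeN0 a : {ae mu, forall x, x != a}.
Proof.
exists [set a]; split => //; first exact: lebesgue_measure_set1.
by move=> x /= /negP; rewrite negbK => /eqP.
Qed.

Lemma FTC_box f F a b : a <= b -> continuous f ->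
  (forall x, is_derive x 1 F (f x)) ->
  \int[mu]_x (box a b x * f x) = F b - F a.
Proof.
rewrite le_eqVlt => /predU1P[->|ab] cf dF.
  (* For a = b the box is the indicator of a single point, a null set. *)
  rewrite subrr -[RHS]int0; apply: ae_eq_int.
  - by apply: measurable_funM; [exact: measurable_box|exact: continuous_measurable_fun].
  - exact: measurable_cst.
  - apply: aeS (aeN0 b) => x xb; rewrite boxE.
    case: (leP b x) => [bx|]; last by rewrite /= mul0r.
    by rewrite (leNgt x b) lt_neqAle eq_sym xb bx/= mul0r.
have cF : continuous F.
  by move=> x; apply: differentiable_continuous; apply/derivable1_diffP; case: (dF x).
rewrite -int_box /Rintegral (@continuous_FTC2 _ f F)//.
- exact: continuous_subspaceT.
- split; [|exact/cvg_at_right_filter/cF|exact/cvg_at_left_filter/cF].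
  by move=> x _; case: (dF x).
- by move=> x _; rewrite derive1E; case: (dF x).
Qed.

Lemma measurable_sgr : measurable_fun setT (@Num.sg R).
Proof.
rewrite (_ : Num.sg = (fun x : R => \1_(`]0, +oo[%classic) x - \1_(`]-oo, 0[%classic) x)).
  by apply: measurable_funB; exact: measurable_indic.
apply/funext => x; rewrite !indicE !mem_setE !in_itv/= andbT.
by case: sgrP => _; rewrite ?subr0 ?sub0r.
Qed.

(** Folds the line onto the half-line: (1 + sgn x) / 2 is the indicator of the positive reals, up to
    the value 1/2 at 0. Integrals over the half-line thus remain integrals over R. *)
Lemma int_sgn_split f : L1 f ->
  \int[mu]_x f x = \int[mu]_x ((1 + Num.sg x) / 2 * (f x + f (- x))).
Proof.
move=> f1.
have msg : measurable_fun setT (@Num.sg R) by exact: measurable_sgr.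
have H (s : R) : `|s| <= 1 -> L1 (fun x => (1 + s * Num.sg x) / 2 * f x).
  move=> s1; apply: (L1M_bounded (c := 1)) => //.
    by apply: measurable_funM => //; apply: measurable_funD => //; exact: measurable_funM.
  move=> x; rewrite normrM (_ : `|2^-1| = 2^-1); last by rewrite ger0_norm.
  rewrite ler_pdivrMr// mul1r (le_trans (ler_normD _ _))// normr1.
  have : `|s * Num.sg x| <= 1.
    by rewrite normrM normr_sg; case: (_ == _) => /=; rewrite ?mulr1 ?mulr0.
  lra.
have Hp : L1 (fun x => (1 + 1 * Num.sg x) / 2 * f x).
  by apply: H; rewrite normr1.
have Hm : L1 (fun x => (1 + (-1) * Num.sg x) / 2 * f x).
  by apply: H; rewrite normrN1.
rewrite -[LHS](_ : \int[mu]_x ((1 + 1 * Num.sg x) / 2 * f x +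
   (1 + (-1) * Num.sg x) / 2 * f x) = _); last first.
  by apply: eq_Rintegral => x _; field.
rewrite intD// -[X in _ + X]int_opp; last exact: L1_measurable Hm.
rewrite -intD//; last exact: (L1_opp Hm).
by apply: eq_Rintegral => x _; rewrite sgrN; ring.
Qed.

Lemma cvg_nat_box f x : box (- n%:R) n%:R x * f x @[n --> \oo] --> f x.
Proof.
apply: cvg_near_cst; near=> n; rewrite boxE.
have : `|x| <= n%:R by near: n; exact: nbhs_infty_ger.
by rewrite ler_norml => ->; rewrite mul1r.
Unshelve. all: by end_near. Qed.

Lemma FTC_half f F g : continuous f -> (forall x, is_derive x 1 F (f x)) ->
  L1 g -> (forall x, 0 <= x -> `|f x| <= g x) ->
  F n%:R @[n --> \oo] --> 0 ->
  \int[mu]_x ((1 + Num.sg x) / 2 * f x) = - F 0.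
Proof.
move=> cf dF g1 fg F0.
have mf : measurable_fun setT f by exact: continuous_measurable_fun.
have [|||||_ H] := @dominated_cvg_int R (fun n x => box 0 n%:R x * f x)
  (fun x => (1 + Num.sg x) / 2 * f x) (fun x => `|g x|).
- by move=> n; apply: measurable_funM => //; exact: measurable_box.
- apply: measurable_funM => //; apply: measurable_funM => //.
  by apply: measurable_funD => //; exact: measurable_sgr.
- exact: L1_norm.
(* The point 0 is excluded, since there [box 0 n%:R] is 1 while (1 + sgn x) / 2 is 1/2. *)
- apply: aeS (aeN0 0) => x x0; apply: cvg_near_cst; near=> n.
  rewrite boxE; have xn : `|x| <= n%:R by near: n; exact: nbhs_infty_ger.
  have xn' : x <= n%:R := le_trans (ler_norm x) xn.
  have [x_gt0|x_lt0|x_0] := ltrgt0P x; last by rewrite x_0 eqxx in x0.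
  + have -> : (1 + Num.sg x) / 2 = 1 by rewrite gtr0_sg//; field.
    by rewrite xn'.
  + by rewrite ltr0_sg// subrr mul0r mul0r mul0r.
- move=> n x; rewrite boxE; case: (leP 0 x) => x0 /=; last by rewrite mul0r normr0.
  rewrite normrM; apply: le_trans (_ : 1 * `|f x| <= _).
    by rewrite ler_wpM2r//; case: (x <= _); rewrite ?normr1 ?normr0.
  by rewrite mul1r (le_trans (fg x x0))// ler_norm.
have {}H : F n%:R - F 0 @[n --> \oo] -->
    \int[mu]_x ((1 + Num.sg x) / 2 * f x).
  by apply: cvg_trans H; apply: near_eq_cvg; apply: nearW => n; rewrite (FTC_box _ cf dF).
have H0 : F n%:R - F 0 @[n --> \oo] --> (0 - F 0 : R).
  by apply: cvgB => //; exact: cvg_cst.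
by rewrite -[RHS]add0r; apply: (cvg_unique _ H H0).
Unshelve. all: by end_near. Qed.

(** An antiderivative on the positive half-line suffices, which covers functions of |x| such as
    [expw e] and (1 + |x|)^(- c). *)
Lemma even_FTC f F (l : R) : continuous f -> (forall x, 0 <= f x) ->
  (forall x, f (- x) = f x) -> (forall x, 0 < x -> is_derive x 1 F (f x)) ->
  F x @[x --> 0^'+] --> F 0 -> F x @[x --> +oo] --> l ->
  L1 f /\ \int[mu]_x f x = 2 * (l - F 0).
Proof.
move=> cf f0 fe dF F0 Fl.
have H : (\int[mu]_x (f x)%:E = (2 * (l - F 0))%:E)%E.
  rewrite ge0_symfun_integralT//; last by move=> x /=; rewrite fe.
  rewrite -set_itvcy (@ge0_continuous_FTC2y _ f F 0 l)//.
  - exact: continuous_subspaceT.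
  - by move=> x /dF[].
  - by move=> x; rewrite in_itv/= andbT => /dF[] ? dFx; rewrite derive1E.
split; last by rewrite /Rintegral H.
apply: (ge0_L1 (c := 2 * (l - F 0))) => //; last by rewrite H.
exact: continuous_measurable_fun.
Qed.

End OneDim.

(** * The Hartley transform *)

Section Kernels.
Context {R : realType}.
Notation mu := (@lebesgue_measure R).
Notation RM := (measurableTypeR R).
Implicit Types (f g h : R -> R) (a b c x y z e : R).

Definition cas x : R := cos x + sin x.

Lemma continuous_cas : continuous cas.
Proof. by move=> x; apply: cvgD; [exact: continuous_cos|exact: continuous_sin]. Qed.

Lemma norm_cas_le2 x : `|cas x| <= 2.
Proof.
rewrite (le_trans (ler_normD _ _))//.
have := cos_max x; have := sin_max x; lra.
Qed.

(** With arguments z x and z y, the cosine is even and the sine odd in z. Against an even weight in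
    z only the function of x - y survives. *)
Lemma casM x y : cas x * cas y = cos (x - y) + sin (x + y).
Proof. rewrite /cas cosB sinD; ring. Qed.

Lemma measurable_cas2 : measurable_fun setT (fun z : RM * RM => cas (z.1 * z.2)).
Proof.
apply: (measurableT_comp (f := cas)).
  exact: continuous_measurable_fun continuous_cas.
by apply: measurable_funM.
Qed.

Lemma measurable_casr x : measurable_fun setT (fun y : R => cas (x * y)).
Proof.
apply: (measurableT_comp (f := cas)).
  exact: continuous_measurable_fun continuous_cas.
exact: measurable_funM.
Qed.

(* Abel weight, regularizing the non-integrable products of cas. *)
Definition expw e x : R := expR (- (e * `|x|)).

Lemma continuous_expw e : continuous (expw e).
Proof.
move=> x; apply: (continuous_comp (f := fun x => - (e * `|x|)) (g := expR)).
  by apply: cvgN; apply: cvgMl_tmp; exact: norm_continuous.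
exact: continuous_expR.
Qed.

Lemma expw_ge0 e x : 0 <= expw e x. Proof. exact: expR_ge0. Qed.

Lemma expw_le1 e x : 0 <= e -> expw e x <= 1.
Proof. by move=> e0; rewrite -expR0 ler_expR oppr_le0 mulr_ge0. Qed.

Lemma is_derive_mull c x : is_derive x 1 (fun y : R => c * y) c.
Proof.
by rewrite -[X in is_derive _ _ _ X]mulr1; exact: (is_deriveZ (f := id) c (is_derive_id x 1)).
Qed.

Lemma is_derive_expM c x : is_derive x 1 (fun y => expR (c * y)) (c * expR (c * x)).
Proof.
have H := is_derive_mull c x.
by rewrite mulrC; exact: (is_derive1_comp (f := expR)).
Qed.

Lemma cvgy_expM e : 0 < e -> expR (- e * x) @[x --> +oo] --> (0 : R).
Proof.
move=> e0.
have H : e * x @[x --> +oo] --> +oo.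
  by apply: gt0_cvgMry => //; exact: cvg_id.
by have := cvg_comp _ _ H (@cvgr_expR R); apply: cvg_trans; apply: near_eq_cvg;
  apply: nearW => x /=; rewrite mulNr.
Qed.

Lemma L1_expw e : 0 < e -> L1 (expw e).
Proof.
move=> e0.
have [] // := @even_FTC R (expw e) (fun x => - e^-1 * expR (- e * x)) 0.
- exact: continuous_expw.
- by move=> x; exact: expw_ge0.
- by move=> x; rewrite /expw normrN.
- move=> x x0; have H := is_derive_expM (- e) x.
  apply: is_derive_eq.
  by rewrite /expw gtr0_norm// -mulNr /GRing.scale/=; field; rewrite gt_eqF.
- apply: cvg_at_right_filter; apply: cvgMl_tmp.
  apply: (continuous_comp (f := fun x => - e * x) (g := expR)).
    by apply: cvgMl_tmp; exact: cvg_id.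
  exact: continuous_expR.
- rewrite -[X in _ --> X](mulr0 (- e^-1)); apply: cvgMl_tmp; exact: cvgy_expM.
Qed.


(** The antiderivative is the real part of exp((i z - e) y) / (i z - e); the one in
    [is_derive_expsin] is its imaginary part. *)
Lemma is_derive_expcos e z x : 0 < e -> is_derive x 1
  (fun y => expR (- e * y) * (z * sin (z * y) - e * cos (z * y)) / (e ^+ 2 + z ^+ 2))
  (expR (- e * x) * cos (z * x)).
Proof.
move=> e0; have ez : e ^+ 2 + z ^+ 2 != 0 by rewrite gt_eqF// ltr_pwDl ?exprn_gt0// sqr_ge0.
have H1 := is_derive_expM (- e) x.
have H2 : is_derive x 1 (fun y => sin (z * y)) (cos (z * x) * z).
  exact: (is_derive1_comp (f := sin) (is_derive_sin _) (is_derive_mull z x)).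
have H3 : is_derive x 1 (fun y => cos (z * y)) (- sin (z * x) * z).
  exact: (is_derive1_comp (f := cos) (is_derive_cos _) (is_derive_mull z x)).
have H4 : is_derive x 1 (fun y => z * sin (z * y) - e * cos (z * y))
    (z * (cos (z * x) * z) - e * (- sin (z * x) * z)).
  exact: (is_deriveB (is_deriveZ z H2) (is_deriveZ e H3)).
have := is_deriveZ (e ^+ 2 + z ^+ 2)^-1 (is_deriveM H1 H4).
rewrite (_ : _ \*: _ = (fun y => expR (- e * y) *
    (z * sin (z * y) - e * cos (z * y)) / (e ^+ 2 + z ^+ 2))).
  by move=> /is_derive_eq; apply; rewrite /GRing.scale/=; field.
by apply/funext => y; rewrite [RHS]mulrC.
Qed.

Lemma is_derive_expsin e z x : 0 < e -> is_derive x 1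
  (fun y => - expR (- e * y) * (e * sin (z * y) + z * cos (z * y)) / (e ^+ 2 + z ^+ 2))
  (expR (- e * x) * sin (z * x)).
Proof.
move=> e0; have ez : e ^+ 2 + z ^+ 2 != 0 by rewrite gt_eqF// ltr_pwDl ?exprn_gt0// sqr_ge0.
have H1 := is_derive_expM (- e) x.
have H2 : is_derive x 1 (fun y => sin (z * y)) (cos (z * x) * z).
  exact: (is_derive1_comp (f := sin) (is_derive_sin _) (is_derive_mull z x)).
have H3 : is_derive x 1 (fun y => cos (z * y)) (- sin (z * x) * z).
  exact: (is_derive1_comp (f := cos) (is_derive_cos _) (is_derive_mull z x)).
have H4 : is_derive x 1 (fun y => e * sin (z * y) + z * cos (z * y))
    (e * (cos (z * x) * z) + z * (- sin (z * x) * z)).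
  exact: (is_deriveD (is_deriveZ e H2) (is_deriveZ z H3)).
have := is_deriveZ (- (e ^+ 2 + z ^+ 2)^-1) (is_deriveM H1 H4).
rewrite (_ : _ \*: _ = (fun y => - expR (- e * y) *
    (e * sin (z * y) + z * cos (z * y)) / (e ^+ 2 + z ^+ 2))).
  by move=> /is_derive_eq; apply; rewrite /GRing.scale/=; field.
apply/funext => y; rewrite -[LHS]/(- (e ^+ 2 + z ^+ 2)^-1 * (expR (- e * y) *
    (e * sin (z * y) + z * cos (z * y)))); ring.
Qed.

Lemma cvgn_expM e (b : nat -> R) c : 0 < e -> (forall n, `|b n| <= c) ->
  expR (- e * n%:R) * b n @[n --> \oo] --> (0 : R).
Proof.
move=> e0 bc; apply: norm_cvg0.
have H : expR (- e * n%:R) * c @[n --> \oo] --> (0 : R).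
  rewrite -[X in _ --> X](mul0r c); apply: cvgMr_tmp.
  by move: (cvgy_expM e0) => /cvg_pinftyP; apply; exact: cvgr_idn.
apply: (squeeze_cvgr _ (cvg_cst 0) H).
apply: nearW => n; rewrite normr_ge0/= normrM ger0_norm ?expR_ge0//.
by rewrite ler_wpM2l ?expR_ge0.
Qed.

Lemma int_half_expcos e z : 0 < e ->
  \int[mu]_x ((1 + Num.sg x) / 2 * (expR (- e * x) * cos (z * x))) =
  e / (e ^+ 2 + z ^+ 2).
Proof.
move=> e0.
rewrite (FTC_half _ (fun x => is_derive_expcos z x e0) (L1_expw e0)).
- by rewrite !mulr0 expR0 sin0 cos0 mulr0 mul1r mulr1 sub0r mulNr opprK.
- move=> x; apply: cvgM.
    apply: (continuous_comp (f := fun x => - e * x) (g := expR)).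
      by apply: cvgMl_tmp; exact: cvg_id.
    exact: continuous_expR.
  apply: (continuous_comp (f := fun x => z * x) (g := cos)).
    by apply: cvgMl_tmp; exact: cvg_id.
  exact: continuous_cos.
- move=> x x0; rewrite normrM (ger0_norm (expR_ge0 _)) /expw (ger0_norm x0) mulNr.
  by rewrite ler_piMr ?expR_ge0// cos_max.
- under eq_fun do rewrite -mulrA.
  apply: (@cvgn_expM _ _ ((`|z| + e) / (e ^+ 2 + z ^+ 2)) e0) => n.
  have p0 : 0 <= (e ^+ 2 + z ^+ 2)^-1 by rewrite invr_ge0 addr_ge0 ?sqr_ge0.
  rewrite normrM (ger0_norm p0) ler_wpM2r// (le_trans (ler_normB _ _))//.
  by rewrite !normrM (ger0_norm (ltW e0)) lerD// ler_piMr ?(ltW e0)// ?sin_max ?cos_max.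
Qed.

Lemma int_half_expsin e z : 0 < e ->
  \int[mu]_x ((1 + Num.sg x) / 2 * (expR (- e * x) * sin (z * x))) =
  z / (e ^+ 2 + z ^+ 2).
Proof.
move=> e0.
rewrite (FTC_half _ (fun x => is_derive_expsin z x e0) (L1_expw e0)).
- by rewrite !mulr0 expR0 sin0 cos0 mulr0 mulN1r add0r mulr1 mulNr opprK.
- move=> x; apply: cvgM.
    apply: (continuous_comp (f := fun x => - e * x) (g := expR)).
      by apply: cvgMl_tmp; exact: cvg_id.
    exact: continuous_expR.
  apply: (continuous_comp (f := fun x => z * x) (g := sin)).
    by apply: cvgMl_tmp; exact: cvg_id.
  exact: continuous_sin.
- move=> x x0; rewrite normrM (ger0_norm (expR_ge0 _)) /expw (ger0_norm x0) mulNr.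
  by rewrite ler_piMr ?expR_ge0// sin_max.
- have H : expR (- e * n%:R) *
      (- ((e * sin (z * n%:R) + z * cos (z * n%:R)) / (e ^+ 2 + z ^+ 2)))
      @[n --> \oo] --> (0 : R).
    apply: (@cvgn_expM _ _ ((e + `|z|) / (e ^+ 2 + z ^+ 2)) e0) => n.
    have p0 : 0 <= (e ^+ 2 + z ^+ 2)^-1 by rewrite invr_ge0 addr_ge0 ?sqr_ge0.
    rewrite normrN normrM (ger0_norm p0) ler_wpM2r// (le_trans (ler_normD _ _))//.
    by rewrite !normrM (ger0_norm (ltW e0)) lerD// ler_piMr ?(ltW e0)// ?sin_max ?cos_max.
  by apply: cvg_trans H; apply: near_eq_cvg; apply: nearW => n; ring.
Qed.

(* 2 pi times the probability density usually called the Poisson kernel. *)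
Definition poisson e x : R := 2 * e / (e ^+ 2 + x ^+ 2).

Lemma half_expw e x z : (1 + Num.sg x) / 2 * (expw e x * z) =
  (1 + Num.sg x) / 2 * (expR (- e * x) * z).
Proof.
have [x0|x0] := leP 0 x; first by rewrite /expw ger0_norm// mulNr.
by rewrite ltr0_sg// subrr !mul0r.
Qed.

Lemma norm_half_le1 x : `|(1 + Num.sg x) / 2| <= 1.
Proof.
have [x0|x0|->] := ltrgt0P x; [rewrite gtr0_sg//|rewrite ltr0_sg//|rewrite sgr0];
  by rewrite ler_norml; apply/andP; split; lra.
Qed.

Lemma measurable_half : measurable_fun setT (fun x : R => (1 + Num.sg x) / 2).
Proof.
by apply: measurable_funM => //; apply: measurable_funD => //; exact: measurable_sgr.
Qed.

Lemma L1_expwM e g c : 0 < e -> measurable_fun setT g -> (forall x, `|g x| <= c) ->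
  L1 (fun x => expw e x * g x).
Proof.
move=> e0 mg gc; have := L1M_bounded mg gc (L1_expw e0).
by congr L1; apply/funext => x; rewrite mulrC.
Qed.

Lemma measurable_casl x : measurable_fun setT (fun y : R => cas (y * x)).
Proof. by apply: eq_measurable_fun (measurable_casr x) => z _; rewrite mulrC. Qed.

Lemma norm_casM_le4 x y : `|cas x * cas y| <= 4.
Proof.
rewrite normrM (_ : 4 = 2 * 2 :> R); last by ring.
by rewrite ler_pM// norm_cas_le2.
Qed.

Lemma measurable_trig (t : R -> R) z : continuous t ->
  measurable_fun setT (fun x : R => t (z * x)).
Proof.
move=> ct; apply: (measurableT_comp (f := t)).
  exact: continuous_measurable_fun.
exact: measurable_funM.
Qed.

(** Regularized orthogonality of the kernels cas: without the weight the integral would formally be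
    2 pi times a Dirac mass at x = y. *)
Lemma int_expw_casM e x y : 0 < e ->
  \int[mu]_z (expw e z * (cas (z * x) * cas (z * y))) = poisson e (x - y).
Proof.
move=> e0; have H : L1 (fun z => expw e z * (cas (z * x) * cas (z * y))).
  apply: L1_expwM => //; last by move=> z; exact: norm_casM_le4.
  by apply: measurable_funM; exact: measurable_casl.
rewrite int_sgn_split// /poisson -mulrA -int_half_expcos// -intZ.
  apply: eq_Rintegral => z _; rewrite -half_expw [RHS]mulrCA; congr (_ * _).
  rewrite /expw normrN -mulrDr mulrCA; congr (_ * _).
  rewrite !casM !mulNr.
  rewrite (_ : (x - y) * z = z * x - z * y); last by ring.
  rewrite (_ : - (z * x) - - (z * y) = - (z * x - z * y)); last by ring.
  rewrite (_ : - (z * x) - z * y = - (z * x + z * y)); last by ring.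
  by rewrite sinN cosN; ring.
have := L1M_bounded measurable_half norm_half_le1 (L1_expwM e0
  (measurable_trig (x - y) (@continuous_cos R)) (fun _ => cos_max _)).
by congr L1; apply/funext => z; rewrite half_expw.
Qed.

(** The odd factor sgn z selects the sine term of [casM], and the reflected second argument makes it
    a function of x - y. The result is twice the conjugate Poisson kernel. *)
Lemma int_expw_sgn_casM e x y : 0 < e ->
  \int[mu]_z (expw e z * (Num.sg z * cas (z * x) * cas (- (z * y)))) =
  2 * (x - y) / (e ^+ 2 + (x - y) ^+ 2).
Proof.
move=> e0; have H : L1 (fun z => expw e z * (Num.sg z * cas (z * x) * cas (- (z * y)))).
  apply: (L1_expwM (c := 4)) => //.
    apply: measurable_funM.
      by apply: measurable_funM; [exact: measurable_sgr|exact: measurable_casl].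
    by apply: eq_measurable_fun (measurable_casl (- y)) => z _; rewrite mulrN.
  move=> z; rewrite -mulrA normrM normr_sg.
  apply: le_trans (norm_casM_le4 (z * x) (- (z * y))).
  by rewrite ler_piMl//; case: (_ == _).
rewrite int_sgn_split// -mulrA -int_half_expsin// -intZ.
  apply: eq_Rintegral => z _; rewrite -half_expw.
  transitivity ((1 + Num.sg z) / 2 * (expw e z * (Num.sg z * (2 * sin ((x - y) * z))))).
    congr (_ * _); rewrite /expw normrN sgrN -mulrDr; congr (_ * _).
    rewrite -!mulrA !casM !mulNr !opprK.
    rewrite (_ : (x - y) * z = z * x - z * y); last by ring.
    rewrite (_ : - (z * x) + z * y = - (z * x - z * y)); last by ring.
    rewrite (_ : - (z * x) - z * y = - (z * x + z * y)); last by ring.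
    by rewrite sinN cosN; ring.
  have [z0|z0|->] := ltrgt0P z.
  - by rewrite gtr0_sg//; ring.
  - by rewrite ltr0_sg// subrr !mul0r mulr0.
  - by rewrite !mulr0 sin0; ring.
have := L1M_bounded measurable_half norm_half_le1 (L1_expwM e0
  (measurable_trig (x - y) (@continuous_sin R)) (fun _ => sin_max _)).
by congr L1; apply/funext => z; rewrite half_expw.
Qed.

End Kernels.

(** * Mass and smoothing properties of the Poisson kernel *)

Section Poisson.
Context {R : realType}.
Notation mu := (@lebesgue_measure R).
Notation RM := (measurableTypeR R).
Implicit Types (f g h : R -> R) (a b c x y z e : R).

Lemma poisson_den_gt0 e x : 0 < e -> 0 < e ^+ 2 + x ^+ 2.
Proof. by move=> e0; rewrite ltr_pwDl ?exprn_gt0// sqr_ge0. Qed.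

Lemma poisson_ge0 e x : 0 < e -> 0 <= poisson e x.
Proof.
by move=> e0; rewrite divr_ge0 ?(ltW (poisson_den_gt0 _ _))// mulr_ge0// ltW.
Qed.

Lemma poisson_le e x : 0 < e -> poisson e x <= 2 / e.
Proof.
move=> e0; rewrite /poisson ler_pdivrMr ?poisson_den_gt0//.
rewrite mulrDr (_ : 2 / e * e ^+ 2 = 2 * e); last by field; rewrite gt_eqF.
by rewrite lerDl mulr_ge0 ?sqr_ge0// divr_ge0// ltW.
Qed.

Lemma norm_poisson_le e x : 0 < e -> `|poisson e x| <= 2 / e.
Proof. by move=> e0; rewrite ger0_norm ?poisson_ge0// poisson_le. Qed.

Lemma poissonN e x : poisson e (- x) = poisson e x.
Proof. by rewrite /poisson sqrrN. Qed.

Lemma poissonBC e x y : poisson e (x - y) = poisson e (y - x).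
Proof. by rewrite -opprB poissonN. Qed.

Lemma continuous_poisson e : 0 < e -> continuous (poisson e).
Proof.
move=> e0 x; apply: cvgMl_tmp; apply: cvgV; first by rewrite gt_eqF// poisson_den_gt0.
by apply: cvgD; [exact: cvg_cst|under eq_fun do rewrite expr2; apply: cvgM; exact: cvg_id].
Qed.

Lemma continuous_poissonB e x : 0 < e -> continuous (fun y : R => poisson e (x - y)).
Proof.
move=> e0 y; apply: (continuous_comp (f := fun y => x - y) (g := poisson e)).
  by apply: cvgB; [exact: cvg_cst|exact: cvg_id].
exact: continuous_poisson.
Qed.

Lemma measurable_poisson2 e : 0 < e ->
  measurable_fun setT (fun z : RM * RM => poisson e (z.1 - z.2)).
Proof.
move=> e0; apply: (measurableT_comp (f := poisson e)).
  exact: continuous_measurable_fun (continuous_poisson e0).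
exact: measurable_funB.
Qed.

Lemma measurable_poissonB e x : 0 < e -> measurable_fun setT (fun y : R => poisson e (x - y)).
Proof. by move=> e0; exact: continuous_measurable_fun (continuous_poissonB e0). Qed.

Lemma is_derive_poisson e x y : 0 < e ->
  is_derive y 1 (fun t => - 2 * atan ((x - t) / e)) (poisson e (x - y)).
Proof.
move=> e0.
have H1 : is_derive y 1 (fun t : R => (x - t) / e) (- e^-1).
  have := is_deriveZ e^-1 (is_deriveB (is_derive_cst x y 1) (is_derive_id y (1 : R))).
  rewrite (_ : _ \*: _ = fun t : R => (x - t) / e); last by apply/funext => t; rewrite mulrC.
  by move=> /is_derive_eq; apply; rewrite sub0r scalerN /GRing.scale/= mulr1.
have H2 := is_derive1_comp (f := atan) (g := fun t : R => (x - t) / e) (x := y) (is_derive1_atan ((x - y) / e)) H1.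
have := is_deriveZ (- 2) H2.
move=> /is_derive_eq; apply; rewrite /GRing.scale/= /poisson; field.
by rewrite !gt_eqF // poisson_den_gt0.
Qed.

Lemma int_poisson_box e x a b : 0 < e -> a <= b ->
  \int[mu]_y (box a b y * poisson e (x - y)) =
  2 * (atan ((x - a) / e) - atan ((x - b) / e)).
Proof.
move=> e0 ab; rewrite (FTC_box ab (continuous_poissonB e0)
  (fun y => is_derive_poisson x y e0)); ring.
Qed.

Lemma poissonB_L1 e x : 0 < e ->
  L1 (fun y => poisson e (x - y)) /\ \int[mu]_y poisson e (x - y) <= 2 * pi.
Proof.
move=> e0; apply: (@fatou_int _ (fun n y => box (- n%:R) n%:R y * poisson e (x - y))).
- by move=> n; apply: L1_box_continuous; exact: continuous_poissonB.
- by move=> n y; rewrite mulr_ge0 ?box_ge0 ?poisson_ge0.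
- exact: measurable_poissonB.
- by move=> y; exact: poisson_ge0.
- apply: aeT => y; exact: cvg_nat_box (fun y => poisson e (x - y)) y.
- move=> n; rewrite int_poisson_box//; last by rewrite (@le_trans _ _ 0) ?oppr_le0.
  rewrite ler_wpM2l//.
  have := atan_ltpi2 ((x - - n%:R) / e); have := atan_gtNpi2 ((x - n%:R) / e); lra.
Qed.

(** Tonelli: integrating first in x, the kernel contributes at most 2 pi for each y, as it is
    symmetric. *)
Lemma poisson_smoothing e h : 0 < e -> L1 h -> (forall x, 0 <= h x) ->
  L1 (fun x => \int[mu]_y (poisson e (x - y) * h y)) /\
  \int[mu]_x \int[mu]_y (poisson e (x - y) * h y) <= 2 * pi * \int[mu]_x h x.
Proof.
move=> e0 h1 h0; have mh := L1_measurable h1.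
have ph1 x : L1 (fun y => poisson e (x - y) * h y).
  by apply: (L1M_bounded (c := 2 / e)) => // [|y]; [exact: measurable_poissonB|exact: norm_poisson_le].
have mF : measurable_fun setT (fun z : RM * RM => poisson e (z.1 - z.2) * h z.2).
  by apply: measurable_funM; [exact: measurable_poisson2|exact: measurableT_comp].
suff H : (\int[mu]_x (\int[mu]_y (poisson e (x - y) * h y))%:E <=
    (2 * pi * \int[mu]_x h x)%:E)%E.
  have L : L1 (fun x => \int[mu]_y (poisson e (x - y) * h y)).
    apply: ge0_L1 H.
      exact: (measurable_int_kernel mF).
    by move=> x; apply: int_ge0 => y; rewrite mulr_ge0 ?poisson_ge0.
  by split => //; rewrite -lee_fin -intE.
under eq_integral do rewrite -intE//.
rewrite (tonelli_real mF)/=; last by move=> z; rewrite mulr_ge0 ?poisson_ge0.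
rewrite -intZ// -intE; last exact: L1Z.
apply: ge0_le_integral => //.
- by move=> x _; apply: integral_ge0 => y _; rewrite lee_fin mulr_ge0 ?poisson_ge0.
- apply: (measurable_fun_fubini_tonelli_G (m1 := mu) (EFin \o (fun z : RM * RM => poisson e (z.1 - z.2) * h z.2))) => [|z].
    exact/measurable_EFinP.
  by rewrite lee_fin mulr_ge0 ?poisson_ge0.
- exact: L1_emeasurable (L1Z _ h1).
move=> y _.
have [p1 p2] := poissonB_L1 y e0.
rewrite (_ : (fun x => _) = fun x => (h y * poisson e (y - x))%:E); last first.
  by apply/funext => x; rewrite mulrC poissonBC.
by rewrite (intE (L1Z (h y) p1)) lee_fin intZ// mulrC ler_wpM2r.
Qed.

End Poisson.

(** * The Hartley transform of integrable functions *)

Section Hartley1.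
Context {R : realType}.
Notation mu := (@lebesgue_measure R).
Notation RM := (measurableTypeR R).
Implicit Types (f g h : R -> R) (a b c x y z e : R).

Definition hartley1 f x : R := \int[mu]_y (cas (x * y) * f y).

Lemma L1_casM f x : L1 f -> L1 (fun y => cas (x * y) * f y).
Proof.
by apply: (L1M_bounded (c := 2)) => [|y]; [exact: measurable_casr|exact: norm_cas_le2].
Qed.

Lemma norm_hartley1_le f x : L1 f -> `|hartley1 f x| <= 2 * \int[mu]_y `|f y|.
Proof.
move=> f1; rewrite (le_trans (le_norm_int (L1_casM x f1)))//.
rewrite -intZ; last exact: L1_norm.
apply: le_int; [exact/L1_norm/L1_casM|exact/L1Z/L1_norm|].
by move=> y; rewrite normrM ler_wpM2r// norm_cas_le2.
Qed.

Lemma continuous_hartley1 f : L1 f -> continuous (hartley1 f).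
Proof.
move=> f1 x.
have := @continuity_under_integral R _ _ mu (fun x y => cas (x * y) * f y) setT
  measurableT (x - 1) (x + 1) _ _ (fun y => 2 * `|f y|) (L1Z 2 (L1_norm f1)).
apply.
- by move=> z _; exact: L1_casM.
- apply: aeT => y _ z _; apply: cvgMr_tmp.
  apply: (continuous_comp (f := fun z => z * y) (g := cas)).
    by apply: cvgMr_tmp; exact: cvg_id.
  exact: continuous_cas.
- by move=> z _; apply: aeT => y _; rewrite normrM ler_wpM2r// norm_cas_le2.
- by rewrite inE /= in_itv/=; apply/andP; split; lra.
Qed.

Lemma measurable_hartley1 f : L1 f -> measurable_fun setT (hartley1 f).
Proof. by move=> f1; exact: continuous_measurable_fun (continuous_hartley1 f1). Qed.

Lemma hartley1_sub f g : L1 f -> L1 g ->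
  hartley1 (fun x => f x - g x) = (fun x => hartley1 f x - hartley1 g x).
Proof.
move=> f1 g1; apply/funext => x; rewrite /hartley1 -intB; [|exact: L1_casM|exact: L1_casM].
by apply: eq_Rintegral => y _; rewrite mulrBr.
Qed.

Lemma hartley1_duality f g : L1 f -> L1 g ->
  \int[mu]_x (f x * hartley1 g x) = \int[mu]_x (g x * hartley1 f x).
Proof.
move=> f1 g1; rewrite /hartley1.
rewrite (fubini_bounded f1 g1 (@measurable_cas2 R) (fun p => norm_cas_le2 (p.1 * p.2))).
apply: eq_Rintegral => x _; congr (_ * _); apply: eq_Rintegral => y _ /=.
by rewrite [y * x]mulrC.
Qed.

Lemma cvg_expw1 x : expw n.+1%:R^-1 x @[n --> \oo] --> (1 : R).
Proof.
have H : - (n.+1%:R^-1 * `|x|) @[n --> \oo] --> (0 : R).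
  rewrite -oppr0; apply: cvgN; rewrite -(mul0r `|x|); apply: cvgMr_tmp.
  exact: cvg_harmonic.
have := cvg_comp _ _ H (@continuous_expR R 0); rewrite expR0; apply: cvg_trans.
by apply: near_eq_cvg; apply: nearW => n.
Qed.

(** The weight makes the double integral absolutely convergent; exchanging the order leaves the
    inner integral of [int_expw_casM]. *)
Lemma hartley1_expw f e x : 0 < e -> L1 f ->
  hartley1 (fun y => expw e y * hartley1 f y) x =
  \int[mu]_y (poisson e (x - y) * f y).
Proof.
move=> e0 f1.
have ec1 : L1 (fun y => expw e y * cas (y * x)).
  by apply: (L1_expwM (c := 2)) => // [|y]; [exact: measurable_casl|exact: norm_cas_le2].
transitivity (\int[mu]_y ((expw e y * cas (y * x)) * \int[mu]_z (cas (y * z) * f z))).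
  by apply: eq_Rintegral => y _; rewrite /hartley1 [x * y]mulrC; ring.
rewrite (fubini_bounded ec1 f1 (@measurable_cas2 R) (fun p => norm_cas_le2 (p.1 * p.2))).
apply: eq_Rintegral => y _ /=; rewrite mulrC -int_expw_casM//; congr (_ * _).
by apply: eq_Rintegral => z _; ring.
Qed.

(** With the Abel weight inserted, duality turns the integral of (hartley1 f)^2 into the quadratic
    form of the Poisson kernel, which is bounded by Schur's test with constant 2 pi uniformly in e;
    Fatou's lemma then removes the weight. *)
Lemma bessel1 f : L1 f -> L2 f ->
  L2 (hartley1 f) /\ \int[mu]_x hartley1 f x ^+ 2 <= 2 * pi * \int[mu]_x f x ^+ 2.
Proof.
move=> f1 f2; have mf := L1_measurable f1.
have mh := measurable_hartley1 f1.
pose M := 2 * \int[mu]_y `|f y|.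
have eh1 e : 0 < e -> L1 (fun x => expw e x * hartley1 f x).
  by move=> e0; apply: (L1_expwM (c := M)) => // x; exact: norm_hartley1_le.
have ehh1 e : 0 < e -> L1 (fun x => expw e x * hartley1 f x ^+ 2).
  move=> e0; apply: (L1_expwM (c := M ^+ 2)) => //.
    exact: measurable_funX.
  move=> x; have h := norm_hartley1_le x f1.
  by rewrite normrX ler_sqr ?nnegrE// (le_trans _ h).
have H e : 0 < e -> \int[mu]_x (expw e x * hartley1 f x ^+ 2) <= 2 * pi * \int[mu]_x f x ^+ 2.
  move=> e0.
  have -> : \int[mu]_x (expw e x * hartley1 f x ^+ 2) =
      \int[mu]_x (f x * \int[mu]_y (poisson e (x - y) * f y)).
    transitivity (\int[mu]_x ((expw e x * hartley1 f x) * hartley1 f x)).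
      by apply: eq_Rintegral => x _; rewrite expr2 mulrA.
    rewrite hartley1_duality//; last exact: eh1.
    by apply: eq_Rintegral => x _; rewrite hartley1_expw.
  have pf1 x : L1 (fun y => poisson e (x - y) * f y).
    by apply: (L1M_bounded (c := 2 / e)) => // [|y]; [exact: measurable_poissonB|exact: norm_poisson_le].
  have pff1 x : L1 (fun y => poisson e (x - y) * f y ^+ 2).
    by apply: (L1M_bounded (c := 2 / e)) => // [|y|]; [exact: measurable_poissonB|exact: norm_poisson_le|case: f2].
  have [s1 s2] := poisson_smoothing e0 (proj2 f2) (fun x => sqr_ge0 _).
  have f2pi : L1 (fun x => 2 * pi * f x ^+ 2) by apply: L1Z; case: f2.
  (* Schur's test: 2 f(x) f(y) <= f(x)^2 + f(y)^2 under the nonnegative kernel, whose mass is at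
     most 2 pi in either variable. *)
  apply: le_trans (_ : \int[mu]_x (2^-1 * (2 * pi * f x ^+ 2 +
      \int[mu]_y (poisson e (x - y) * f y ^+ 2))) <= _); last first.
    rewrite intZ; last exact: L1D.
    rewrite intD// intZ; last by case: f2.
    lra.
  have mpf : measurable_fun setT (fun x => \int[mu]_y (poisson e (x - y) * f y)).
    apply: (@measurable_int_kernel _ (fun z : RM * RM => poisson e (z.1 - z.2) * f z.2)).
    by apply: measurable_funM; [exact: measurable_poisson2|exact: measurableT_comp].
  apply: le_int.
  - have := L1M_bounded (c := 2 / e * \int[mu]_y `|f y|) mpf _ f1.
    rewrite (_ : (fun x => _ * f x) = (fun x => f x * \int[mu]_y (poisson e (x - y) * f y))).
      apply=> x; rewrite (le_trans (le_norm_int (pf1 x)))// -intZ; last exact: L1_norm.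
      apply: le_int; [exact: L1_norm|exact/L1Z/L1_norm|].
      by move=> y; rewrite normrM ler_wpM2r// norm_poisson_le.
    by apply/funext => x; rewrite mulrC.
  - exact/L1Z/L1D.
  move=> x; rewrite -intZ//.
  have [p1 p2] := poissonB_L1 x e0.
  apply: le_trans (_ : \int[mu]_y (2^-1 * (f x ^+ 2 * poisson e (x - y) +
     poisson e (x - y) * f y ^+ 2)) <= _).
    apply: le_int; [exact: L1Z|by apply/L1Z/L1D => //; exact: L1Z|].
    move=> y; have := poisson_ge0 (x - y) e0; set p := poisson _ _ => p0.
    rewrite -subr_ge0 (_ : _ - _ = 2^-1 * (p * (f x - f y) ^+ 2)); last by field.
    by rewrite mulr_ge0 ?invr_ge0// mulr_ge0 ?sqr_ge0.
  rewrite intZ; last by apply: L1D => //; exact: L1Z.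
  rewrite intD; [|exact: L1Z|exact: pff1].
  by rewrite (intZ (f x ^+ 2) p1) ler_wpM2l// lerD2r mulrC ler_wpM2r// sqr_ge0.
have e0 n : 0 < n.+1%:R^-1 :> R by rewrite invr_gt0.
have [|L1h Lh] := @fatou_int R (fun n x => expw n.+1%:R^-1 x * hartley1 f x ^+ 2)
  (fun x => hartley1 f x ^+ 2) (2 * pi * \int[mu]_x f x ^+ 2)
  (fun n => ehh1 _ (e0 n)) (fun n x => mulr_ge0 (expw_ge0 _ _) (sqr_ge0 _))
  (measurable_funX 2 mh) (fun x => sqr_ge0 _) _ (fun n => H _ (e0 n)).
- apply: aeT => x; rewrite -[X in _ --> X]mul1r; apply: cvgMr_tmp; exact: cvg_expw1.
- by split => //; split.
Qed.

End Hartley1.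

(** * Completeness of L^2 *)

Section Completeness.
Context {R : realType}.
Notation mu := (@lebesgue_measure R).
Implicit Types (f g h : R -> R).

(** The series of 4^k (D k)^2 has integral at most the sum of the 2^-k, so its sum is finite almost
    everywhere; where it is finite, |D k| decays like 2^-k. *)
Lemma ae_cvg_fast (D : nat -> R -> R) : (forall k, L2 (D k)) ->
  (forall k, \int[mu]_x D k x ^+ 2 <= 16%:R^-1 ^+ k) ->
  {ae mu, forall x, cvgn (series (D ^~ x))}.
Proof.
move=> D2 iD.
pose G (x : R) : \bar R := (\sum_(0 <= k <oo) (4 ^+ k * D k x ^+ 2)%:E)%E.
have t0 k x : (0 <= (4 ^+ k * D k x ^+ 2)%:E)%E.
  by rewrite lee_fin mulr_ge0 ?sqr_ge0// exprn_ge0.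
have tL k : L1 (fun x => 4 ^+ k * D k x ^+ 2) by apply: L1Z; case: (D2 k).
have iG : (\int[mu]_x G x <= 2%:E)%E.
  rewrite /G integral_nneseries//; last by move=> k; exact: L1_emeasurable (tL k).
  apply: lime_le.
    by apply: is_cvg_nneseries => k _ _; apply: integral_ge0 => x _; exact: t0.
  apply: nearW => n.
  rewrite (eq_bigr (fun k => (\int[mu]_x (4 ^+ k * D k x ^+ 2))%:E)); last first.
    by move=> k _; exact: intE (tL k).
  rewrite sumEFin lee_fin.
  have -> : 2 = \sum_(0 <= k < n) (2^-1 : R) ^+ k + 2 * 2^-1 ^+ n :> R.
    elim: n => [|n IH]; first by rewrite big_geq// expr0 add0r mulr1.
    rewrite big_nat_recr//= [LHS]IH exprS -addrA; congr (_ + _); lra.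
  rewrite ler_wpDr ?mulr_ge0 ?exprn_ge0//; apply: ler_sum => k _.
  rewrite intZ; last by case: (D2 k).
  apply: le_trans (_ : 4 ^+ k * 16%:R^-1 ^+ k <= _).
    by rewrite ler_wpM2l// exprn_ge0.
  rewrite -exprMn lerXn2r ?nnegrE//; lra.
have mG : measurable_fun setT G.
  by apply: ge0_emeasurable_sum => // k _; exact: L1_emeasurable (tL k).
have G0 x : (0 <= G x)%E by exact: nneseries_ge0.
have : mu.-integrable setT G.
  apply/integrableP; split => //.
  under eq_integral do rewrite gee0_abs//.
  by rewrite (le_lt_trans iG) ?ltry.
move=> /(integrable_ae measurableT); apply: aeS => x /(_ Logic.I) Gx.
apply: normed_cvg; have [c Gc] : exists c : R, (G x = c%:E)%E.
  by exists (fine (G x)); rewrite fineK.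
have c0 : 0 <= c by rewrite -lee_fin -Gc.
(* The constant c + 1 is a bound for the square root of c. *)
have Dc k : `|D k x| <= (c + 1) * 2^-1 ^+ k.
  have H : 4 ^+ k * D k x ^+ 2 <= c.
    rewrite -lee_fin -Gc; apply: le_trans (nneseries_lim_ge k.+1 (fun n _ _ => t0 n x)).
    rewrite big_nat_recr//= leeDr//; exact: sume_ge0.
  have k4 : (2^-1 ^+ k) ^+ 2 * 4 ^+ k = 1 :> R.
    by rewrite -exprM mulnC exprM -exprMn (_ : 2^-1 ^+ 2 * 4 = 1) ?expr1n//; field.
  rewrite -ler_sqr ?nnegrE ?mulr_ge0 ?exprn_ge0//; last by lra.
  rewrite real_normK ?num_real// exprMn.
  have -> : D k x ^+ 2 = (2^-1 ^+ k) ^+ 2 * (4 ^+ k * D k x ^+ 2) by rewrite mulrA k4 mul1r.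
  rewrite [leRHS]mulrC ler_wpM2l ?sqr_ge0//.
  by rewrite (le_trans H)//; nra.
apply: (@series_le_cvg _ _ (geometric (c + 1) 2^-1)).
- by move=> n /=.
- by move=> n; apply: geometric_ge0 => //; lra.
- by move=> n; exact: Dc.
- by apply: is_cvg_geometric_series; rewrite ger0_norm//; lra.
Qed.

Lemma L2_complete (fn : nat -> R -> R) : (forall n, L2 (fn n)) ->
  (forall k, exists N, forall m n, (N <= m)%N -> (N <= n)%N ->
     \int[mu]_x (fn m x - fn n x) ^+ 2 <= 16%:R^-1 ^+ k) ->
  exists f, L2 f /\ \int[mu]_x (fn n x - f x) ^+ 2 @[n --> \oo] --> 0.
Proof.
move=> fn2 /choice[N Ncauchy].
(* The sum dominates N j for all j <= k, so consecutive terms of the subsequence are 16^-k close. *)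
pose s k := (\sum_(i < k.+1) N i)%N.
have Ns j k : (j <= k)%N -> (N j <= s k)%N.
  move=> jk; rewrite /s (bigD1 (Ordinal (jk : (j < k.+1)%N)))//=; exact: leq_addr.
pose h k := fn (s k).
have hcv : {ae mu, forall x, cvgn (series (fun k => h k.+1 x - h k x))}.
  apply: (ae_cvg_fast (D := fun k x => h k.+1 x - h k x)).
    by move=> k; exact: (L2B (fn2 _) (fn2 _)).
  by move=> k; apply: Ncauchy; exact: Ns.
(* An upper limit is defined and measurable everywhere, and agrees with the limit where that
   exists. *)
pose f x := fine (limn_esup (fun k => (h k x)%:E)).
have mf : measurable_fun setT f.
  apply: measurableT_comp => //; apply: measurable_fun_limn_esup => k.
  by apply/measurable_EFinP; case: (fn2 (s k)).
have hf : {ae mu, forall x, h k x @[k --> \oo] --> f x}.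
  apply: aeS hcv => x /cvg_ex[l hl].
  have {}hl : h k x @[k --> \oo] --> l + h 0%N x.
    have H : (series (fun k => h k.+1 x - h k x) \+ cst (h 0%N x)) @ \oo --> l + h 0%N x.
      by apply: cvgD => //; exact: cvg_cst.
    apply: cvg_trans H; apply: near_eq_cvg; apply: nearW => k.
    have E : h k x = h 0%N x + series (fun k => h k.+1 x - h k x) k.
      exact: (eq_sum_telescope (fun k => h k x) k).
    by rewrite E addrC.
  have hlE : (h k x)%:E @[k --> \oo] --> (l + h 0%N x)%:E.
    by apply: cvg_EFin => //; exact: nearW.
  by rewrite /f is_cvg_limn_esupE; [rewrite (cvg_lim _ hlE)//|apply/cvg_ex; exists (l + h 0%N x)%:E].
(* Fatou's lemma along the shifted subsequence, whose indices are all at least N j: the Cauchy bound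
   passes to the limit and controls the whole sequence. *)
have key j n : (N j <= n)%N -> L1 (fun x => (fn n x - f x) ^+ 2) /\
    \int[mu]_x (fn n x - f x) ^+ 2 <= 16%:R^-1 ^+ j.
  move=> jn; apply: (@fatou_int _ (fun k x => (fn n x - h (k + j)%N x) ^+ 2)).
  - by move=> k; case: (L2B (fn2 n) (fn2 (s (k + j)%N))).
  - by move=> k x; exact: sqr_ge0.
  - by apply: measurable_funX; apply: measurable_funB => //; case: (fn2 n).
  - by move=> x; exact: sqr_ge0.
  - apply: aeS hf => x hx.
    have hx' : h (k + j)%N x @[k --> \oo] --> f x by rewrite (cvg_shiftn j (fun k => h k x)).
    have dfx : fn n x - h (k + j)%N x @[k --> \oo] --> fn n x - f x.
      by apply: cvgB => //; exact: cvg_cst.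
    by under eq_fun do rewrite expr2; rewrite expr2; exact: (cvgM dfx dfx).
  - by move=> k; apply: Ncauchy => //; apply: Ns; exact: leq_addl.
have f2 : L2 f.
  have d2 : L2 (fun x => fn (N 0%N) x - f x).
    split; last by case: (key 0%N (N 0%N) (leqnn _)).
    by apply: measurable_funB => //; case: (fn2 (N 0%N)).
  have := L2B (fn2 (N 0%N)) d2; congr L2; apply/funext => x; ring.
exists f; split => //; apply/cvgr0Pnorm_le => e e0.
have [j je] : exists j : nat, 16%:R^-1 ^+ j <= e.
  have := @cvg_geometric R 1 16%:R^-1 _; move=> /(_ _)/cvgr0Pnorm_le.
  move=> /(_ _ e e0)[]; first by rewrite ger0_norm//; lra.
  move=> j _ /(_ j (leqnn j)) /=; rewrite mul1r => je.
  by exists j; rewrite (le_trans _ je)// ler_norm.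
near=> n; rewrite ger0_norm; last exact: (int_sqr_ge0 (fun x => fn n x - f x)).
by apply: le_trans je; apply: (proj2 (key j n _)); near: n; exact: nbhs_infty_ge.
Unshelve. all: by end_near. Qed.

End Completeness.

(** * Functions whose integrals over intervals vanish *)

Section AeZero.
Context {R : realType}.
Notation mu := (@lebesgue_measure R).
Implicit Types (f g h : R -> R).

(** The primitive of f from - oo is a limit of integrals over bounded intervals, hence 0; by
    Lebesgue differentiation its derivative is f almost everywhere. *)
Lemma L1_ae_eq0 f : L1 f -> (forall a b, a <= b -> \int[mu]_x (box a b x * f x) = 0) ->
  {ae mu, forall x, f x = 0}.
Proof.
move=> f1 fab.
have mf := L1_measurable f1.
have loc : locally_integrable setT f.
  by apply: open_integrable_locally => //; exact: openT.
have fi y : mu.-integrable `]-oo, y] (EFin \o f).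
  exact: integrableS f1.
have := FTC1Ny fi loc; apply: aeS => x [_ <-].
rewrite (_ : (fun x => _) = cst 0) ?derive1_cst//.
apply/funext => y /=.
rewrite Rintegral_mkcond.
rewrite (_ : \int[mu]_x _ = \int[mu]_x (\1_(`]-oo, y]%classic) x * f x)); last first.
  by apply: eq_Rintegral => z _; rewrite patch_indic/= mulrC.
have [|||||_] := @dominated_cvg_int R (fun n x => box (- n%:R) y x * f x)
   (fun x => \1_(`]-oo, y]%classic) x * f x) (fun x => `|f x|).
- by move=> n; apply: measurable_funM => //; exact: measurable_box.
- by apply: measurable_funM => //; exact: measurable_indic.
- exact: L1_norm.
- apply: aeT => z; apply: cvg_near_cst; near=> n; rewrite boxE indicE mem_setE in_itv/=.
  have : `|z| <= n%:R by near: n; exact: nbhs_infty_ger.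
  by rewrite ler_norml => /andP[-> _].
- by move=> n z; rewrite normrM ler_piMl// norm_box_le1.
move=> H; apply: (cvg_unique _ H) => //.
apply: cvg_near_cst; near=> n; apply: fab.
have : `|y| <= n%:R by near: n; exact: nbhs_infty_ger.
by rewrite ler_norml => /andP[].
Unshelve. all: by end_near. Qed.

Lemma box_inter a b c d x : box a b x * box c d x = box (Num.max a c) (Num.min b d) x :> R.
Proof. by rewrite !boxE ge_max le_min -natrM mulnb; congr (_%:R); rewrite andbACA. Qed.

Lemma box_empty a b x : b < a -> box a b x = 0 :> R.
Proof.
move=> ba; rewrite boxE; case: (leP a x) => //= ax; case: (leP x b) => //= xb.
by have := lt_le_trans ba (le_trans ax xb); rewrite ltxx.
Qed.

Lemma L2_ae_eq0 f : L2 f -> (forall a b, a <= b -> \int[mu]_x (box a b x * f x) = 0) ->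
  {ae mu, forall x, f x = 0}.
Proof.
move=> f2 fab.
have H n : {ae mu, forall x, box (- n%:R) n%:R x * f x = 0}.
  apply: L1_ae_eq0; first exact: L2M (@L2_box R _ _) f2.
  move=> a b ab; rewrite (_ : \int[mu]_x _ =
      \int[mu]_x (box (Num.max a (- n%:R)) (Num.min b n%:R) x * f x)); last first.
    by apply: eq_Rintegral => x _; rewrite mulrA box_inter.
  have [le|lt] := leP (Num.max a (- n%:R)) (Num.min b n%:R); first exact: fab.
  by rewrite -[RHS]int0; apply: eq_Rintegral => x _; rewrite box_empty// mul0r.
have := ae_foralln H; apply: aeS => x Hx.
have := Hx (Num.truncn `|x|).+1; rewrite boxE.
have : `|x| <= (Num.truncn `|x|).+1%:R by apply/ltW; exact: truncnS_gt.
by rewrite ler_norml => ->; rewrite mul1r.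
Qed.

End AeZero.

(** * The Hartley transform on L^2 *)

Section Hartley.
Context {R : realType}.
Notation mu := (@lebesgue_measure R).
Implicit Types (f g h : R -> R) (a b c x y z : R).

Definition trunc n f x : R := box (- n%:R) n%:R x * f x.

Lemma trunc_L2 n f : L2 f -> L2 (trunc n f).
Proof. exact: (L2M_bounded (measurable_box _ _) (@norm_box_le1 _ _ _)). Qed.

Lemma trunc_L1 n f : L2 f -> L1 (trunc n f).
Proof. exact: (L2M (L2_box _ _)). Qed.

Lemma cvg_trunc f : L2 f -> \int[mu]_x (trunc n f x - f x) ^+ 2 @[n --> \oo] --> (0 : R).
Proof.
move=> f2; have mf : measurable_fun setT f by case: f2.
have [|||||_] := @dominated_cvg_int R (fun n x => (trunc n f x - f x) ^+ 2)
   (fun=> 0) (fun x => f x ^+ 2).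
- by move=> n; apply: measurable_funX; apply: measurable_funB => //; case: (trunc_L2 n f2).
- exact: measurable_cst.
- by case: f2.
- apply: aeT => x.
  have H : trunc n f x - f x @[n --> \oo] --> (0 : R).
    rewrite -[X in _ --> X](subrr (f x)); apply: cvgB; last exact: cvg_cst.
    exact: (@cvg_nat_box R f x).
  have H2 : (trunc n f x - f x) * (trunc n f x - f x) @[n --> \oo] --> (0 * 0 : R).
    exact: cvgM.
  by rewrite mulr0 in H2; under eq_fun do rewrite expr2.
- move=> n x; rewrite /trunc ger0_norm ?sqr_ge0// boxE.
  by case: (_ <= _ <= _)%R; rewrite /= ?mul1r ?mul0r ?subrr ?sub0r ?sqrrN ?expr0n ?sqr_ge0.
by rewrite int0.
Qed.

(** Same truncations to [-n, n] as in [fourier], so that the two transforms can be compared for each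
    n before passing to the limit. *)
Definition is_hartley f g := L2 g /\
  \int[mu]_x (hartley1 (trunc n f) x - g x) ^+ 2 @[n --> \oo] --> (0 : R).

(* Determined only up to a.e. equality; 0 when f is not in L^2. *)
Definition hartley f : R -> R := xget (fun=> 0) [set g | is_hartley f g].

Lemma bessel1B f g : L1 f -> L2 f -> L1 g -> L2 g ->
  \int[mu]_x (hartley1 f x - hartley1 g x) ^+ 2 <=
  2 * pi * \int[mu]_x (f x - g x) ^+ 2.
Proof.
move=> f1 f2 g1 g2; have := (bessel1 (L1B f1 g1) (L2B f2 g2)).2.
by rewrite hartley1_sub.
Qed.

Lemma hartley1_trunc_L2 n f : L2 f -> L2 (hartley1 (trunc n f)).
Proof. by move=> f2; case: (bessel1 (trunc_L1 n f2) (trunc_L2 n f2)). Qed.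

(** The truncations of f converge in L^2, and by [bessel1] their transforms form a Cauchy
    sequence. *)
Lemma hartleyP f : L2 f -> is_hartley f (hartley f).
Proof.
move=> f2; apply: (@xgetPex _ (fun=> 0) [set g | is_hartley f g]).
have [|k|g [g2 Hg]] := @L2_complete R (fun n => hartley1 (trunc n f)); last by exists g.
  by move=> n; exact: hartley1_trunc_L2.
have p0 : 0 < 2 * (2 * pi) :> R by rewrite !mulr_gt0// pi_gt0.
(* Solves 2 pi * 2 (e + e) = 16^-k, where 2 pi comes from [bessel1B] and the factor 2 from
   [int_sqrD_le]. *)
pose e := (16^-1 ^+ k) / (2 * (2 * pi)) / 2 : R.
have e0 : 0 < e by rewrite !divr_gt0 ?exprn_gt0// invr_gt0.
have /cvgr0Pnorm_le/(_ e e0)[N _ HN] := cvg_trunc f2.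
exists N => m n Nm Nn; apply: le_trans (bessel1B _ _ _ _) _;
  [exact: trunc_L1|exact: trunc_L2|exact: trunc_L1|exact: trunc_L2|].
rewrite (_ : 16^-1 ^+ k = 2 * pi * (2 * (e + e))); last first.
  by rewrite /e; move: (@pi_gt0 R); generalize (@pi R) => p pp; field; rewrite gt_eqF.
rewrite ler_pM2l; last by rewrite mulr_gt0// pi_gt0.
rewrite (_ : \int[mu]_x _ = \int[mu]_x ((trunc m f x - f x) - (trunc n f x - f x)) ^+ 2); last first.
  by apply: eq_Rintegral => x _; ring.
have := int_sqrD_le (L2B (trunc_L2 m f2) f2) (L2N (L2B (trunc_L2 n f2) f2)).
move=> /le_trans; apply; rewrite ler_wpM2l// lerD//.
  by rewrite (le_trans (ler_norm _))//; exact: HN.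
rewrite (_ : \int[mu]_x _ = \int[mu]_x (trunc n f x - f x) ^+ 2); last first.
  by apply: eq_Rintegral => x _; rewrite sqrrN.
by rewrite (le_trans (ler_norm _))//; exact: HN.
Qed.

Lemma hartley_L2 f : L2 f -> L2 (hartley f).
Proof. by move=> /hartleyP[]. Qed.

Lemma hartley_unique f g : L2 f -> is_hartley f g ->
  {ae mu, forall x, hartley f x = g x}.
Proof.
move=> f2 [g2 fg]; have [h2 fh] := hartleyP f2.
apply: (cvg2_unique _ h2 g2 fh fg).
by apply: nearW => n; exact: hartley1_trunc_L2.
Qed.

Lemma hartley_L1 f : L1 f -> L2 f -> {ae mu, forall x, hartley f x = hartley1 f x}.
Proof.
move=> f1 f2; apply: hartley_unique => //; have [h2 _] := bessel1 f1 f2; split => //.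
have H : 2 * pi * \int[mu]_x (trunc n f x - f x) ^+ 2 @[n --> \oo] --> (0 : R).
  by rewrite -(mulr0 (2 * pi)); apply: cvgMl_tmp; exact: cvg_trunc.
apply: (squeeze_cvgr _ (cvg_cst 0) H); apply: nearW => n.
rewrite (int_sqr_ge0 (fun x => hartley1 (trunc n f) x - hartley1 f x))/=.
by apply: bessel1B => //; [exact: trunc_L1|exact: trunc_L2].
Qed.

Lemma hartleyB f g : L2 f -> L2 g ->
  {ae mu, forall x, hartley (fun x => f x - g x) x = hartley f x - hartley g x}.
Proof.
move=> f2 g2; apply: hartley_unique; first exact: L2B.
have [hf Hf] := hartleyP f2; have [hg Hg] := hartleyP g2.
split; first exact: L2B.
pose A n := \int[mu]_x (hartley1 (trunc n f) x - hartley f x) ^+ 2.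
pose B n := \int[mu]_x (hartley1 (trunc n g) x - hartley g x) ^+ 2.
have H : 2 * (A n + B n) @[n --> \oo] --> (2 * (0 + 0) : R).
  by apply: cvgMl_tmp; exact: (@cvgD _ _ _ _ _ A B 0 0 Hf Hg).
rewrite addr0 mulr0 in H.
apply: (squeeze_cvgr _ (cvg_cst 0) H); apply: nearW => n.
rewrite (int_sqr_ge0 (fun x => hartley1 (trunc n (fun x => f x - g x)) x - (hartley f x - hartley g x)))/=.
have := int_sqrD_le (L2B (hartley1_trunc_L2 n f2) hf) (L2N (L2B (hartley1_trunc_L2 n g2) hg)).
rewrite (_ : \int[mu]_x (- _) ^+ 2 = \int[mu]_x (hartley1 (trunc n g) x - hartley g x) ^+ 2); last first.
  by apply: eq_Rintegral => x _; rewrite sqrrN.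
apply: le_trans; rewrite le_eqVlt; apply/orP; left; apply/eqP.
rewrite (_ : trunc n _ = fun x => trunc n f x - trunc n g x); last first.
  by apply/funext => x; rewrite /trunc mulrBr.
rewrite (hartley1_sub (trunc_L1 n f2) (trunc_L1 n g2)).
apply: eq_Rintegral => x _; congr (_ ^+ 2).
move: (hartley1 (trunc n f) x) (hartley1 (trunc n g) x) => p q.
by move: (hartley f x) (hartley g x) => u v; ring.
Qed.

Lemma hartley_ae f g : L2 f -> L2 g -> {ae mu, forall x, f x = g x} ->
  {ae mu, forall x, hartley f x = hartley g x}.
Proof.
move=> f2 g2 fg; apply: hartley_unique => //.
have [hg Hg] := hartleyP g2; split; first exact: hg.
suff E n : hartley1 (trunc n f) = hartley1 (trunc n g) by under eq_fun do rewrite E.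
apply/funext => x; have cf := L1_casM x (trunc_L1 n f2); have cg := L1_casM x (trunc_L1 n g2).
apply: ae_eq_int; [exact: L1_measurable cf|exact: L1_measurable cg|].
by apply: (aeS _ fg) => y fgy; rewrite /trunc fgy.
Qed.

Lemma hartleyZ c f : L2 f ->
  {ae mu, forall x, hartley (fun x => c * f x) x = c * hartley f x}.
Proof.
move=> f2; apply: hartley_unique; first exact: L2Z.
have [hf Hf] := hartleyP f2; split; first exact: L2Z.
have H : c ^+ 2 * \int[mu]_x (hartley1 (trunc n f) x - hartley f x) ^+ 2
    @[n --> \oo] --> (c ^+ 2 * 0 : R) by apply: cvgMl_tmp; exact: Hf.
suff E n : \int[mu]_x (hartley1 (trunc n (fun x => c * f x)) x - c * hartley f x) ^+ 2 =
    c ^+ 2 * \int[mu]_x (hartley1 (trunc n f) x - hartley f x) ^+ 2.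
  by rewrite mulr0 in H; under eq_fun do rewrite E.
rewrite -intZ; last by case: (L2B (hartley1_trunc_L2 n f2) hf).
apply: eq_Rintegral => x _; rewrite -exprMn mulrBr; congr ((_ - _) ^+ 2).
rewrite /hartley1 -intZ; last exact/L1_casM/trunc_L1.
by apply: eq_Rintegral => y _; rewrite /trunc; move: (cas _) (box _ _ _) (f y) => p q r; ring.
Qed.

Lemma hartley_duality f g : L2 f -> L2 g ->
  \int[mu]_x (f x * hartley g x) = \int[mu]_x (g x * hartley f x).
Proof.
move=> f2 g2; have [hf Hf] := hartleyP f2; have [hg Hg] := hartleyP g2.
have H1 : \int[mu]_x (trunc n f x * hartley1 (trunc n g) x) @[n --> \oo] -->
    \int[mu]_x (f x * hartley g x).
  apply: (cvg2_inner _ f2 hg (cvg_trunc f2) Hg); apply: nearW => n.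
  by split; [exact: trunc_L2|exact: hartley1_trunc_L2].
have H2 : \int[mu]_x (trunc n g x * hartley1 (trunc n f) x) @[n --> \oo] -->
    \int[mu]_x (g x * hartley f x).
  apply: (cvg2_inner _ g2 hf (cvg_trunc g2) Hf); apply: nearW => n.
  by split; [exact: trunc_L2|exact: hartley1_trunc_L2].
have E n := hartley1_duality (trunc_L1 n f2) (trunc_L1 n g2).
have {}H2 : \int[mu]_x (trunc n f x * hartley1 (trunc n g) x) @[n --> \oo] -->
    \int[mu]_x (g x * hartley f x) by under eq_fun do rewrite E.
exact: (cvg_unique _ H1 H2).
Qed.

Lemma measurable_reflect f : measurable_fun setT f -> measurable_fun setT (fun x => f (- x)).
Proof. by move=> mf; exact: measurableT_comp. Qed.

Lemma hartley_opp f : L2 f ->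
  {ae mu, forall x, hartley (fun x => f (- x)) x = hartley f (- x)}.
Proof.
move=> f2; apply: hartley_unique; first exact: L2_opp.
have [hf Hf] := hartleyP f2; split; first exact: L2_opp.
suff E n : \int[mu]_x (hartley1 (trunc n (fun x => f (- x))) x - hartley f (- x)) ^+ 2 =
    \int[mu]_x (hartley1 (trunc n f) x - hartley f x) ^+ 2.
  by under eq_fun do rewrite E.
have [d2 _] := L2B (hartley1_trunc_L2 n f2) hf.
rewrite -[RHS]int_opp; last exact: measurable_funX.
apply: eq_Rintegral => x _; congr ((_ - _) ^+ 2).
rewrite /hartley1 -int_opp; last exact: L1_measurable (L1_casM _ (trunc_L1 _ (L2_opp f2))).
apply: eq_Rintegral => y _; rewrite /trunc mulrN mulNr opprK !boxE; congr (_ * (_%:R * _)).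
by rewrite lerN2 lerNl andbC.
Qed.

End Hartley.

(** * Hartley inversion and the Parseval identity *)

Section Inversion.
Context {R : realType}.
Notation mu := (@lebesgue_measure R).
Implicit Types (f g h : R -> R) (a b c e x y z : R).

Lemma poisson_L2 e x : 0 < e -> L2 (fun y => poisson e (x - y)).
Proof.
move=> e0; apply: (L2_bounded_L1 (c := 2 / e)).
- exact: measurable_poissonB.
- by move=> y; exact: norm_poisson_le.
- by case: (poissonB_L1 x e0).
Qed.

(** Here |y - z| >= |y| / 2, so the kernel is at most 8 e / y^2, and y^2 >= 1 turns 8 / y^2 into 16
    / (1 + y^2). *)
Lemma poisson_tail e M y z : 0 < e <= 1 -> 1 <= M -> `|z| <= M -> 2 * M <= `|y| ->
  poisson e (y - z) <= 8 * poisson 1 y.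
Proof.
move=> /andP[e0 e1] M1 zM My.
have yz : `|y| / 2 <= `|y - z|.
  have := lerB_normD (y - z) z; rewrite subrK.
  have := ler_normD (y - z) z; rewrite subrK; lra.
have y2 : y ^+ 2 / 4 <= (y - z) ^+ 2.
  rewrite -(real_normK (num_real (y - z))) -(real_normK (num_real y)).
  by have := normr_ge0 y; nra.
have yM : 1 <= y ^+ 2.
  by rewrite -(real_normK (num_real y)); have := normr_ge0 y; nra.
have -> : 8 * poisson 1 y = 16 / (1 + y ^+ 2).
  by rewrite /poisson mulr1 expr1n mulrA -natrM.
have y0 : 0 < 1 + y ^+ 2 by lra.
rewrite /poisson ler_pdivrMr ?poisson_den_gt0// mulrAC ler_pdivlMr//.
have e2 := sqr_ge0 e; nra.
Qed.

(* The convolution of poisson e with the indicator of [a, b]. *)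
Definition theta e a b y : R := 2 * (atan ((y - a) / e) - atan ((y - b) / e)).

Lemma theta_ge0 e a b y : 0 < e -> a <= b -> 0 <= theta e a b y.
Proof.
move=> e0 ab; rewrite mulr_ge0// subr_ge0 le_atan// ler_wpM2r ?invr_ge0 ?(ltW e0)//; lra.
Qed.

Lemma theta_le e a b y : theta e a b y <= 2 * pi.
Proof.
have := atan_ltpi2 ((y - a) / e); have := atan_gtNpi2 ((y - b) / e).
rewrite /theta; lra.
Qed.

(** Provides the majorant, independent of e and square integrable, for the dominated convergence in
    [hartleyK]. *)
Lemma theta_majorant a b : a <= b -> exists C, forall e y, 0 < e <= 1 ->
  `|theta e a b y| <= C * poisson 1 y.
Proof.
move=> ab; pose M := 1 + `|a| + `|b|.
have M1 : 1 <= M by rewrite /M -addrA lerDl addr_ge0.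
have p2 : 0 <= (pi : R) by exact: pi_ge0.
(* The first term serves |y| < 2 M, where theta <= 2 pi and poisson 1 y >= 2 / (1 + 4 M^2); the
   second is [poisson_tail] integrated over [a, b]. *)
exists (pi * (1 + 4 * M ^+ 2) + 8 * (b - a)) => e y e01.
have /andP[e0 e1] := e01.
rewrite ger0_norm ?theta_ge0//.
have p0 := poisson_ge0 y (@ltr01 R).
have [yM|yM] := leP (2 * M) `|y|.
  apply: le_trans (_ : 8 * (b - a) * poisson 1 y <= _); last first.
    by rewrite ler_wpM2r// lerDr mulr_ge0// addr_ge0// mulr_ge0// sqr_ge0.
  rewrite /theta -int_poisson_box//.
  apply: le_trans (_ : \int[mu]_z (8 * poisson 1 y * box a b z) <= _).
    apply: le_int.
    - exact: L1_box_continuous (continuous_poissonB e0).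
    - exact/L1Z/L1_box.
    move=> z; rewrite mulrC boxE; case: (boolP (a <= z <= b)%R) => [/andP[az zb]|_].
      rewrite !mulr1; apply: (poisson_tail e01 M1) => //.
      rewrite ler_norml /M; have := ler_norm b; have := ler_norm (- a).
      rewrite normrN; have := normr_ge0 a; have := normr_ge0 b => ? ? ? ?.
      by apply/andP; split; lra.
    by rewrite !mulr0.
  rewrite intZ; last exact: L1_box.
  rewrite (_ : \int[mu]_x box a b x = b - a); first by rewrite mulrAC.
  have := @FTC_box R (fun=> 1) id a b ab (fun x => cvg_cst _) (fun x => is_derive_id x 1).
  by move=> <-; apply: eq_Rintegral => z _; rewrite mulr1.
apply: le_trans (theta_le _ _ _ _) _.
apply: le_trans (_ : pi * (1 + 4 * M ^+ 2) * poisson 1 y <= _); last first.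
  by rewrite ler_wpM2r// lerDl mulr_ge0// subr_ge0.
rewrite [leLHS]mulrC -[leRHS]mulrA ler_wpM2l// /poisson mulr1 expr1n mulrA.
rewrite ler_pdivlMr; last by rewrite ltr_pwDl// sqr_ge0.
have : y ^+ 2 <= 4 * M ^+ 2.
  by rewrite -(real_normK (num_real y)); have := normr_ge0 y; nra.
lra.
Qed.

Lemma cvg_atan_div c : c != 0 ->
  atan (c / n.+1%:R^-1) @[n --> \oo] --> Num.sg c * (pi / 2).
Proof.
suff H d : 0 < d -> atan (d / n.+1%:R^-1) @[n --> \oo] --> (pi / 2 : R).
  have [c0|c0|->] := ltrgt0P c; last by [].
    by move=> _; rewrite gtr0_sg// mul1r; exact: H.
  move=> _; rewrite ltr0_sg// mulN1r.
  have Hn : - atan (- c / n.+1%:R^-1) @[n --> \oo] --> (- (pi / 2) : R).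
    by apply: cvgN; apply: H; rewrite oppr_gt0.
  have E n : atan (c / n.+1%:R^-1) = - atan (- c / n.+1%:R^-1) by rewrite mulNr atanN opprK.
  by under eq_fun do rewrite E.
move=> d0; have dn : d / n.+1%:R^-1 @[n --> \oo] --> (+oo : set_system R).
  apply/cvgryPge => A; near=> n; rewrite invrK -ler_pdivrMl//.
  rewrite (@le_trans _ _ n%:R)// ?ler_nat//.
  by near: n; exact: nbhs_infty_ger.
exact: (cvg_comp _ _ dn (@cvgy_atan R)).
Unshelve. all: by end_near. Qed.

(** The end points are excluded because for a < b the limit there is pi, half the value inside. *)
Lemma cvg_theta a b y : y != a -> y != b -> a <= b ->
  theta n.+1%:R^-1 a b y @[n --> \oo] --> 2 * pi * box a b y.
Proof.
move=> ya yb ab.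
have H : theta n.+1%:R^-1 a b y @[n --> \oo] -->
   2 * (Num.sg (y - a) * (pi / 2) - Num.sg (y - b) * (pi / 2)).
  by apply: cvgMl_tmp; apply: cvgB; apply: cvg_atan_div; rewrite subr_eq0.
rewrite (_ : 2 * pi * box a b y =
  2 * (Num.sg (y - a) * (pi / 2) - Num.sg (y - b) * (pi / 2)))//.
rewrite boxE; have [ay|ya'|/eqP] := ltgtP a y; last by rewrite eq_sym (negbTE ya).
  rewrite (@gtr0_sg _ (y - a)) ?subr_gt0//.
  have [yb'|yb'|/eqP] := ltgtP y b; last by rewrite (negbTE yb).
    by rewrite ltr0_sg ?subr_lt0//=; lra.
  by rewrite gtr0_sg ?subr_gt0//= subrr !mulr0.
rewrite (@ltr0_sg _ (y - a)) ?subr_lt0// ltr0_sg ?subr_lt0 ?(lt_le_trans ya')//=.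
by rewrite subrr !mulr0.
Qed.

Section expw_box.
Context (e a b : R) (e0 : 0 < e) (ab : a <= b).
Let b1 := @L1_box R a b.
Let mh := measurable_hartley1 b1.

Lemma expw_box_L1 : L1 (fun x => expw e x * hartley1 (box a b) x).
Proof. exact: L1_expwM e0 mh (fun x => norm_hartley1_le x b1). Qed.

Lemma expw_box_L2 : L2 (fun x => expw e x * hartley1 (box a b) x).
Proof.
have [h2 _] := bessel1 b1 (L2_box a b).
apply: (L2M_bounded (c := 1)) => //.
  exact: continuous_measurable_fun (@continuous_expw R e).
by move=> x; rewrite ger0_norm ?expw_ge0// expw_le1// ltW.
Qed.

Lemma hartley1_expw_box :
  hartley1 (fun x => expw e x * hartley1 (box a b) x) = theta e a b.
Proof.
apply/funext => y; rewrite hartley1_expw// /theta -int_poisson_box//.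
by apply: eq_Rintegral => z _; rewrite mulrC.
Qed.

Lemma measurable_theta : measurable_fun setT (theta e a b).
Proof. by rewrite -hartley1_expw_box; exact: measurable_hartley1 expw_box_L1. Qed.

Lemma hartley_expw_box :
  {ae mu, forall y, hartley (fun x => expw e x * hartley1 (box a b) x) y = theta e a b y}.
Proof. by rewrite -hartley1_expw_box; exact: hartley_L1 expw_box_L1 expw_box_L2. Qed.

End expw_box.

(** Both sides are tested against the indicator of [a, b]. The integral of [hartley f] times the
    Abel-weighted transform of the box has two limits as e tends to 0: removing the weight gives the
    integral of [hartley (hartley f)] over [a, b], while moving the transform back onto the box
    gives the integrals of f * theta, which tend to 2 pi times that of f. *)
Theorem hartleyK f : L2 f -> {ae mu, forall x, hartley (hartley f) x = 2 * pi * f x}.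
Proof.
move=> f2; have h2 := hartley_L2 f2; have hh2 := hartley_L2 h2.
have pf2 := L2Z (2 * pi) f2.
suff : {ae mu, forall x, hartley (hartley f) x - 2 * pi * f x = 0}.
  by apply: aeS => x /eqP; rewrite subr_eq0 => /eqP.
apply: L2_ae_eq0; first exact: L2B.
move=> a b ab; have b1 := @L1_box R a b; have b2 := @L2_box R a b.
have [hb2 _] := bessel1 b1 b2.
have mh := measurable_hartley1 b1.
pose e (n : nat) : R := n.+1%:R^-1.
have e01 n : 0 < e n <= 1 by rewrite invr_gt0 ltr0n/= invf_le1// ler1n.
have e0 n : 0 < e n by case/andP: (e01 n).
have eh2 n := expw_box_L2 a b (e0 n).
have lim1 : \int[mu]_x (hartley f x * (expw (e n) x * hartley1 (box a b) x))
    @[n --> \oo] --> \int[mu]_x (box a b x * hartley (hartley f) x).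
  have -> : \int[mu]_x (box a b x * hartley (hartley f) x) =
      \int[mu]_x (hartley f x * hartley1 (box a b) x).
    rewrite hartley_duality//; apply: ae_eq_int.
    - by apply: measurable_funM; [case: h2|case: (hartley_L2 b2)].
    - by apply: measurable_funM => //; case: h2.
    - by apply: (aeS _ (hartley_L1 b1 b2)) => x ->.
  have [|||||_] := @dominated_cvg_int R
     (fun n x => hartley f x * (expw (e n) x * hartley1 (box a b) x))
     (fun x => hartley f x * hartley1 (box a b) x)
     (fun x => `|hartley f x * hartley1 (box a b) x|) => //.
  - by move=> n; apply: measurable_funM; [case: h2|case: (eh2 n)].
  - by apply: measurable_funM => //; case: h2.
  - by apply: L1_norm; exact: L2M.
  - apply: aeT => x; apply: cvgMl_tmp; rewrite -[X in _ --> X]mul1r.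
    by apply: cvgMr_tmp; exact: cvg_expw1.
  - move=> n x; rewrite mulrCA normrM ler_piMl// ger0_norm ?expw_ge0//.
    by rewrite expw_le1// ltW.
have lim2 : \int[mu]_x (hartley f x * (expw (e n) x * hartley1 (box a b) x))
    @[n --> \oo] --> \int[mu]_x (2 * pi * (box a b x * f x)).
  have [C HC] := theta_majorant ab.
  have w2 : L2 (@poisson R 1).
    apply: (le_L2 _ (poisson_L2 0 (@ltr01 R))).
      exact: continuous_measurable_fun (continuous_poisson ltr01).
    by move=> x; rewrite sub0r poissonN.
  have E n : \int[mu]_x (hartley f x * (expw (e n) x * hartley1 (box a b) x)) =
      \int[mu]_x (f x * theta (e n) a b x).
    rewrite -[RHS](_ : \int[mu]_x (f x *
      hartley (fun x => expw (e n) x * hartley1 (box a b) x) x) = _).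
      rewrite (hartley_duality f2 (eh2 n)).
      by apply: eq_Rintegral => x _; rewrite mulrC.
    apply: ae_eq_int.
    - by apply: measurable_funM; [case: f2|case: (hartley_L2 (eh2 n))].
    - by apply: measurable_funM; [case: f2|exact: measurable_theta].
    - by apply: (aeS _ (hartley_expw_box (e0 n) ab)) => x ->.
  under eq_fun do rewrite E.
  have [|||||_] := @dominated_cvg_int R
     (fun n x => f x * theta (e n) a b x)
     (fun x => 2 * pi * (box a b x * f x))
     (fun x => `|f x * (C * poisson 1 x)|) => //.
  - by move=> n; apply: measurable_funM; [case: f2|exact: measurable_theta].
  - by apply: measurable_funM => //; apply: measurable_funM; [exact: measurable_box|case: f2].
  - by apply: L1_norm; apply: L2M => //; exact: L2Z.
  - apply: (aeS2 _ (aeN0 a) (aeN0 b)) => x xa xb.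
    rewrite (_ : 2 * pi * _ = f x * (2 * pi * box a b x)); last by ring.
    by apply: cvgMl_tmp; exact: cvg_theta.
  - move=> n x; rewrite normrM [leRHS]normrM ler_wpM2l//.
    by rewrite (le_trans (HC _ x (e01 n)))// ler_norm.
have := cvg_unique _ lim1 lim2.
rewrite intZ; last exact: (L2M b2 f2).
move=> E; rewrite (_ : \int[mu]_x _ = \int[mu]_x (box a b x * hartley (hartley f) x -
   2 * pi * (box a b x * f x))); last first.
  by apply: eq_Rintegral => x _; move: (box a b x) (hartley _ x) => p q; ring.
rewrite intB; [|exact: L2M|exact/L1Z/(L2M b2 f2)].
by rewrite E// intZ ?subrr//; exact: (L2M b2 f2).
Qed.

Lemma hartley_parseval f g : L2 f -> L2 g ->
  \int[mu]_x (hartley f x * hartley g x) = 2 * pi * \int[mu]_x (f x * g x).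
Proof.
move=> f2 g2; have hf2 := hartley_L2 f2; have hhf2 := hartley_L2 hf2.
rewrite hartley_duality// -intZ; last exact: L2M.
apply: ae_eq_int.
- by apply: measurable_funM; [case: g2|case: hhf2].
- by apply: measurable_funM => //; apply: measurable_funM; [case: f2|case: g2].
- by apply: (aeS _ (hartleyK f2)) => x ->; ring.
Qed.

Lemma continuous_ae_eq f g : continuous f -> continuous g ->
  {ae mu, forall x, f x = g x} -> f = g.
Proof.
move=> cf cg [N [mN N0 Nfg]]; apply/funext => x; apply: contrapT => /eqP fgx.
have op : \near x, f x - g x != 0.
  have : {for x, continuous (fun x => f x - g x)} by apply: cvgB; [exact: cf|exact: cg].
  by move=> /cvgr_neq0; apply; rewrite subr_eq0.
have [e /= e0 He] := op.
have : (mu (ball x e) <= mu N)%E.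
  apply: le_measure; rewrite ?inE//; first exact: measurable_ball.
  move=> y /He; apply: contraPP => Ny /eqP; apply; apply/eqP; rewrite subr_eq0.
  by apply: contrapT => fgy; apply: Ny; apply: Nfg => /= fgy'; rewrite fgy' eqxx in fgy.
rewrite N0 lebesgue_measure_ball; last exact: ltW.
by rewrite leNgt lte_fin pmulrn_rgt0 ?e0.
Qed.

Lemma hartley_inversion f : L2 f -> continuous f -> L1 (hartley f) ->
  forall x, f x = (2 * pi)^-1 * hartley1 (hartley f) x.
Proof.
move=> f2 cf h1; have h2 := hartley_L2 f2.
suff E : f = fun x => (2 * pi)^-1 * hartley1 (hartley f) x.
  by move=> x; exact: (congr1 (@^~ x) E).
apply: (continuous_ae_eq cf).
  by move=> x; apply: cvgMl_tmp; exact: continuous_hartley1.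
apply: (aeS2 _ (hartleyK f2) (hartley_L1 h1 h2)) => x E <-.
by rewrite E mulrA mulVf ?mul1r// gt_eqF// mulr_gt0// pi_gt0.
Qed.

End Inversion.

(** * Fourier and Hilbert transforms of real functions *)

Section Complex.
Local Open Scope complex_scope.
Context {R : realType}.
Notation mu := (@lebesgue_measure R).
Notation Re := complex.Re.
Notation Im := complex.Im.
Implicit Types (f g h p q : R -> R) (F G : R -> R[i]) (a b c x y : R).

Lemma Lfun2P f : f \in Lfun mu 2%:E <-> L2 f.
Proof.
split=> [f2|[mf f2]].
  split; last exact: Lfun2_integrable_sqr.
  by move: f2; rewrite inE => /andP[+ _]; rewrite inE.
rewrite inE; apply/andP; split; rewrite inE//= /finite_norm unlock.
apply: poweR_lty; have /integrableP[_] := f2; apply: le_lt_trans.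
rewrite le_eqVlt; apply/orP; left; apply/eqP; apply: eq_integral => x _.
by rewrite /= powR_mulrn// -normrX.
Qed.

Definition L2c F := L2 (fun x => Re (F x)) /\ L2 (fun x => Im (F x)).

Lemma L2CP F : L2C F <-> L2c F.
Proof. by split=> -[/Lfun2P ? /Lfun2P ?]. Qed.

Lemma normc_sqr (z : R[i]) : ComplexField.Normc.normc z ^+ 2 = Re z ^+ 2 + Im z ^+ 2.
Proof. by case: z => a b /=; rewrite sqr_sqrtr// addr_ge0// sqr_ge0. Qed.

Lemma normc_ge0 (z : R[i]) : 0 <= ComplexField.Normc.normc z.
Proof. by case: z => a b /=; exact: sqrtr_ge0. Qed.

Lemma L2normCE F : L2normC F =
  ((\int[mu]_x (Re (F x) ^+ 2 + Im (F x) ^+ 2)%:E) `^ 2^-1)%E.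
Proof.
rewrite /L2normC unlock; congr (_ `^ _)%E; apply: eq_integral => x _.
by rewrite /= ger0_norm ?normc_ge0// powR_mulrn ?normc_ge0// normc_sqr.
Qed.

Lemma L2c_sqr F : L2c F -> L1 (fun x => Re (F x) ^+ 2 + Im (F x) ^+ 2).
Proof. by move=> [[_ F1] [_ F2]]; exact: L1D. Qed.

Lemma L2normC_L2c F : L2c F -> L2normC F =
  (Num.sqrt (\int[mu]_x Re (F x) ^+ 2 + \int[mu]_x Im (F x) ^+ 2))%:E.
Proof.
move=> F2; rewrite L2normCE intE; last exact: L2c_sqr.
case: F2 => [[_ F1] [_ F2]].
by rewrite poweR_EFin powR12_sqrt intD// addr_ge0// int_sqr_ge0.
Qed.

Lemma cvg_L2normC T (FF : set_system T) {PF : ProperFilter FF} (Fn : T -> R -> R[i]) :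
  (forall t, L2c (Fn t)) ->
  L2normC (Fn t) @[t --> FF] --> 0%E <->
  (\int[mu]_x Re (Fn t x) ^+ 2 @[t --> FF] --> 0) /\
  (\int[mu]_x Im (Fn t x) ^+ 2 @[t --> FF] --> 0).
Proof.
move=> F2.
pose A t := \int[mu]_x Re (Fn t x) ^+ 2; pose B t := \int[mu]_x Im (Fn t x) ^+ 2.
have A0 t : 0 <= A t by exact: (int_sqr_ge0 (fun x => Re (Fn t x))).
have B0 t : 0 <= B t by exact: (int_sqr_ge0 (fun x => Im (Fn t x))).
have E t : L2normC (Fn t) = (Num.sqrt (A t + B t))%:E by rewrite L2normC_L2c.
under eq_fun do rewrite E.
rewrite -/A -/B; split.
  move=> /fine_cvg /= H.
  have H2 : Num.sqrt (A t + B t) * Num.sqrt (A t + B t) @[t --> FF] --> (0 * 0 : R).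
    by apply: cvgM; exact: H.
  have {}H2 : A t + B t @[t --> FF] --> (0 : R).
    rewrite mulr0 in H2; apply: cvg_trans H2; apply: near_eq_cvg; apply: nearW => t /=.
    by rewrite -expr2 sqr_sqrtr// addr_ge0.
  split; apply: (squeeze_cvgr _ (cvg_cst 0) H2); apply: nearW => t.
    by rewrite A0/= lerDl.
  by rewrite B0/= lerDr.
move=> [HA HB]; apply: cvg_EFin; first exact: nearW.
have H : A t + B t @[t --> FF] --> (0 + 0 : R) by exact: (@cvgD _ _ _ _ _ A B).
rewrite addr0 in H; rewrite -(@sqrtr0 R).
exact: (cvg_comp _ _ H (@sqrt_continuous R 0)).
Qed.

(** Serves [fourier] and [ifourier] alike: a limit is exhibited so that [xget] does not fall back to
    0, and uniqueness of L^2 limits identifies the chosen representative. *)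
Lemma xget_L2C (Fn : nat -> R -> R[i]) p q :
  (forall n, L2c (Fn n)) -> L2 p -> L2 q ->
  \int[mu]_x (Re (Fn n x) - p x) ^+ 2 @[n --> \oo] --> 0 ->
  \int[mu]_x (Im (Fn n x) - q x) ^+ 2 @[n --> \oo] --> 0 ->
  let g := xget (fun=> 0) [set g | L2C g /\
    L2normC (fun x => Fn n x - g x) @[n --> \oo] --> 0%E] in
  {ae mu, forall x, g x = p x +i* q x} /\ L2c g.
Proof.
move=> Fn2 p2 q2 Fp Fq /=; set S := [set g | _].
have ReB (z w : R[i]) : Re (z - w) = Re z - Re w by case: z; case: w.
have ImB (z w : R[i]) : Im (z - w) = Im z - Im w by case: z; case: w.
have B2 G : L2c G -> forall n, L2c (fun x => Fn n x - G x).
  move=> [G1 G2] n; have [F1 F2] := Fn2 n; split.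
    by under eq_fun do rewrite ReB; exact: L2B.
  by under eq_fun do rewrite ImB; exact: L2B.
have cvgE G : L2c G -> L2normC (fun x => Fn n x - G x) @[n --> \oo] --> 0%E <->
    (\int[mu]_x (Re (Fn n x) - Re (G x)) ^+ 2 @[n --> \oo] --> 0) /\
    (\int[mu]_x (Im (Fn n x) - Im (G x)) ^+ 2 @[n --> \oo] --> 0).
  move=> G2; rewrite cvg_L2normC; last exact: B2.
  have E1 n : \int[mu]_x Re (Fn n x - G x) ^+ 2 = \int[mu]_x (Re (Fn n x) - Re (G x)) ^+ 2.
    by apply: eq_Rintegral => x _; rewrite ReB.
  have E2 n : \int[mu]_x Im (Fn n x - G x) ^+ 2 = \int[mu]_x (Im (Fn n x) - Im (G x)) ^+ 2.
    by apply: eq_Rintegral => x _; rewrite ImB.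
  split=> -[H1 H2]; split.
  - by under eq_fun do rewrite -E1.
  - by under eq_fun do rewrite -E2.
  - by under eq_fun do rewrite E1.
  - by under eq_fun do rewrite E2.
have pq2 : L2c (fun x => p x +i* q x) by [].
have : S (xget (fun=> 0) S).
  apply: (@xgetPex _ (fun=> 0) S); exists (fun x => p x +i* q x); split.
    exact/L2CP.
  by apply/cvgE.
move: (xget _ _) => g [/L2CP g2 /(cvgE _ g2)[g_re g_im]]; split => //.
have H1 : {ae mu, forall x, Re (g x) = p x}.
  by apply: (cvg2_unique _ g2.1 p2 g_re Fp); apply: nearW => n; case: (Fn2 n).
have H2 : {ae mu, forall x, Im (g x) = q x}.
  by apply: (cvg2_unique _ g2.2 q2 g_im Fq); apply: nearW => n; case: (Fn2 n).
by apply: (aeS2 _ H1 H2) => x <- <-; case: (g x).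
Qed.

(** The even and odd parts of a Hartley transform are the cosine and sine transforms; the Fourier
    transform of a real function is the former minus i times the latter. *)
Definition evenp f x : R := (f x + f (- x)) / 2.
Definition oddp f x : R := (f x - f (- x)) / 2.

Lemma L2_evenp f : L2 f -> L2 (evenp f).
Proof.
move=> f2; have := L2Z 2^-1 (L2D f2 (L2_opp f2)).
by congr L2; apply/funext => x; rewrite /evenp mulrC.
Qed.

Lemma L2_oddp f : L2 f -> L2 (oddp f).
Proof.
move=> f2; have := L2Z 2^-1 (L2B f2 (L2_opp f2)).
by congr L2; apply/funext => x; rewrite /oddp mulrC.
Qed.

Lemma int_evenp_oddp f : L2 f ->
  \int[mu]_x evenp f x ^+ 2 + \int[mu]_x oddp f x ^+ 2 = \int[mu]_x f x ^+ 2.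
Proof.
move=> f2; have [_ e2] := L2_evenp f2; have [_ o2] := L2_oddp f2.
have [mf fs] := f2; have [_ fo] := L2_opp f2.
rewrite -intD//.
transitivity (\int[mu]_x (2^-1 * f x ^+ 2 + 2^-1 * f (- x) ^+ 2)).
  by apply: eq_Rintegral => x _; rewrite /evenp /oddp; field.
rewrite intD; [|exact: L1Z|exact: L1Z].
rewrite !intZ// (int_opp (f := fun x => f x ^+ 2)); last exact: measurable_funX.
lra.
Qed.

Lemma cvg_evenp_oddp (fn : nat -> R -> R) f : (forall n, L2 (fn n)) -> L2 f ->
  \int[mu]_x (fn n x - f x) ^+ 2 @[n --> \oo] --> 0 ->
  (\int[mu]_x (evenp (fn n) x - evenp f x) ^+ 2 @[n --> \oo] --> 0) /\
  (\int[mu]_x (oddp (fn n) x - oddp f x) ^+ 2 @[n --> \oo] --> 0).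
Proof.
move=> fn2 f2 H.
have EE n : \int[mu]_x (evenp (fn n) x - evenp f x) ^+ 2 =
    \int[mu]_x evenp (fun x => fn n x - f x) x ^+ 2.
  by apply: eq_Rintegral => x _; rewrite /evenp; congr (_ ^+ 2); ring.
have EO n : \int[mu]_x (oddp (fn n) x - oddp f x) ^+ 2 =
    \int[mu]_x oddp (fun x => fn n x - f x) x ^+ 2.
  by apply: eq_Rintegral => x _; rewrite /oddp; congr (_ ^+ 2); ring.
have S n := int_evenp_oddp (L2B (fn2 n) f2).
split.
- apply: (squeeze_cvgr _ (cvg_cst 0) H); apply: nearW => n.
  by rewrite EE (int_sqr_ge0 (evenp _))/= -S lerDl (int_sqr_ge0 (oddp _)).
- apply: (squeeze_cvgr _ (cvg_cst 0) H); apply: nearW => n.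
  by rewrite EO (int_sqr_ge0 (oddp _))/= -S lerDr (int_sqr_ge0 (evenp _)).
Qed.

End Complex.

(** * Fourier transforms expressed by the Hartley transform *)

Section FourierHartley.
Local Open Scope complex_scope.
Context {R : realType}.
Notation mu := (@lebesgue_measure R).
Notation Re := complex.Re.
Notation Im := complex.Im.
Implicit Types (f g h p q : R -> R) (F G : R -> R[i]) (a b c x y : R).

Lemma ae_opp (P : R -> Prop) : {ae mu, forall x, P x} -> {ae mu, forall x, P (- x)}.
Proof.
move=> [N [mN N0 PN]]; exists (-%R @^-1` N); split.
- by rewrite -[X in measurable X]setTI; exact: (@oppr_measurable R _ measurableT _ mN).
- by have := lebesgue_measureN mN; rewrite N0 => <-.
- by move=> x /= nP; exact: PN.
Qed.

Lemma evenp_hartley1 f x : L1 f -> evenp (hartley1 f) x = \int[mu]_y (cos (x * y) * f y).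
Proof.
move=> f1; rewrite /evenp /hartley1 -intD; [|exact: L1_casM|exact: L1_casM].
rewrite mulrC -intZ; last by apply: L1D; exact: L1_casM.
by apply: eq_Rintegral => y _; rewrite mulNr /cas cosN sinN; move: (cos _) (sin _) (f y) => u v w; lra.
Qed.

Lemma oddp_hartley1 f x : L1 f -> oddp (hartley1 f) x = \int[mu]_y (sin (x * y) * f y).
Proof.
move=> f1; rewrite /oddp /hartley1 -intB; [|exact: L1_casM|exact: L1_casM].
rewrite mulrC -intZ; last by apply: L1B; exact: L1_casM.
by apply: eq_Rintegral => y _; rewrite mulNr /cas cosN sinN; move: (cos _) (sin _) (f y) => u v w; lra.
Qed.

Lemma L1_trig_trunc (t : R -> R) f x : continuous t -> (forall y, `|t y| <= 1) -> L1 f ->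
  L1 (fun y => t (x * y) * f y).
Proof.
move=> ct t1 f1; apply: (L1M_bounded (c := 1)) => //; exact: measurable_trig.
Qed.

Lemma int_trunc n (t : R -> R) f :
  \int[mu]_(x in `[- n%:R, n%:R]) (t x * f x) = \int[mu]_x (t x * trunc n f x).
Proof. by rewrite int_box; apply: eq_Rintegral => x _; rewrite /trunc mulrCA. Qed.

Lemma fourier_trunc_hartley n f x : L2 f ->
  fourier_trunc n (fun x => (f x)%:C) x =
  evenp (hartley1 (trunc n f)) x -i* oddp (hartley1 (trunc n f)) x.
Proof.
move=> f2; rewrite evenp_hartley1 ?oddp_hartley1; [|exact: trunc_L1|exact: trunc_L1].
rewrite /fourier_trunc /cintegral -!int_trunc; congr (_ +i* _).
  by apply: eq_Rintegral => y _; rewrite /= mulr0 subr0 cosN.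
have f1 : L1 (fun y => sin (x * y) * trunc n f y).
  by apply: L1_trig_trunc (trunc_L1 n f2); [exact: continuous_sin|exact: sin_max].
rewrite int_trunc -intN// (_ : (fun y => _) = (fun y => - sin (x * y) * f y)); last first.
  by apply/funext => y; rewrite /= mulr0 add0r sinN.
by rewrite int_trunc; apply: eq_Rintegral => y _; rewrite mulNr.
Qed.

Lemma fourierR_hartley f : L2 f -> {ae mu, forall x,
  fourierR f x = evenp (hartley f) x -i* oddp (hartley f) x} /\ L2c (fourierR f).
Proof.
move=> f2; have [h2 Hh] := hartleyP f2.
have hn2 n := hartley1_trunc_L2 n f2.
have [He Ho] := cvg_evenp_oddp hn2 h2 Hh.
apply: (@xget_L2C R (fun n => fourier_trunc n (fun x => (f x)%:C))).
- move=> n; split.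
    by under eq_fun do rewrite fourier_trunc_hartley//=; exact: L2_evenp.
  by under eq_fun do rewrite fourier_trunc_hartley//=; exact/L2N/L2_oddp.
- exact: L2_evenp.
- exact/L2N/L2_oddp.
- have E n : \int[mu]_x (Re (fourier_trunc n (fun x => (f x)%:C) x) - evenp (hartley f) x) ^+ 2 =
     \int[mu]_x (evenp (hartley1 (trunc n f)) x - evenp (hartley f) x) ^+ 2.
    by apply: eq_Rintegral => x _; rewrite fourier_trunc_hartley.
  by under eq_fun do rewrite E.
- have E n : \int[mu]_x (Im (fourier_trunc n (fun x => (f x)%:C) x) - - oddp (hartley f) x) ^+ 2 =
     \int[mu]_x (oddp (hartley1 (trunc n f)) x - oddp (hartley f) x) ^+ 2.
    by apply: eq_Rintegral => x _; rewrite fourier_trunc_hartley//= -opprD sqrrN.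
  by under eq_fun do rewrite E.
Qed.

Lemma ifourier_trunc_hartley n G x : L2c G ->
  let p := fun x => Re (G x) in let q := fun x => Im (G x) in
  ifourier_trunc n G x =
  ((2 * pi)^-1 * (evenp (hartley1 (trunc n p)) x - oddp (hartley1 (trunc n q)) x)) +i*
  ((2 * pi)^-1 * (evenp (hartley1 (trunc n q)) x + oddp (hartley1 (trunc n p)) x)).
Proof.
move=> [p2 q2] p q.
have p1 := trunc_L1 n p2; have q1 := trunc_L1 n q2.
rewrite !evenp_hartley1// !oddp_hartley1//.
have cosL f : L1 f -> L1 (fun y => cos (x * y) * f y).
  by apply: L1_trig_trunc; [exact: continuous_cos|exact: cos_max].
have sinL f : L1 f -> L1 (fun y => sin (x * y) * f y).
  by apply: L1_trig_trunc; [exact: continuous_sin|exact: sin_max].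
rewrite -intB; [|exact: cosL|exact: sinL].
rewrite -intD; [|exact: cosL|exact: sinL].
rewrite /ifourier_trunc /cintegral.
rewrite (_ : \int[mu]_(y in `[- n%:R, n%:R]) Re (cexpi (y * x) * G y) =
  \int[mu]_y (cos (x * y) * trunc n p y - sin (x * y) * trunc n q y)); last first.
  rewrite int_box; apply: eq_Rintegral => y _; rewrite /trunc /p /q [y * x]mulrC.
  by case: (G y) => a b /=; ring.
rewrite (_ : \int[mu]_(y in `[- n%:R, n%:R]) Im (cexpi (y * x) * G y) =
  \int[mu]_y (cos (x * y) * trunc n q y + sin (x * y) * trunc n p y)); last first.
  rewrite int_box; apply: eq_Rintegral => y _; rewrite /trunc /p /q [y * x]mulrC.
  by case: (G y) => a b /=; ring.
by apply/eqP; rewrite eq_complex /= !mul0r subr0 addr0 !eqxx.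
Qed.

Lemma cvg_sqrD (a b : R) (A B : nat -> R -> R) p q :
  (forall n, L2 (A n)) -> (forall n, L2 (B n)) -> L2 p -> L2 q ->
  \int[mu]_x (A n x - p x) ^+ 2 @[n --> \oo] --> 0 ->
  \int[mu]_x (B n x - q x) ^+ 2 @[n --> \oo] --> 0 ->
  \int[mu]_x (a * (A n x + b * B n x) - a * (p x + b * q x)) ^+ 2 @[n --> \oo] --> 0.
Proof.
move=> A2 B2 p2 q2 HA HB.
pose U n := \int[mu]_x (A n x - p x) ^+ 2; pose V n := \int[mu]_x (B n x - q x) ^+ 2.
have H : a ^+ 2 * (2 * (U n + b ^+ 2 * V n)) @[n --> \oo] --> (a ^+ 2 * (2 * (0 + b ^+ 2 * 0)) : R).
  apply: cvgMl_tmp; apply: cvgMl_tmp; apply: (@cvgD _ _ _ _ _ U (fun n => b ^+ 2 * V n)) => //.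
  exact: cvgMl_tmp.
rewrite !(mulr0, addr0) in H.
apply: (squeeze_cvgr _ (cvg_cst 0) H); apply: nearW => n.
have AD := L2B (A2 n) p2; have BD := L2B (B2 n) q2.
rewrite (int_sqr_ge0 (fun x => a * (A n x + b * B n x) - a * (p x + b * q x)))/=.
rewrite (_ : \int[mu]_x _ = \int[mu]_x (a ^+ 2 * ((A n x - p x) + b * (B n x - q x)) ^+ 2)); last first.
  apply: eq_Rintegral => x _; rewrite -exprMn; congr (_ ^+ 2); ring.
rewrite intZ; last by case: (L2D AD (L2Z b BD)).
rewrite ler_wpM2l ?sqr_ge0// (le_trans (int_sqrD_le AD (L2Z b BD)))//.
rewrite le_eqVlt; apply/orP; left; apply/eqP; congr (2 * (_ + _)).
rewrite -intZ; last by case: BD.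
by apply: eq_Rintegral => x _; rewrite exprMn.
Qed.

Lemma ifourier_hartley G : L2c G ->
  {ae mu, forall x, Re (ifourier G x) = (2 * pi)^-1 *
    (evenp (hartley (fun x => Re (G x))) x - oddp (hartley (fun x => Im (G x))) x)} /\
  L2 (fun x => Re (ifourier G x)).
Proof.
move=> G2; have [p2 q2] := G2.
set p := fun x => Re (G x) in p2 *; set q := fun x => Im (G x) in q2 *.
have [hp2 Hp] := hartleyP p2; have [hq2 Hq] := hartleyP q2.
have pn2 n := hartley1_trunc_L2 n p2; have qn2 n := hartley1_trunc_L2 n q2.
have [Hpe Hpo] := cvg_evenp_oddp pn2 hp2 Hp.
have [Hqe Hqo] := cvg_evenp_oddp qn2 hq2 Hq.
have E n x := ifourier_trunc_hartley n x G2.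
have [|||||H1 [H2 _]] := @xget_L2C R (fun n => ifourier_trunc n G)
  (fun x => (2 * pi)^-1 * (evenp (hartley p) x + -1 * oddp (hartley q) x))
  (fun x => (2 * pi)^-1 * (evenp (hartley q) x + 1 * oddp (hartley p) x)).
- move=> n; split; under eq_fun do rewrite E /=.
    exact: (L2Z _ (L2B (L2_evenp (pn2 n)) (L2_oddp (qn2 n)))).
  exact: (L2Z _ (L2D (L2_evenp (qn2 n)) (L2_oddp (pn2 n)))).
- by apply/L2Z/L2D; [exact: L2_evenp|exact/L2Z/L2_oddp].
- by apply/L2Z/L2D; [exact: L2_evenp|exact/L2Z/L2_oddp].
- have HH := cvg_sqrD (2 * pi)^-1 (-1) (fun n => L2_evenp (pn2 n)) (fun n => L2_oddp (qn2 n))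
    (L2_evenp hp2) (L2_oddp hq2) Hpe Hqo.
  have F n : \int[mu]_x (Re (ifourier_trunc n G x) - (2 * pi)^-1 * (evenp (hartley p) x + -1 * oddp (hartley q) x)) ^+ 2 =
    \int[mu]_x ((2 * pi)^-1 * (evenp (hartley1 (trunc n p)) x + -1 * oddp (hartley1 (trunc n q)) x)
     - (2 * pi)^-1 * (evenp (hartley p) x + -1 * oddp (hartley q) x)) ^+ 2.
    by apply: eq_Rintegral => x _; rewrite E /= !mulN1r.
  by under eq_fun do rewrite F.
- have HH := cvg_sqrD (2 * pi)^-1 1 (fun n => L2_evenp (qn2 n)) (fun n => L2_oddp (pn2 n))
    (L2_evenp hq2) (L2_oddp hp2) Hqe Hpo.
  have F n : \int[mu]_x (Im (ifourier_trunc n G x) - (2 * pi)^-1 * (evenp (hartley q) x + 1 * oddp (hartley p) x)) ^+ 2 =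
    \int[mu]_x ((2 * pi)^-1 * (evenp (hartley1 (trunc n q)) x + 1 * oddp (hartley1 (trunc n p)) x)
     - (2 * pi)^-1 * (evenp (hartley q) x + 1 * oddp (hartley p) x)) ^+ 2.
    by apply: eq_Rintegral => x _; rewrite E /= !mul1r.
  by under eq_fun do rewrite F.
split; last exact: H2.
by apply: (aeS _ H1) => x Ex; rewrite -mulN1r -[LHS]/(Re (ifourier G x)) [ifourier G x]Ex.
Qed.

End FourierHartley.

(** * The Hilbert transform on the Hartley side *)

Section HilbertHartley.
Local Open Scope complex_scope.
Context {R : realType}.
Notation mu := (@lebesgue_measure R).
Notation Re := complex.Re.
Notation Im := complex.Im.
Implicit Types (f g h p q : R -> R) (a b c x y : R).

Lemma L2_sgM f : L2 f -> L2 (fun x => Num.sg x * f x).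
Proof.
apply: (L2M_bounded (c := 1)); first exact: measurable_sgr.
by move=> x; rewrite normr_sg; case: (_ == _).
Qed.

Lemma aeI (P Q : R -> Prop) : {ae mu, forall x, P x} -> {ae mu, forall x, Q x} ->
  {ae mu, forall x, P x /\ Q x}.
Proof. by apply: aeS2. Qed.

Lemma hartley_even f : L2 f -> (forall x, f (- x) = f x) ->
  {ae mu, forall x, hartley f (- x) = hartley f x}.
Proof.
move=> f2 fe; apply: (aeS _ (hartley_opp f2)) => x <-.
by congr (hartley _ x); apply/funext => y; rewrite fe.
Qed.

Lemma hartley_odd f : L2 f -> (forall x, f (- x) = - f x) ->
  {ae mu, forall x, hartley f (- x) = - hartley f x}.
Proof.
move=> f2 fo; apply: (aeS2 _ (hartley_opp f2) (hartleyZ (-1) f2)) => x <-.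
rewrite mulN1r => <-; congr (hartley _ x).
by apply/funext => y; rewrite fo mulN1r.
Qed.

Lemma hilbert_hartley f : L2 f -> L2 (hilbert f) /\ {ae mu, forall x,
  hilbert f x = (2 * pi)^-1 * hartley (fun y => Num.sg y * hartley f (- y)) x}.
Proof.
move=> f2; have h2 := hartley_L2 f2; have [FE [F2 F2']] := fourierR_hartley f2.
pose G := fun y : R => (0 -i* 1) * (Num.sg y)%:C * fourierR f y.
have GRe y : Re (G y) = Num.sg y * Im (fourierR f y).
  by rewrite /G; case: (fourierR f y) => a b /=; ring.
have GIm y : Im (G y) = - (Num.sg y * Re (fourierR f y)).
  by rewrite /G; case: (fourierR f y) => a b /=; ring.
have P2 : L2 (fun y => Re (G y)) by under eq_fun do rewrite GRe; exact: L2_sgM.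
have Q2 : L2 (fun y => Im (G y)) by under eq_fun do rewrite GIm; exact/L2N/L2_sgM.
have [HE H2] := ifourier_hartley (conj P2 Q2); split; first exact: H2.
(* [P0] and [Q0] are the real and imaginary parts of - i sgn times the Fourier transform. [P0] is
   even and [Q0] odd, hence so are their Hartley transforms, and [P0 - Q0] is sgn(y) times the
   reflected Hartley transform of f. *)
pose P0 y := - (Num.sg y * oddp (hartley f) y).
pose Q0 y := - (Num.sg y * evenp (hartley f) y).
have P02 : L2 P0 by exact/L2N/L2_sgM/L2_oddp.
have Q02 : L2 Q0 by exact/L2N/L2_sgM/L2_evenp.
have PP : {ae mu, forall y, Re (G y) = P0 y}.
  by apply: (aeS _ FE) => y E; rewrite GRe E /= mulrN.
have QQ : {ae mu, forall y, Im (G y) = Q0 y}.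
  by apply: (aeS _ FE) => y E; rewrite GIm E.
have hPP := hartley_ae P2 P02 PP; have hQQ := hartley_ae Q2 Q02 QQ.
have P0e x : P0 (- x) = P0 x by rewrite /P0 sgrN /oddp opprK; field.
have Q0o x : Q0 (- x) = - Q0 x by rewrite /Q0 sgrN /evenp opprK; field.
have hk : {ae mu, forall x, hartley (fun y => Num.sg y * hartley f (- y)) x =
    hartley P0 x - hartley Q0 x}.
  rewrite (_ : (fun y => _) = fun y => P0 y - Q0 y); first exact: hartleyB.
  apply/funext => y; rewrite /P0 /Q0 /oddp /evenp.
  by move: (hartley f y) (hartley f (- y)) (Num.sg y) => u v w; field.
have eP := aeI hPP (aeI (ae_opp hPP) (hartley_even P02 P0e)).
have oQ := aeI hQQ (aeI (ae_opp hQQ) (hartley_odd Q02 Q0o)).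
apply: (aeS _ (aeI HE (aeI hk (aeI eP oQ)))) => x [A [B C]].
rewrite -[hilbert f x]/(Re (ifourier G x)) A B; move: C.
rewrite /evenp /oddp => -[[-> [-> ->]] [-> [-> ->]]].
by move: (hartley P0 x) (hartley Q0 x) => u v; congr (_ * _); field.
Qed.

Lemma hartley_hilbert f : L2 f -> {ae mu, forall x,
  hartley (hilbert f) x = Num.sg x * hartley f (- x)}.
Proof.
move=> f2; have [H2 HE] := hilbert_hartley f2; have h2 := hartley_L2 f2.
have k2 : L2 (fun y => Num.sg y * hartley f (- y)) by exact/L2_sgM/L2_opp.
have hk2 := hartley_L2 k2.
apply: (aeS _ (aeI (hartley_ae H2 (L2Z _ hk2) HE)
  (aeI (hartleyZ (2 * pi)^-1 hk2) (hartleyK k2)))) => x [-> [-> ->]].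
by rewrite mulrA mulVf ?mul1r// gt_eqF// mulr_gt0// pi_gt0.
Qed.

End HilbertHartley.

(** * Sobolev norms on the Hartley side *)

Section SobolevHartley.
Context {R : realType}.
Notation mu := (@lebesgue_measure R).
Notation Re := complex.Re.
Notation Im := complex.Im.
Implicit Types (f g h p q : R -> R) (a b c s x y : R).

Definition bessel_weight s x : R := (1 + x ^+ 2) `^ (s / 2).

Definition weighted s f x : R := bessel_weight s x * hartley f x.

Lemma bessel_weight_ge0 s x : 0 <= bessel_weight s x.
Proof. exact: powR_ge0. Qed.

Lemma bessel_weight_ge1 s x : 0 <= s -> 1 <= bessel_weight s x.
Proof.
move=> s0; rewrite -(powRr0 (1 + x ^+ 2)) ler_powR//.
  by rewrite lerDl sqr_ge0.
by rewrite divr_ge0.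
Qed.

Lemma measurable_bessel_weight s : measurable_fun setT (bessel_weight s).
Proof.
apply: (measurableT_comp (f := fun y : R => y `^ (s / 2))).
  exact: measurable_powR.
by apply: measurable_funD => //; exact: measurable_funX.
Qed.

Lemma measurable_weighted s f : L2 f -> measurable_fun setT (weighted s f).
Proof.
by move=> /hartley_L2[mh _]; apply: measurable_funM => //; exact: measurable_bessel_weight.
Qed.

(** The squared modulus of the Fourier transform at x is the mean of the squared Hartley transforms
    at x and - x, and the weight is even. The identity is in the extended reals, so it also decides
    when the norm is finite. *)
Lemma sobolev_normE s f : L2 f -> sobolev_norm s f =
  ((\int[mu]_x (weighted s f x ^+ 2)%:E) `^ 2^-1)%E.
Proof.
move=> f2; have [FE [[m1 _] [m2 _]]] := fourierR_hartley f2.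
have mW := measurable_bessel_weight s; have mw := measurable_weighted s f2.
rewrite /sobolev_norm L2normCE; congr (_ `^ _)%E.
have mw2 : measurable_fun setT (fun x => (2^-1 * weighted s f x ^+ 2)%:E).
  by apply/measurable_EFinP; apply: measurable_funM => //; exact: measurable_funX.
have mw2' : measurable_fun setT (fun x : R => (2^-1 * weighted s f (- x) ^+ 2)%:E).
  apply/measurable_EFinP; apply: measurable_funM => //; apply: measurable_funX.
  exact: measurable_reflect.
have w0 x : (0 <= (2^-1 * weighted s f x ^+ 2)%:E)%E.
  by rewrite lee_fin mulr_ge0// sqr_ge0.
transitivity (\int[mu]_x ((2^-1 * weighted s f x ^+ 2)%:E +
   (2^-1 * weighted s f (- x) ^+ 2)%:E))%E.
  apply: ae_eq_integral => //.
  - apply/measurable_EFinP; apply: measurable_funD; apply: measurable_funX.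
      by rewrite (_ : (fun x => _) = (fun x => bessel_weight s x * Re (fourierR f x)));
        [exact: measurable_funM|apply/funext => x; case: (fourierR f x) => a b /=; rewrite mul0r subr0].
    by rewrite (_ : (fun x => _) = (fun x => bessel_weight s x * Im (fourierR f x)));
        [exact: measurable_funM|apply/funext => x; case: (fourierR f x) => a b /=; rewrite mul0r addr0].
  - exact: emeasurable_funD.
  apply: (aeS _ FE) => x -> _ /=; rewrite -EFinD; congr (_%:E).
  rewrite /weighted /evenp /oddp /bessel_weight sqrrN.
  by move: (_ `^ _) (hartley f x) (hartley f (- x)) => W u v; field.
have D := @ge0_integralD _ _ _ mu setT measurableT.
pose A := (\int[mu]_x (2^-1 * weighted s f x ^+ 2)%:E)%E.
transitivity (A + A)%E.
  rewrite -[X in (_ + X)%E](ge0_int_opp (g := fun x => (2^-1 * weighted s f x ^+ 2)%:E))//.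
  exact: (D _ (fun x => (2^-1 * weighted s f (- x) ^+ 2)%:E)).
transitivity (\int[mu]_x ((2^-1 * weighted s f x ^+ 2)%:E +
  (2^-1 * weighted s f x ^+ 2)%:E))%E.
  by apply: esym; exact: (D _ (fun x => (2^-1 * weighted s f x ^+ 2)%:E)).
by apply: eq_integral => x _; rewrite -EFinD; congr (_%:E); move: (_ ^+ 2) => w; lra.
Qed.

Lemma sobolev_norm_lty s f : L2 f -> (sobolev_norm s f < +oo)%E -> L2 (weighted s f).
Proof.
move=> f2; rewrite sobolev_normE// => /lty_poweRy H; have mw := measurable_weighted s f2.
split => //; apply/integrableP; split; first exact/measurable_EFinP/measurable_funX.
under eq_integral do rewrite /= ger0_norm ?sqr_ge0//.
exact: H.
Qed.

Lemma sobolev_norm_sqrt s f : L2 f -> L2 (weighted s f) ->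
  sobolev_norm s f = (Num.sqrt (\int[mu]_x weighted s f x ^+ 2))%:E.
Proof.
move=> f2 [_ w2]; rewrite sobolev_normE// (intE w2) poweR_EFin powR12_sqrt//.
exact: (int_sqr_ge0 (weighted s f)).
Qed.

(** The norms may be infinite away from the limit; convergence to 0 makes them finite eventually,
    whence the conclusion along the filter. *)
Lemma sobolev_norm_cvg0 s T (FF : set_system T) {PF : ProperFilter FF} (fn : T -> R -> R) :
  (\forall t \near FF, L2 (fn t)) -> sobolev_norm s (fn t) @[t --> FF] --> 0%E ->
  (\forall t \near FF, L2 (weighted s (fn t))) /\
  \int[mu]_x weighted s (fn t) x ^+ 2 @[t --> FF] --> 0.
Proof.
move=> fn2 /fine_cvgP[Hfin H].
have near2 : \forall t \near FF, L2 (weighted s (fn t)).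
  apply: filterS2 fn2 Hfin => t ft2 ftfin; apply: sobolev_norm_lty => //.
  by rewrite ltey_eq ftfin.
split => //.
have H2 : fine (sobolev_norm s (fn t)) * fine (sobolev_norm s (fn t)) @[t --> FF] --> (0 * 0 : R).
  by apply: cvgM; exact: H.
rewrite mulr0 in H2; apply: cvg_trans H2; apply: near_eq_cvg.
apply: filterS2 fn2 near2 => t ft2 wt2 /=.
rewrite sobolev_norm_sqrt//= -expr2 sqr_sqrtr//.
exact: (int_sqr_ge0 (weighted s (fn t))).
Qed.

Lemma weightedB s f g : L2 f -> L2 g -> {ae mu, forall x,
  weighted s (fun y => f y - g y) x = weighted s f x - weighted s g x}.
Proof. by move=> f2 g2; apply: (aeS _ (hartleyB f2 g2)) => x E; rewrite /weighted E mulrBr. Qed.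

Lemma int_sqr_weighted s f : 0 <= s -> L2 f -> L2 (weighted s f) ->
  2 * pi * \int[mu]_x f x ^+ 2 <= \int[mu]_x weighted s f x ^+ 2.
Proof.
move=> s0 f2 [_ w2].
have := hartley_parseval f2 f2; have [_ h2] := hartley_L2 f2.
under [in X in _ = X -> _]eq_Rintegral do rewrite -expr2.
under [in X in X = _ -> _]eq_Rintegral do rewrite -expr2.
move=> <-; apply: le_int => // x; rewrite /weighted exprMn.
by rewrite ler_peMl ?sqr_ge0// exprn_ege1// bessel_weight_ge1.
Qed.

End SobolevHartley.

(** * Sobolev regularity *)

Section Regularity.
Context {R : realType}.
Notation mu := (@lebesgue_measure R).
Implicit Types (f g h : R -> R) (a b c s x y : R).

Lemma cvgy_powRN b : 0 < b -> (1 + x) `^ (- b) @[x --> +oo] --> (0 : R).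
Proof.
move=> b0; apply/cvgr0Pnorm_le => e e0; near=> x.
have x0 : 0 <= x by near: x; apply: nbhs_pinfty_ge; exact: num_real.
have xM : e^-1 `^ b^-1 <= x by near: x; apply: nbhs_pinfty_ge; exact: num_real.
rewrite ger0_norm ?powR_ge0// powRN -[leRHS]invrK lef_pV2 ?posrE ?invr_gt0//; last first.
  by rewrite powR_gt0// ltr_pwDl.
have -> : e^-1 = (e^-1 `^ b^-1) `^ b.
  by rewrite -powRrM mulVf ?gt_eqF// powRr1// invr_ge0 ltW.
apply: ge0_ler_powR; rewrite ?nnegrE ?powR_ge0 ?(ltW b0)//; first by rewrite addr_ge0.
by rewrite (le_trans xM)// lerDr.
Unshelve. all: by end_near. Qed.

Lemma L1_abs_powR c : 1 < c -> L1 (fun x : R => (1 + `|x|) `^ (- c)).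
Proof.
move=> c1; have c10 : 1 - c != 0 by rewrite subr_eq0 lt_eqF.
have D (x : R) : 0 <= x ->
    is_derive x 1 (fun y : R => (1 - c)^-1 * (1 + y) `^ (1 - c)) ((1 + x) `^ (- c)).
  move=> x0; have p : 0 < 1 + x by rewrite ltr_pwDl.
  have H1 : is_derive x 1 (fun y : R => 1 + y) 1.
    have := is_deriveD (is_derive_cst (1 : R) x 1) (is_derive_id x (1 : R)).
    by rewrite add0r.
  have H2 := is_derive1_comp (f := fun y : R => y `^ (1 - c)) (g := fun y : R => 1 + y)
    (x := x) (@is_derive1_powR R (1 - c) _ p) H1.
  have := is_deriveZ (1 - c)^-1 H2; move=> /is_derive_eq; apply.
  rewrite /GRing.scale/= mulr1 mulrA mulVf// mul1r; congr (_ `^ _); ring.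
have cf : continuous (fun x : R => (1 + `|x|) `^ (- c)).
  move=> x; apply: (continuous_comp (f := fun x : R => 1 + `|x|) (g := fun y : R => y `^ (- c))).
    by apply: cvgD; [exact: cvg_cst|exact: norm_continuous].
  apply: differentiable_continuous; apply/derivable1_diffP.
  by apply: derivable_powR; rewrite in_itv/= andbT ltr_pwDl.
refine (proj1 (@even_FTC R (fun x : R => (1 + `|x|) `^ (- c))
  (fun y : R => (1 - c)^-1 * (1 + y) `^ (1 - c)) 0 cf _ _ _ _ _)).
- by move=> x; exact: powR_ge0.
- by move=> x; rewrite normrN.
- move=> x x0; rewrite (gtr0_norm x0); exact: (D x (ltW x0)).
- apply: cvg_at_right_filter.
  have C : {for (0 : R), continuous (fun y : R => (1 - c)^-1 * (1 + y) `^ (1 - c))}.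
    by apply: differentiable_continuous; apply/derivable1_diffP; case: (D 0 (lexx _)).
  exact: C.
- rewrite -[X in _ --> X](mulr0 (1 - c)^-1); apply: cvgMl_tmp.
  have := @cvgy_powRN (c - 1); rewrite subr_gt0 => /(_ c1).
  by rewrite opprB.
Qed.

(** From (1 + |x|)^2 <= 2 (1 + x^2) the square is dominated by a power of 1 + |x|, which has an
    elementary antiderivative on the half-line. *)
Lemma L2_bessel_weightN c : 1 < 2 * c -> L2 (fun x => bessel_weight (- c) x).
Proof.
move=> c1; split; first exact: measurable_bessel_weight.
have c0 : 0 < c by lra.
apply: (le_L1 (g := fun x => 2 `^ c * (1 + `|x|) `^ (- (2 * c)))).
- apply: measurable_funX; exact: measurable_bessel_weight.
- exact/L1Z/L1_abs_powR.
move=> x; have q0 : 0 < 1 + x ^+ 2 by rewrite ltr_pwDl// sqr_ge0.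
have r0 : 0 < 1 + `|x| by rewrite ltr_pwDl.
have -> : bessel_weight (- c) x ^+ 2 = (1 + x ^+ 2) `^ (- c).
  by rewrite /bessel_weight -powR_mulrn ?powR_ge0// -powRrM divfK.
have -> : (1 + `|x|) `^ (- (2 * c)) = ((1 + `|x|) ^+ 2) `^ (- c).
  by rewrite -(powR_mulrn 2 (ltW r0)) -powRrM mulrN.
rewrite ger0_norm ?powR_ge0// !powRN ler_pdivlMr ?powR_gt0 ?exprn_gt0//.
rewrite mulrC ler_pdivrMr ?powR_gt0// -powRM ?(ltW q0)//.
apply: ge0_ler_powR; rewrite ?nnegrE ?(ltW c0) ?sqr_ge0 ?mulr_ge0 ?(ltW q0)//.
rewrite -(real_normK (num_real x)); have := sqr_ge0 (`|x| - 1); lra.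
Qed.

Lemma powX_le_bessel_weight k c x : k%:R <= c -> `|x| ^+ k <= bessel_weight c x.
Proof.
move=> kc; apply: le_trans (_ : bessel_weight k%:R x <= _); last first.
  by rewrite ler_powR ?lerDl ?sqr_ge0// ler_pM2r.
rewrite -(@ler_sqr _ _ _ _) ?nnegrE ?exprn_ge0 ?bessel_weight_ge0//.
rewrite /bessel_weight -[leRHS]powR_mulrn ?powR_ge0// -powRrM mulrVK ?unitfE//.
rewrite powR_mulrn ?addr_ge0 ?sqr_ge0// -exprM mulnC exprM real_normK ?num_real//.
by rewrite lerXn2r ?nnegrE ?addr_ge0 ?sqr_ge0// lerDr.
Qed.

Lemma is_derive_cas x : is_derive x 1 (@cas R) (cas (- x)).
Proof.
have := is_deriveD (is_derive_cos x) (is_derive_sin x); move=> /is_derive_eq; apply.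
by rewrite /cas cosN sinN addrC.
Qed.

(** The derivative of cas is cas(- x); the change of variable y |-> - y moves this reflection from
    the kernel to the function. *)
Lemma is_derive_hartley1 h x : L1 h -> L1 (fun y => y * h y) ->
  is_derive x 1 (hartley1 h) (hartley1 (fun y => - y * h (- y)) x).
Proof.
move=> h1 yh1.
have D (z y : R) : is_derive z 1 (fun t : R => cas (t * y) * h y) (cas (- (z * y)) * (y * h y)).
  have H1 : is_derive z 1 (fun t : R => t * y) y.
    have := is_derive_mull y z; congr (is_derive _ _ _ _).
    by apply/funext => t; rewrite mulrC.
  have H2 := is_derive1_comp (f := @cas R) (g := fun t : R => t * y) (x := z)
    (is_derive_cas (z * y)) H1.
  have := is_deriveZ (h y) H2.
  rewrite (_ : _ \*: _ = fun t : R => cas (t * y) * h y); last by apply/funext => t; rewrite mulrC.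
  by move=> /is_derive_eq; apply; rewrite /GRing.scale/=; ring.
have dE (z y : R) : partial1of2 (fun z y : R => cas (z * y) * h y) z y = cas (- (z * y)) * (y * h y).
  by rewrite partial1of2E; case: (D z y).
have P := @derivable_under_integral R _ _ mu (fun z y => cas (z * y) * h y) setT measurableT
  x (x - 1) (x + 1).
have P' := @differentiation_under_integral R _ _ mu (fun z y => cas (z * y) * h y) setT measurableT
  x (x - 1) (x + 1).
have Ix : `]x - 1, x + 1[%classic x by rewrite /= in_itv/=; apply/andP; split; lra.
have i1 (z : R) : `]x - 1, x + 1[%classic z -> mu.-integrable setT (EFin \o (fun y => cas (z * y) * h y)).
  by move=> _; exact: L1_casM.
have i2 (z y : R) : `]x - 1, x + 1[%classic z -> setT y -> derivable (fun t : R => cas (t * y) * h y) z 1.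
  by move=> _ _; case: (D z y).
have G0 (y : R) : 0 <= 2 * `|y * h y| by rewrite mulr_ge0.
have G1 : mu.-integrable setT (EFin \o (fun y => 2 * `|y * h y|)) by exact/L1Z/L1_norm.
have Gub (z y : R) : `]x - 1, x + 1[%classic z -> setT y ->
    `|partial1of2 (fun z y : R => cas (z * y) * h y) z y| <= 2 * `|y * h y|.
  by move=> _ _; rewrite dE normrM ler_wpM2r// norm_cas_le2.
split; first exact: (P Ix i1 i2 _ G0 G1 Gub).
rewrite -derive1E.
rewrite (P' Ix i1 i2 _ G0 G1 Gub).
transitivity (\int[mu]_y (cas (- (x * y)) * (y * h y))).
  by apply: eq_Rintegral => y _; rewrite dE.
rewrite -int_opp; last first.
  by have := L1_measurable (L1_casM (- x) yh1); under eq_fun do rewrite mulNr.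
by apply: eq_Rintegral => y _; rewrite mulrN opprK.
Qed.

Lemma hartley_of_hartley1 h : L1 h -> L2 h ->
  [/\ L2 (fun x => (2 * pi)^-1 * hartley1 h x),
      continuous (fun x => (2 * pi)^-1 * hartley1 h x) &
      {ae mu, forall x, hartley (fun x => (2 * pi)^-1 * hartley1 h x) x = h x}].
Proof.
move=> h1 h2; have [hh2 _] := bessel1 h1 h2; have H2 := hartley_L2 h2; split.
- exact: L2Z.
- by move=> x; apply: cvgMl_tmp; exact: continuous_hartley1.
- apply: (aeS _ (aeI (hartleyZ (2 * pi)^-1 hh2)
    (aeI (hartley_ae H2 hh2 (hartley_L1 h1 h2)) (hartleyK h2)))) => x [-> [<- ->]].
  by rewrite mulrA mulVf ?mul1r// gt_eqF// mulr_gt0// pi_gt0.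
Qed.

End Regularity.

(** * Classical derivatives and sup bounds for s > 7/2 *)

Section SobolevC3.
Context {R : realType}.
Notation mu := (@lebesgue_measure R).
Implicit Types (f g h : R -> R) (a b c x y : R).

Definition hartley_diff h y : R := - y * h (- y).

Lemma is_derive_inversion h (v : R -> R) : L1 h -> L1 (fun y => y * h y) ->
  (forall x, v x = (2 * pi)^-1 * hartley1 h x) ->
  (forall x, is_derive x 1 v (v^`()%classic x)) /\
  (forall x, v^`()%classic x = (2 * pi)^-1 * hartley1 (hartley_diff h) x).
Proof.
move=> h1 yh1 vE.
have D x : is_derive x 1 v ((2 * pi)^-1 * hartley1 (hartley_diff h) x).
  rewrite (_ : v = fun x => (2 * pi)^-1 * hartley1 h x); last exact/funext.
  exact: (is_deriveZ (2 * pi)^-1 (is_derive_hartley1 x h1 yh1)).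
have E x : v^`()%classic x = (2 * pi)^-1 * hartley1 (hartley_diff h) x.
  by rewrite derive1E; case: (D x).
by split => // x; rewrite E.
Qed.

Context (s : R) (u : R -> R) (hs : 7 / 2 < s) (us : sobolev_rep s u).

Lemma sobolev_L2 : L2 u.
Proof. by case: us => -[/Lfun2P]. Qed.
Let u2 := sobolev_L2.

Lemma sobolev_weighted : L2 (weighted s u).
Proof. by case: us => -[_ H] _; exact: sobolev_norm_lty. Qed.

Let w2 := sobolev_weighted.
Let A := hartley u.

(** The hypothesis s > 7/2 is exactly 2 (s - 3) > 1. Paired with the weighted transform in L^2, this
    weight makes x^k times the transform integrable for k <= 3. *)
Lemma bessel_weight_L2 : L2 (bessel_weight (3 - s)).
Proof. by rewrite -opprB; apply: L2_bessel_weightN; have := hs; lra. Qed.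

Lemma norm_powX_hartley_le k x : (k <= 3)%N ->
  `|x ^+ k * A x| <= bessel_weight (3 - s) x * `|weighted s u x|.
Proof.
move=> k3; rewrite /weighted !normrM normrX (ger0_norm (bessel_weight_ge0 s x)) mulrA.
rewrite ler_wpM2r// /bessel_weight -powRD; last first.
  by apply/implyP => _; rewrite gt_eqF// ltr_pwDl// sqr_ge0.
rewrite -mulrDl subrK; apply: powX_le_bessel_weight.
by rewrite (ler_nat _ _ 3).
Qed.

Lemma measurable_powX_hartley k : measurable_fun setT (fun x => x ^+ k * A x).
Proof.
apply: measurable_funM; first exact: measurable_funX.
by case: (hartley_L2 u2).
Qed.

Lemma powX_hartley_L1 k : (k <= 3)%N -> L1 (fun x => x ^+ k * A x).
Proof.
move=> k3; apply: (le_L1 _ (L1_norm (L2M bessel_weight_L2 w2))).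
  exact: measurable_powX_hartley.
by move=> x; rewrite [leRHS]normrM (ger0_norm (bessel_weight_ge0 _ _)) norm_powX_hartley_le.
Qed.

Lemma powX_hartley_L2 k : (k <= 3)%N -> L2 (fun x => x ^+ k * A x).
Proof.
move=> k3; apply: (le_L2 _ w2); first exact: measurable_powX_hartley.
move=> x; rewrite !normrM ler_wpM2r// normrX (ger0_norm (bessel_weight_ge0 s x)).
apply: powX_le_bessel_weight; apply: le_trans (_ : 3 <= _); last by have := hs; lra.
by rewrite (ler_nat _ _ 3).
Qed.

Let A1 := hartley_diff A.
Let A2 := hartley_diff A1.
Let A3 := hartley_diff A2.

Let A2E x : A2 x = - (x ^+ 2 * A x).
Proof. by rewrite /A2 /A1 /hartley_diff opprK expr2; ring. Qed.
Let A3E x : A3 x = - ((- x) ^+ 3 * A (- x)).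
Proof. by rewrite /A3 /hartley_diff A2E; ring. Qed.

Let hA : L1 A /\ L2 A.
Proof.
split; [have := @powX_hartley_L1 0%N isT; congr L1|exact: hartley_L2].
by apply/funext => x; rewrite expr0 mul1r.
Qed.
Let hA1 : L1 A1 /\ L2 A1.
Proof. by split; [exact: (L1_opp (@powX_hartley_L1 1%N isT))|exact: (L2_opp (@powX_hartley_L2 1%N isT))]. Qed.
Let hA2 : L1 A2 /\ L2 A2.
Proof.
rewrite (_ : A2 = fun x => - (x ^+ 2 * A x)); last exact/funext/A2E.
by split; [exact: (L1N (@powX_hartley_L1 2%N isT))|exact: (L2N (@powX_hartley_L2 2%N isT))].
Qed.
Let hA3 : L1 A3 /\ L2 A3.
Proof.
rewrite (_ : A3 = fun x => - ((- x) ^+ 3 * A (- x))); last exact/funext/A3E.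
by split; [exact: (L1N (L1_opp (@powX_hartley_L1 3%N isT)))|exact: (L2N (L2_opp (@powX_hartley_L2 3%N isT)))].
Qed.

Let L1_opp_diff h : L1 (hartley_diff h) -> L1 (fun y => y * h y).
Proof.
move=> /L1_opp; congr L1; apply/funext => y; by rewrite /hartley_diff !opprK.
Qed.

Let uE x : u x = (2 * pi)^-1 * hartley1 A x.
Proof. by apply: hartley_inversion => //; [case: us|case: hA]. Qed.

Let D1 := is_derive_inversion hA.1 (L1_opp_diff hA1.1) uE.
Let D2 := is_derive_inversion hA1.1 (L1_opp_diff hA2.1) D1.2.
Let D3 := is_derive_inversion hA2.1 (L1_opp_diff hA3.1) D2.2.

Lemma sobolev_is_derive x : is_derive x 1 u (u^`()%classic x).
Proof. exact: D1.1. Qed.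

Let inv h (v : R -> R) : L1 h -> L2 h -> (forall x, v x = (2 * pi)^-1 * hartley1 h x) ->
  [/\ L2 v, continuous v & {ae mu, forall x, hartley v x = h x}].
Proof.
move=> h1 h2 /funext ->; exact: hartley_of_hartley1.
Qed.

Lemma sobolev_derive1 : [/\ L2 (u^`()%classic), continuous (u^`()%classic) &
  {ae mu, forall x, hartley (u^`()%classic) x = - x * hartley u (- x)}].
Proof. by case: hA1 => a b; exact: (inv a b D1.2). Qed.

Lemma sobolev_derive2 : [/\ L2 ((u^`(2))%classic), continuous ((u^`(2))%classic) &
  {ae mu, forall x, hartley ((u^`(2))%classic) x = - (x ^+ 2 * hartley u x)}].
Proof.
case: hA2 => a b; have [c d e] := inv a b D2.2; split => //.
by apply: (aeS _ e) => x ->; exact: A2E.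
Qed.

Lemma sobolev_derive3 : [/\ L2 ((u^`(3))%classic), continuous ((u^`(3))%classic) &
  {ae mu, forall x, hartley ((u^`(3))%classic) x = x ^+ 3 * hartley u (- x)}].
Proof.
case: hA3 => a b; have [c d e] := inv a b D3.2; split => //.
apply: (aeS _ e) => x ->; rewrite A3E -/A; move: (A (- x)) => v; ring.
Qed.

(** Comes from 2 p q <= p^2 + q^2. It depends on u only through the H^s norm, which makes the sup
    bounds uniform in time for a solution. *)
Let bound_mass : R :=
  \int[mu]_y bessel_weight (3 - s) y ^+ 2 + \int[mu]_y weighted s u y ^+ 2.

Let int_powX_hartley_le k : (k <= 3)%N ->
  2 * \int[mu]_y `|y ^+ k * A y| <= bound_mass.
Proof.
move=> k3; have h1 := powX_hartley_L1 k3.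
have [mb b2] := bessel_weight_L2; have [mw ww] := w2.
rewrite -intZ; last exact: L1_norm.
rewrite /bound_mass -intD//; apply: le_int; [exact/L1Z/L1_norm|exact: L1D|].
move=> y; rewrite -[weighted s u y ^+ 2](real_normK (num_real _)).
have := @norm_powX_hartley_le k y k3.
have := sqr_ge0 (bessel_weight (3 - s) y - `|weighted s u y|).
move: (bessel_weight _ _) `|weighted s u y| `|_ * _| => p q r; nra.
Qed.

Let sup_hartley1 h x : L1 h -> 2 * \int[mu]_y `|h y| <= bound_mass ->
  `|(2 * pi)^-1 * hartley1 h x| <= (2 * pi)^-1 * bound_mass.
Proof.
move=> h1 hb; have p0 : 0 < (2 * pi)^-1 :> R by rewrite invr_gt0 mulr_gt0// pi_gt0.
rewrite normrM (gtr0_norm p0) ler_wpM2l ?(ltW p0)//.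
exact: (le_trans (norm_hartley1_le x h1)).
Qed.

Lemma sobolev_sup x : `|u x| <= (2 * pi)^-1 * (\int[mu]_y bessel_weight (3 - s) y ^+ 2 +
  \int[mu]_y weighted s u y ^+ 2).
Proof.
rewrite uE; apply: sup_hartley1; first by case: hA.
have := @int_powX_hartley_le 0%N isT.
by under eq_Rintegral do rewrite expr0 mul1r.
Qed.

Lemma sobolev_sup1 x : `|u^`()%classic x| <= (2 * pi)^-1 *
  (\int[mu]_y bessel_weight (3 - s) y ^+ 2 + \int[mu]_y weighted s u y ^+ 2).
Proof.
rewrite D1.2; apply: sup_hartley1; first by case: hA1.
have := @int_powX_hartley_le 1%N isT.
rewrite -(int_opp (f := fun y => `|y ^+ 1 * A y|))//.
exact: L1_measurable (L1_norm (@powX_hartley_L1 1%N isT)).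
Qed.

Lemma sobolev_sup2 x : `|(u^`(2))%classic x| <= (2 * pi)^-1 *
  (\int[mu]_y bessel_weight (3 - s) y ^+ 2 + \int[mu]_y weighted s u y ^+ 2).
Proof.
have -> : (u^`(2))%classic x = _ := D2.2 x; apply: sup_hartley1; first by case: hA2.
have := @int_powX_hartley_le 2%N isT.
by congr (2 * _ <= _); apply: eq_Rintegral => y _; rewrite -/A2 A2E normrN.
Qed.

End SobolevC3.

(** * Unique continuation for the Hilbert transform *)

Section Bernstein.
Context {R : realType}.
Implicit Types (phi psi : nat -> R) (H : R -> R) (a b c t : R).

(* De Casteljau's recursion for \sum_k 'C(n, k) phi(k) X^k (1 - X)^(n - k). *)
Fixpoint bernstein n phi : {poly R} :=
  if n is m.+1 then (1 - 'X) * bernstein m phi + 'X * bernstein m (phi \o succn)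
  else (phi 0%N)%:P.

Lemma bernsteinS n phi t : (bernstein n.+1 phi).[t] =
  (1 - t) * (bernstein n phi).[t] + t * (bernstein n (phi \o succn)).[t].
Proof. by rewrite /= !hornerE. Qed.

Lemma le_bernstein n phi psi t : 0 <= t <= 1 ->
  (forall k, (k <= n)%N -> phi k <= psi k) ->
  (bernstein n phi).[t] <= (bernstein n psi).[t].
Proof.
move=> /andP[t0 t1]; elim: n phi psi => [|n IH] phi psi H.
  by rewrite !hornerC; exact: H.
rewrite !bernsteinS lerD// ler_wpM2l ?subr_ge0//; apply: IH => k kn.
  by apply: H; rewrite (leq_trans kn).
exact: H.
Qed.

(** Mean n t and variance n t (1 - t) of the binomial distribution in one identity. The center a is
    arbitrary because the recursion shifts it by one. *)
Lemma bernstein_quadratic n a b c t :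
  (bernstein n (fun k => b + c * (k%:R - a) ^+ 2)).[t] =
  b + c * (n%:R * (t * (1 - t)) + (n%:R * t - a) ^+ 2).
Proof.
elim: n a => [|n IH] a; first by rewrite hornerC; ring.
rewrite bernsteinS IH.
rewrite (_ : _ \o succn = fun k => b + c * (k%:R - (a - 1)) ^+ 2); last first.
  by apply/funext => k /=; rewrite -natr1; ring.
by rewrite IH -natr1; ring.
Qed.

(** Positivity of the Bernstein operator: phi lies between two quadratics centered at the mean n t,
    of which only the variance remains. *)
Lemma bernstein_le_quadratic n phi a b c t : 0 <= t <= 1 ->
  (forall k, (k <= n)%N -> `|phi k - a| <= b + c * (k%:R - n%:R * t) ^+ 2) ->
  `|(bernstein n phi).[t] - a| <= b + c * (n%:R * (t * (1 - t))).
Proof.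
move=> t01 H; have Q := bernstein_quadratic n (n%:R * t) _ _ t.
have := @le_bernstein n phi (fun k => a + b + c * (k%:R - n%:R * t) ^+ 2) t t01.
have := @le_bernstein n (fun k => a - b + (- c) * (k%:R - n%:R * t) ^+ 2) phi t t01.
rewrite !Q subrr expr0n addr0 => L U.
set q := n%:R * (t * (1 - t)) in L U *.
have {}L : a - b + (- c) * q <= (bernstein n phi).[t].
  by apply: L => k /H; set r := (_ ^+ 2); rewrite ler_norml => /andP[]; lra.
have {}U : (bernstein n phi).[t] <= a + b + c * q.
  by apply: U => k /H; set r := (_ ^+ 2); rewrite ler_norml => /andP[]; lra.
by rewrite ler_norml; apply/andP; split; lra.
Qed.

Lemma norm_bernstein_le n phi b t : 0 <= t <= 1 ->
  (forall k, (k <= n)%N -> `|phi k| <= b) -> `|(bernstein n phi).[t]| <= b.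
Proof.
move=> t01 H; have := @bernstein_le_quadratic n phi 0 b 0 t t01.
rewrite subr0 mul0r addr0; apply => k kn; rewrite subr0 mul0r addr0; exact: H.
Qed.

Lemma cvg_bernstein H b t : 0 <= t <= 1 -> {for t, continuous H} ->
  (forall r, 0 <= r <= 1 -> `|H r| <= b) ->
  (bernstein n.+1 (fun k => H (k%:R / n.+1%:R))).[t] @[n --> \oo] --> H t.
Proof.
move=> t01 cH Hb; have /andP[t0 t1] := t01.
have b0 : 0 <= b by rewrite (le_trans _ (Hb t t01)).
apply/cvgrPdist_le => e e0.
have e2 : 0 < e / 2 by rewrite divr_gt0.
move/cvgrPdist_le : cH => /(_ _ e2) [d /= d0 dH].
(* Chebyshev's argument: at distance at least d from t the trivial bound 2 b is at most c (r -
   t)^2. *)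
pose c := 2 * b / d ^+ 2.
have c0 : 0 <= c by rewrite divr_ge0 ?sqr_ge0// mulr_ge0.
near=> n; rewrite distrC.
have n0 : 0 < n.+1%:R :> R by rewrite ltr0n.
apply: le_trans (@bernstein_le_quadratic n.+1 (fun k => H (k%:R / n.+1%:R)) (H t)
  (e / 2) (c / n.+1%:R ^+ 2) t t01 _) _.
  move=> k kn; set r := k%:R / n.+1%:R.
  have r01 : 0 <= r <= 1.
    by rewrite /r divr_ge0//= ler_pdivrMr// mul1r ler_nat.
  have -> : c / n.+1%:R ^+ 2 * (k%:R - n.+1%:R * t) ^+ 2 = c * (r - t) ^+ 2.
    by rewrite /r; field; rewrite gt_eqF.
  have [rt|rt] := ltP `|t - r| d.
    by rewrite distrC (le_trans (dH r rt))// lerDl mulr_ge0// sqr_ge0.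
  apply: le_trans (_ : 2 * b <= _).
    by rewrite (le_trans (ler_normB _ _))// mulr_natl mulr2n lerD// Hb.
  have : 2 * b <= c * (r - t) ^+ 2.
    rewrite /c mulrAC ler_pdivlMr ?exprn_gt0// ler_wpM2l ?mulr_ge0//.
    by rewrite -[leRHS]real_normK ?num_real// distrC ler_sqr ?nnegrE// ltW.
  lra.
have -> : c / n.+1%:R ^+ 2 * (n.+1%:R * (t * (1 - t))) = c * (t * (1 - t)) / n.+1%:R.
  by field; rewrite gt_eqF.
have ct : c * (t * (1 - t)) <= c by rewrite ler_piMr//; nra.
have cn : c <= e / 2 * n.+1%:R.
  rewrite -ler_pdivrMl//; apply: (@le_trans _ _ n%:R); last by rewrite ler_nat.
  by near: n; exact: nbhs_infty_ger.
by rewrite [leRHS]splitr lerD2l ler_pdivrMr// (le_trans ct).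
Unshelve. all: by end_near. Qed.

End Bernstein.

(** * Kernel identities and estimates away from the singularity *)

Section UniqueContinuation.
Context {R : realType}.
Notation mu := (@lebesgue_measure R).
Implicit Types (a b c e h x y : R).

(** The formula sgn(z) exp(- ln |z|) also holds at 0, where both sides are 0. *)
Lemma measurable_inv : measurable_fun setT (fun z : R => z^-1).
Proof.
rewrite (_ : (fun z : R => z^-1) = fun z => Num.sg z * expR (- ln `|z|)).
  apply: measurable_funM; first exact: measurable_sgr.
  apply: measurableT_comp => //; apply: measurableT_comp => //.
  by apply: measurableT_comp => //; exact: measurable_ln.
apply/funext => z; have [->|z0] := eqVneq z 0; first by rewrite invr0 sgr0 mul0r.
by rewrite expRN lnK ?posrE ?normr_gt0// -normfV -sgrV -numEsg.
Qed.

Context (f g : R -> R) (f2 : L2 f) (g2 : L2 g)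
  (gf : {ae mu, forall x, hartley g x = Num.sg x * hartley f (- x)}).

(* The conjugate Poisson kernel (y - x) / (e^2 + (y - x)^2) is the Hilbert transform of the
   Poisson kernel. *)
Lemma conjugate_poisson_duality e x : 0 < e ->
  \int[mu]_y (g y * poisson e (x - y)) =
  - \int[mu]_y (f y * (2 * (y - x) / (e ^+ 2 + (y - x) ^+ 2))).
Proof.
move=> e0.
(* The Hartley transform of [ex] is the Poisson kernel and that of [m] is minus twice the conjugate
   kernel; [m] arises from [ex] when the factor sgn and the reflection in [gf] are moved across the
   pairing by z |-> - z. *)
pose ex z := expw e z * cas (z * x).
pose m z := - (expw e z * (Num.sg z * cas (- (z * x)))).
have mex : measurable_fun setT (fun z : R => cas (z * x)) by exact: measurable_casl.
have mm : measurable_fun setT (fun z : R => Num.sg z * cas (- (z * x))).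
  apply: measurable_funM; first exact: measurable_sgr.
  by apply: eq_measurable_fun (measurable_casl (- x)) => z _; rewrite mulrN.
have mw : measurable_fun setT (@expw R e).
  exact: continuous_measurable_fun (@continuous_expw R e).
have sc z : `|Num.sg z * cas (- (z * x))| <= 2.
  rewrite normrM normr_sg (le_trans _ (norm_cas_le2 (- (z * x))))//.
  by rewrite ler_piMl//; case: (_ == _).
have w2 z : `|expw e z| <= 1 by rewrite ger0_norm ?expw_ge0// expw_le1// ltW.
have ex1 : L1 ex by apply: (L1_expwM (c := 2)) => // z; exact: norm_cas_le2.
have m1 : L1 m by apply: L1N; exact: L1_expwM mm sc.
have ex2 : L2 ex.
  apply: (L2_bounded_L1 (c := 2)) => //; first exact: measurable_funM.
  by move=> z; rewrite normrM -[leRHS]mul1r ler_pM// norm_cas_le2.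
have m2 : L2 m.
  apply: (L2_bounded_L1 (c := 2)) => //; first exact: L1_measurable m1.
  by move=> z; rewrite normrN normrM -[leRHS]mul1r ler_pM.
have hex y : hartley1 ex y = poisson e (x - y).
  rewrite -int_expw_casM//; apply: eq_Rintegral => z _.
  by rewrite /ex [y * z]mulrC; move: (expw e z) (cas _) (cas _) => p q t; ring.
have hm y : hartley1 m y = - (2 * (y - x) / (e ^+ 2 + (y - x) ^+ 2)).
  rewrite -int_expw_sgn_casM// /hartley1 -[RHS]mulN1r -intZ; last first.
    have := L1_casM y m1; move=> /L1N; congr L1; apply/funext => z.
    rewrite /m [y * z]mulrC.
    by move: (expw e z) (Num.sg z) (cas _) (cas _) => p q r t; ring.
  apply: eq_Rintegral => z _; rewrite /m [y * z]mulrC.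
  by move: (expw e z) (Num.sg z) (cas _) (cas _) => p q r t; ring.
have hex2 := hartley_L2 ex2; have hm2 := hartley_L2 m2.
have hf2 := hartley_L2 f2; have hg2 := hartley_L2 g2.
transitivity (\int[mu]_y (g y * hartley ex y)).
  apply: ae_eq_int.
  - by apply: measurable_funM; [case: g2|exact: measurable_poissonB].
  - by apply: measurable_funM; [case: g2|case: hex2].
  - by apply: (aeS _ (hartley_L1 ex1 ex2)) => y ->; rewrite hex.
rewrite hartley_duality//.
have mshf : measurable_fun setT (fun z : R => ex z * (Num.sg z * hartley f (- z))).
  apply: measurable_funM; first by case: ex2.
  by apply: measurable_funM; [exact: measurable_sgr|case: (L2_opp hf2)].
transitivity (\int[mu]_z (ex z * (Num.sg z * hartley f (- z)))).
  apply: ae_eq_int => //; first by apply: measurable_funM; [case: ex2|case: hg2].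
  by apply: (aeS _ gf) => z ->.
rewrite -int_opp//.
transitivity (\int[mu]_z (m z * hartley f z)).
  apply: eq_Rintegral => z _; rewrite /ex /m /expw normrN sgrN opprK mulNr.
  by move: (expR _) (Num.sg z) (cas _) (hartley f z) => p q r t; ring.
rewrite hartley_duality// -mulN1r -intZ; last first.
  have := L1N (L2M f2 (bessel1 m1 m2).1); congr L1; apply/funext => y.
  by rewrite hm mulrN opprK.
apply: ae_eq_int.
- by apply: measurable_funM; [case: f2|case: hm2].
- have := L1_measurable (L2M f2 (bessel1 m1 m2).1).
  by under eq_fun do rewrite hm mulrN -mulN1r.
- by apply: (aeS _ (hartley_L1 m1 m2)) => y ->; rewrite hm mulN1r mulrN.
Qed.

Section kernel.
Context (x r : R) (r0 : 0 < r)
  (f0 : forall y, box (x - r) (x + r) y = 1 -> f y = 0).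

(** For |t| > r one has 1 / t^2 <= K / (1 + t^2), and 1 / (1 + t^2) is half of [poisson 1 t], an
    integrable function. *)
Let K := 1 + (r ^+ 2)^-1.
Let K0 : 0 <= K. Proof. by rewrite addr_ge0// invr_ge0 sqr_ge0. Qed.

Lemma box_ball y : box (x - r) (x + r) y = (`|y - x| <= r)%R%:R.
Proof. by rewrite boxE ler_distl. Qed.

Lemma box_far y : box (x - r) (x + r) y = 1 \/
  (box (x - r) (x + r) y = 0 /\ r < `|y - x|).
Proof. by rewrite box_ball; case: leP => H; [left|right]. Qed.

Lemma inv_sqr_far t : r < `|t| -> (t ^+ 2)^-1 <= K * (2^-1 * poisson 1 t).
Proof.
move=> rt; have t2 : r ^+ 2 <= t ^+ 2.
  by rewrite -(real_normK (num_real t)) ler_sqr ?nnegrE// ltW.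
have r2 : 0 < r ^+ 2 by rewrite exprn_gt0.
have t20 : 0 < t ^+ 2 := lt_le_trans r2 t2.
have -> : 2^-1 * poisson 1 t = (1 + t ^+ 2)^-1.
  by rewrite /poisson expr1n mulr1 mulrA mulVf// mul1r.
rewrite ler_pdivlMr ?ltr_pwDl ?sqr_ge0// ler_pdivrMl//.
rewrite /K mulrDr mulr1 [leLHS]addrC lerD2l.
by rewrite ler_pdivlMr// mul1r.
Qed.

Lemma f_far_le y : 2 * `|f y / (y - x)| <= f y ^+ 2 + K * (2^-1 * poisson 1 (x - y)).
Proof.
have p0 := poisson_ge0 (x - y) (@ltr01 R).
have [/f0 ->|[_ yx]] := box_far y.
  by rewrite mul0r normr0 mulr0 addr_ge0 ?sqr_ge0// mulr_ge0 ?K0// mulr_ge0 ?invr_ge0.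
rewrite poissonBC (le_trans _ (lerD (lexx _) (inv_sqr_far yx)))//.
rewrite -[f y ^+ 2](real_normK (num_real _)) normrM normfV.
rewrite -(real_normK (num_real (y - x))) -exprVn.
move: (`|f y|) (`|y - x|^-1) => p q.
by have := sqr_ge0 (p - q); nra.
Qed.

Let maj1 : L1 (fun y => f y ^+ 2 + K * (2^-1 * poisson 1 (x - y))).
Proof.
apply: L1D; first by case: f2.
by do 2 apply: L1Z; case: (poissonB_L1 x (@ltr01 R)).
Qed.

Lemma measurable_quotient : measurable_fun setT (fun y : R => f y / (y - x)).
Proof.
apply: measurable_funM; first by case: f2.
apply: (measurableT_comp measurable_inv); exact: measurable_funB.
Qed.

Lemma quotient_L1 : L1 (fun y => f y / (y - x)).
Proof.
apply: (le_L1 measurable_quotient maj1) => y; have := f_far_le y.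
have := normr_ge0 (f y / (y - x)); lra.
Qed.

End kernel.

End UniqueContinuation.

(** * Vanishing of the integral of f(y) / (y - x) *)

Section SingularIntegral.
Context {R : realType}.
Notation mu := (@lebesgue_measure R).
Implicit Types (a b c e h x y : R).

(** Stands in for limits e -> 0+: the errors below are bounded explicitly by e times a constant. *)
Lemma eq0_small c d : (forall e, 0 < e -> e <= 1 -> `|c| <= e * d) -> c = 0.
Proof.
move=> cd; apply: contrapT => /eqP; rewrite -normr_gt0 => c0.
have d0 : 0 < d by have := cd 1 ltr01 (lexx _); lra.
have cd0 : 0 < `|c| + d by rewrite addr_gt0.
(* For this e the hypothesis reads |c| + d <= d, a contradiction. *)
have := cd (`|c| / (`|c| + d)) (divr_gt0 c0 cd0).
rewrite ler_pdivrMr// mul1r lerDl => /(_ (ltW d0)).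
rewrite mulrAC ler_pdivlMr// ler_pM2l//; lra.
Qed.

Context (f g : R -> R) (f2 : L2 f) (g2 : L2 g)
  (gf : {ae mu, forall x, hartley g x = Num.sg x * hartley f (- x)}).

(** In [conjugate_poisson_duality] both errors are O(e): f vanishes where the conjugate kernel
    differs much from 2 / (y - x), and g vanishes where the Poisson kernel is not O(e). *)
Lemma singular_integral_eq0 x r : 0 < r ->
  (forall y, box (x - r) (x + r) y = 1 -> f y = 0) ->
  {ae mu, forall y, box (x - r) (x + r) y = 1 -> g y = 0} ->
  \int[mu]_y (f y / (y - x)) = 0.
Proof.
move=> r0 f0 g0.
have q1 := quotient_L1 f2 r0 f0.
have p2 := poisson_L2 x (@ltr01 R).
have gp1 := L1_norm (L2M g2 p2).
set K := 1 + (r ^+ 2)^-1.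
have K0 : 0 <= K by rewrite addr_ge0// invr_ge0 sqr_ge0.
set A := \int[mu]_y `|g y * poisson 1 (x - y)|.
set B := \int[mu]_y `|f y / (y - x)|.
have A0 : 0 <= A by apply: int_ge0 => y; exact: normr_ge0.
have B0 : 0 <= B by apply: int_ge0 => y; exact: normr_ge0.
suff H e : 0 < e -> e <= 1 ->
    `|2 * \int[mu]_y (f y / (y - x))| <= e * (K * A + 2 / r ^+ 2 * B).
  by have /eqP := eq0_small H; rewrite mulf_eq0 pnatr_eq0/= => /eqP.
move=> e0 e1; pose d y := poisson e (x - y) * (f y / (y - x)).
have d1 : L1 d.
  apply: (L1M_bounded (c := 2 / e)) => //; first exact: measurable_poissonB.
  by move=> y; exact: norm_poisson_le.
(* With t = y - x: 2 t / (e^2 + t^2) = 2 / t - e * poisson e t / t. At t = 0 both sides are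
   multiplied by f x = 0. *)
have fd y : f y * (2 * (y - x) / (e ^+ 2 + (y - x) ^+ 2)) =
    2 * (f y / (y - x)) - e * d y.
  have := poisson_den_gt0 (y - x) e0; rewrite /d poissonBC /poisson.
  have [->|yx] := eqVneq y x; last first.
    rewrite -subr_eq0 in yx; move: (y - x) (f y) yx => t z t0 /gt_eqF/negbT h.
    by field; apply/andP; split.
  have -> : f x = 0.
    by apply: f0; rewrite box_ball subrr normr0 ltW.
  by rewrite !mul0r !mulr0 subr0.
have L : \int[mu]_y (f y * (2 * (y - x) / (e ^+ 2 + (y - x) ^+ 2))) =
    2 * \int[mu]_y (f y / (y - x)) - e * \int[mu]_y d y.
  rewrite -!intZ// -intB; [|exact: L1Z|exact: L1Z].
  by apply: eq_Rintegral => y _; exact: fd.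
have := conjugate_poisson_duality f2 g2 gf x e0; rewrite {}L => L.
have -> : 2 * \int[mu]_y (f y / (y - x)) =
    e * \int[mu]_y d y - \int[mu]_y (g y * poisson e (x - y)) by rewrite L; ring.
rewrite (le_trans (ler_normB _ _))// mulrDr addrC lerD//.
  have gpe1 : L1 (fun y => g y * poisson e (x - y)).
    exact: L2M g2 (poisson_L2 x e0).
  rewrite (le_trans (le_norm_int gpe1))// mulrA /A -intZ//.
  (* Cutting out the interval costs nothing, as g is 0 almost everywhere there; outside it the
     kernel is at most e * K * poisson 1. *)
  pose G y := `|(1 - box (x - r) (x + r) y) * (g y * poisson e (x - y))|.
  have G1 : L1 G.
    apply/L1_norm/(L1M_bounded (c := 1)) => //; last first.
      move=> y; have := box_ge0 (x - r) (x + r) y; have := box_le1 (x - r) (x + r) y.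
      by move: (box _ _ _) => b b1 b0; rewrite ger0_norm; lra.
    by apply: measurable_funB => //; exact: measurable_box.
  rewrite (_ : \int[mu]_y `|g y * poisson e (x - y)| = \int[mu]_y G y); last first.
    apply: ae_eq_int; [exact: L1_measurable (L1_norm gpe1)|exact: L1_measurable|].
    apply: (aeS _ g0) => y gy; rewrite /G.
    have [/[dup] bx /gy ->|[-> _]] := box_far x r y; first by rewrite mul0r mulr0.
    by rewrite subr0 mul1r.
  apply: le_int => // [|y]; first exact: L1Z.
  rewrite /G; have [->|[-> yx]] := box_far x r y.
    by rewrite subrr mul0r normr0 !mulr_ge0 // ltW.
  rewrite subr0 mul1r [leLHS]normrM [X in _ <= _ * X]normrM [leRHS]mulrCA ler_wpM2l//.
  rewrite !ger0_norm ?poisson_ge0//.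
  rewrite !(poissonBC _ x y).
  have := inv_sqr_far r0 yx; rewrite -/K => h.
  have t2 : 0 < (y - x) ^+ 2.
    by rewrite -(real_normK (num_real _)) exprn_gt0// (lt_trans r0).
  have h2 : (e ^+ 2 + (y - x) ^+ 2)^-1 <= K * (2^-1 * poisson 1 (y - x)).
    apply: le_trans h.
    by rewrite lef_pV2 ?posrE ?poisson_den_gt0// lerDr sqr_ge0.
  rewrite {1}/poisson (_ : e * K * _ = 2 * e * (K * (2^-1 * poisson 1 (y - x)))).
    by rewrite ler_wpM2l// mulr_ge0// ltW.
  by move: (poisson 1 (y - x)) => p; field.
rewrite normrM ger0_norm ?(ltW e0)// ler_pM2l//.
rewrite (le_trans (le_norm_int d1))// /B -intZ; last exact: L1_norm.
apply: le_int; [exact: L1_norm|by apply: L1Z; exact: L1_norm|move=> y].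
rewrite normrM; have [/f0 ->|[_ yx]] := box_far x r y.
  by rewrite mul0r normr0 !mulr0.
rewrite ler_wpM2r// ger0_norm ?poisson_ge0// /poisson.
rewrite ler_pM ?mulr_ge0 ?invr_ge0 ?addr_ge0 ?sqr_ge0 ?(ltW e0)//; first by lra.
rewrite lef_pV2 ?posrE ?exprn_gt0// ?poisson_den_gt0//.
rewrite -(real_normK (num_real (x - y))) distrC.
have : r ^+ 2 <= `|y - x| ^+ 2 by rewrite ler_sqr ?nnegrE ?(ltW r0) ?(ltW yx).
have := sqr_ge0 e; lra.
Qed.

End SingularIntegral.

(** * Moments and polynomial approximation *)

Section UniqueContinuationMoments.
Context {R : realType}.
Notation mu := (@lebesgue_measure R).
Implicit Types (a b c e h x y : R).

Context (f g : R -> R) (f2 : L2 f) (g2 : L2 g)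
  (gf : {ae mu, forall x, hartley g x = Num.sg x * hartley f (- x)}).
Context (x r : R) (r0 : 0 < r)
  (f0 : forall y, box (x - r) (x + r) y = 1 -> f y = 0)
  (g0 : {ae mu, forall y, box (x - r) (x + r) y = 1 -> g y = 0}).

Let phi y := f y / (y - x).
(** The reciprocal 1 / (y - x), cut off where f vanishes: bounded by 1 / r, so multiplying by its
    powers preserves integrability. *)
Let U y := (1 - box (x - r) (x + r) y) / (y - x).

Let phi1 : L1 phi. Proof. exact: (quotient_L1 f2 r0 f0). Qed.

Let mU : measurable_fun setT U.
Proof.
apply: measurable_funM; first by apply: measurable_funB => //; exact: measurable_box.
by apply: (measurableT_comp (@measurable_inv R)); exact: measurable_funB.
Qed.

Let normU y : `|U y| <= r^-1.
Proof.
rewrite /U; have [->|[-> yx]] := box_far x r y.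
  by rewrite subrr mul0r normr0 invr_ge0 ltW.
by rewrite subr0 mul1r normfV lef_pV2 ?posrE ?(lt_trans r0 yx)// ltW.
Qed.

Let mUX k : measurable_fun setT (fun y : R => U y ^+ k).
Proof. exact: measurable_funX. Qed.

Let normUX k y : `|U y ^+ k| <= r^-1 ^+ k.
Proof. by rewrite normrX lerXn2r ?nnegrE// invr_ge0 ltW. Qed.

Let UL1 k (q : R -> R) : L1 q -> L1 (fun y => U y ^+ k * q y).
Proof. exact: L1M_bounded (mUX k) (normUX k). Qed.

(** The interval of radius r / 2 about x + h lies in the one of radius r about x, so the vanishing
    also holds with the pole moved to x + h. *)
Lemma shifted_integral_eq0 h : 0 < h -> h <= r / 2 ->
  L1 (fun y => f y / (y - (x + h))) /\ \int[mu]_y (f y / (y - (x + h))) = 0.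
Proof.
move=> h0 hr; have r2 : 0 < r / 2 by rewrite divr_gt0.
have sub y : box (x + h - r / 2) (x + h + r / 2) y = 1 -> box (x - r) (x + r) y = 1.
  rewrite !box_ball; case: (leP `|y - (x + h)|) => [H _|_ /eqP]; last by rewrite eq_sym oner_eq0.
  suff -> : `|y - x| <= r by [].
  have -> : y - x = y - (x + h) + h by ring.
  rewrite (le_trans (ler_normD _ _))// (ger0_norm (ltW h0)); lra.
have f0' y : box (x + h - r / 2) (x + h + r / 2) y = 1 -> f y = 0 by move/sub/f0.
split; first exact: (quotient_L1 f2 r2 f0').
apply: (singular_integral_eq0 f2 g2 gf r2 f0').
by apply: (aeS _ g0) => y gy /sub.
Qed.

(* With z = y - x, from 1 / (z - h) = 1 / z + h / (z (z - h)): dividing by h > 0 and letting h tend to 0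
   passes from the kernel z^-k / (z - h) to the kernel z^-(k+1) / (z - h). *)
Lemma moments_eq0 k : (forall h, 0 < h -> h <= r / 2 ->
    \int[mu]_y (U y ^+ k * (f y / (y - (x + h)))) = 0) /\
  \int[mu]_y (U y ^+ k * phi y) = 0.
Proof.
suff step k0 : (forall h, 0 < h -> h <= r / 2 ->
    \int[mu]_y (U y ^+ k0 * (f y / (y - (x + h)))) = 0) ->
  \int[mu]_y (U y ^+ k0 * phi y) = 0 /\ (forall h, 0 < h -> h <= r / 2 ->
    \int[mu]_y (U y ^+ k0.+1 * (f y / (y - (x + h)))) = 0).
  suff H : forall h, 0 < h -> h <= r / 2 ->
      \int[mu]_y (U y ^+ k * (f y / (y - (x + h)))) = 0.
    by split => //; case: (step _ H).
  elim: k => [|k /step[]//] h h0 hr.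
  rewrite -[RHS](shifted_integral_eq0 h0 hr).2.
  by apply: eq_Rintegral => y _; rewrite expr0 mul1r.
move=> H; set m := \int[mu]_y _.
set F := fun h => \int[mu]_y (U y ^+ k0.+1 * (f y / (y - (x + h)))).
have mF h : 0 < h -> h <= r / 2 -> m + h * F h = 0.
  move=> h0 hr; rewrite -(H h h0 hr) /m /F.
  have q1 := (shifted_integral_eq0 h0 hr).1.
  rewrite -(intZ _ (UL1 _ q1)) -intD; [|exact: UL1|exact/L1Z/UL1].
  apply: eq_Rintegral => y _; rewrite exprS /phi.
  have [/f0 ->|[By yx]] := box_far x r y; first by rewrite !mul0r !mulr0 addr0.
  rewrite {2}/U By subr0 mul1r.
  have y0 : y - x != 0 by rewrite -normr_gt0 (lt_trans r0).
  have yh0 : y - x - h != 0.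
    rewrite subr_eq0; apply/negP => /eqP yh; move: yx.
    by rewrite yh gtr0_norm//; lra.
  have -> : y - (x + h) = y - x - h by ring.
  move: (U y ^+ k0) (f y) (y - x) y0 yh0 => p q t t0 th.
  by field; apply/andP; split.
have m0 : m = 0.
  (* Bounds [F h] uniformly in h: |U| <= 1 / r, and |y - (x + h)| >= |y - x| / 2 off the interval
     because h <= r / 2. The factor r / 2 comes from h = e * (r / 2). *)
  apply: (@eq0_small _ _ (r / 2 * (r^-1 ^+ k0.+1 * (2 * \int[mu]_y `|phi y|)))).
  move=> e e0 e1; pose h := e * (r / 2).
  have h0 : 0 < h by rewrite mulr_gt0// divr_gt0.
  have hr : h <= r / 2 by rewrite ler_piMl// divr_ge0// ltW.
  have q1 := (shifted_integral_eq0 h0 hr).1.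
  have /eqP := mF h h0 hr; rewrite addr_eq0 => /eqP ->.
  rewrite normrN normrM (ger0_norm (ltW h0)) mulrA ler_wpM2l ?(ltW h0)//.
  rewrite (le_trans (le_norm_int (UL1 _ q1)))//.
  rewrite -(intZ 2 (L1_norm phi1)) -(intZ _ (L1Z 2 (L1_norm phi1))).
  apply: le_int => [||y]; [exact/L1_norm/UL1|exact/L1Z/L1Z/L1_norm|].
  rewrite normrM; apply: ler_pM => //.
  have [/f0 fy|[_ yx]] := box_far x r y.
    by rewrite /phi fy !mul0r normr0 mulr0.
  rewrite /phi !normrM !normfV mulrCA ler_wpM2l//.
  have y0 : 0 < `|y - x| := lt_trans r0 yx.
  have H1 : `|y - x| <= `|y - (x + h)| + h.
    have := ler_normD (y - (x + h)) h; rewrite (ger0_norm (ltW h0)).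
    by rewrite (_ : y - (x + h) + h = y - x)//; ring.
  have H2 : 2^-1 * `|y - x| <= `|y - (x + h)| by lra.
  have H3 : 0 < 2^-1 * `|y - x| by rewrite mulr_gt0.
  rewrite -[X in X * _^-1]invrK -invfM lef_pV2 ?posrE//.
  exact: lt_le_trans H2.
split => // h h0 hr; have /eqP := mF h h0 hr.
by rewrite m0 add0r mulf_eq0 gt_eqF//= => /eqP.
Qed.

(** The extra power k carries the induction: the factor 'X of p * 'X + c is absorbed into
    [U y ^+ k.+1]. *)
Lemma moments_poly_eq0 (p : {poly R}) k :
  L1 (fun y => U y ^+ k * (p.[U y] * phi y)) /\
  \int[mu]_y (U y ^+ k * (p.[U y] * phi y)) = 0.
Proof.
elim/poly_ind: p k => [|p c IH] k.
  have E : (fun y => U y ^+ k * ((0 : {poly R}).[U y] * phi y)) = fun=> 0.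
    by apply/funext => y; rewrite horner0 mul0r mulr0.
  by rewrite E int0; split => //; exact: L1_0.
have [p1 p0] := IH k.+1.
have q1 := L1Z c (UL1 k phi1).
have E : (fun y => U y ^+ k * ((p * 'X + c%:P).[U y] * phi y)) =
    fun y => U y ^+ k.+1 * (p.[U y] * phi y) + c * (U y ^+ k * phi y).
  by apply/funext => y; rewrite hornerMXaddC exprS; move: p.[U y] (phi y) (U y ^+ k) (U y) => a b d e; ring.
rewrite E; split; first exact: L1D.
by rewrite intD// p0 (intZ _ (UL1 _ phi1)) (moments_eq0 k).2 mulr0 addr0.
Qed.

Context (M : R) (cf : continuous f) (fM : forall y, `|f y| <= M).

Let G z := z * f (x + z^-1).

(** At z = 0 the factor z prevails over the bounded f, whatever f does at infinity. *)
Let continuous_G : continuous G.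
Proof.
move=> z; have [->|z0] := eqVneq z 0.
  apply/cvgrPdist_le => e e0; rewrite /G mul0r.
  have M1 : 0 < `|M| + 1 by rewrite ltr_wpDl.
  near=> t; rewrite sub0r normrN normrM.
  rewrite (le_trans (ler_wpM2l (normr_ge0 _) (fM _)))//.
  rewrite (@le_trans _ _ (`|t| * (`|M| + 1)))//.
    by rewrite ler_wpM2l// (le_trans (ler_norm _))// lerDl.
  rewrite -ler_pdivlMr//; near: t.
  exists (e / (`|M| + 1)); first exact: divr_gt0.
  by move=> t /=; rewrite sub0r normrN => /ltW.
apply: cvgM; first exact: cvg_id.
apply: continuous_comp; last exact: cf.
by apply: cvgD; [exact: cvg_cst|exact: inv_continuous].
Unshelve. all: by end_near. Qed.

(* The polynomials are Bernstein polynomials of z f(x + 1 / z) on [- 1 / r, 1 / r]. *)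
Lemma ae_eq0_moments : {ae mu, forall y, f y = 0}.
Proof.
(* Affine rescaling of [- 1 / r, 1 / r], the range of [U], to the interval [0, 1] of the Bernstein
   polynomials; [t y] below is the inverse image of [U y]. *)
pose H t := G ((2 * t - 1) / r).
have cH : continuous H.
  move=> t; apply: (continuous_comp (f := fun t : R => (2 * t - 1) / r)); last exact: continuous_G.
  apply: cvgMr_tmp; apply: cvgB; last exact: cvg_cst.
  by apply: cvgMl_tmp; exact: cvg_id.
have Hb t : 0 <= t <= 1 -> `|H t| <= r^-1 * M.
  move=> /andP[t0 t1]; rewrite /H /G normrM ler_pM//.
  have ri0 : 0 <= r^-1 by rewrite invr_ge0 ltW.
  rewrite normrM [X in _ * X <= _]ger0_norm// ler_piMl//.
  by rewrite ler_norml; apply/andP; split; lra.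
pose B n := bernstein n.+1 (fun k => H (k%:R / n.+1%:R)).
pose P n := B n \Po ((2^-1 * r) *: 'X + (2^-1)%:P).
pose t y := (r * U y + 1) / 2.
have t01 y : 0 <= t y <= 1.
  have : `|r * U y| <= 1.
    by rewrite normrM gtr0_norm// -ler_pdivlMl// mulr1.
  by rewrite ler_norml /t => /andP[? ?]; apply/andP; split; lra.
have PE n y : (P n).[U y] = (B n).[t y].
  rewrite /P horner_comp; congr (_.[_]); rewrite hornerD hornerZ hornerX hornerC /t; by move: (U y) => z; field.
(* Off the interval around x, G(1 / (y - x)) = f(y) / (y - x) = phi(y); on it phi is 0. *)
have HE y : H (t y) * phi y = phi y ^+ 2.
  have -> : H (t y) = G (U y).
    by rewrite /H /t; congr G; field; rewrite gt_eqF.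
  rewrite /G expr2 /phi; have [/f0 ->|[By yx]] := box_far x r y.
    by rewrite !mul0r !mulr0.
  rewrite /U By subr0 mul1r invrK [x + _]addrC subrK.
  by move: (f y) (_^-1) => p q; ring.
have mt : measurable_fun setT t.
  apply: measurable_funM => //; apply: measurable_funD => //.
  exact: measurable_funM.
have mphi : measurable_fun setT phi := L1_measurable phi1.
have [|||||phi2 lim] := @dominated_cvg_int R (fun n y => (P n).[U y] * phi y)
  (fun y => phi y ^+ 2) (fun y => r^-1 * M * `|phi y|).
- move=> n; apply: L1_measurable.
  by have := (moments_poly_eq0 (P n) 0).1; congr L1; apply/funext => y; rewrite mul1r.
- exact: measurable_funX.
- exact/L1Z/L1_norm.
- apply: aeT => y; rewrite -HE; apply: cvgMr_tmp.
  under eq_fun do rewrite PE.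
  by apply: cvg_bernstein (t01 y) _ Hb; exact: cH.
- move=> n y; rewrite normrM ler_wpM2r// PE; apply: norm_bernstein_le => // k kn.
  by apply: Hb; rewrite divr_ge0//= ler_pdivrMr ?ltr0n// mul1r ler_nat.
have phi0 : \int[mu]_y phi y ^+ 2 = 0.
  apply: (cvg_unique _ lim) => //.
  rewrite (_ : (fun n => _) = fun=> 0); first exact: cvg_cst.
  apply/funext => n; rewrite -[RHS](moments_poly_eq0 (P n) 0).2.
  by apply: eq_Rintegral => y _; rewrite mul1r.
have := int_eq0_ae phi2 (fun y => sqr_ge0 _) phi0.
apply: aeS => y /eqP; rewrite sqrf_eq0 mulf_eq0 => /orP[/eqP//|].
rewrite invr_eq0 subr_eq0 => /eqP ->; apply: f0.
by rewrite box_ball subrr normr0 ltW.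
Qed.


End UniqueContinuationMoments.

(** * Unique continuation from an open set *)

Section UniqueContinuation.
Context {R : realType}.
Notation mu := (@lebesgue_measure R).

Lemma hilbert_unique_continuation (f g : R -> R) (I : set R) M : L2 f -> L2 g ->
  {ae mu, forall x, hartley g x = Num.sg x * hartley f (- x)} ->
  continuous f -> (forall x, `|f x| <= M) -> open I -> I !=set0 ->
  (forall x, I x -> f x = 0) -> {ae mu, forall x, I x -> g x = 0} -> f = cst 0.
Proof.
move=> f2 g2 gf cf fM oI [x Ix] f0 g0.
have /nbhs_ballP[d /= d0 dI] : nbhs x I by exact: open_nbhs_nbhs.
(* The radius is halved because [box] is a closed interval and the ball an open one. *)
have r0 : 0 < d / 2 by rewrite divr_gt0.
have sub y : box (x - d / 2) (x + d / 2) y = 1 -> I y.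
  rewrite box_ball; case: leP => [H _|_ /eqP]; last by rewrite eq_sym oner_eq0.
  by apply: dI; rewrite /ball/= distrC; lra.
apply: continuous_ae_eq => //; first by move=> ?; exact: cvg_cst.
apply: (ae_eq0_moments f2 g2 gf r0 _ _ cf fM); first by move=> y /sub /f0.
by apply: (aeS _ g0) => y gy /sub.
Qed.

End UniqueContinuation.

(** * Solutions of the Benjamin equation *)

Section InitialData.
Context {R : realType}.
Notation mu := (@lebesgue_measure R).
Implicit Types (f g u v : R -> R) (a b c x y : R).

Lemma open_eq_derive1 (I : set R) f g : open I -> (forall x, I x -> f x = g x) ->
  forall x, I x -> f^`()%classic x = g^`()%classic x.
Proof.
move=> oI fg x Ix; rewrite !derive1E; apply: near_eq_derive.
by near=> y; apply: fg; near: y; exact: open_nbhs_nbhs.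
Unshelve. all: by end_near. Qed.

Lemma hartley_eq0 f : L2 f -> {ae mu, forall x, hartley f x = 0} -> {ae mu, forall x, f x = 0}.
Proof.
move=> f2 hf0; apply: int_sqr_eq0 => //.
have h2 := hartley_L2 f2.
have : \int[mu]_x (hartley f x * hartley f x) = 0.
  rewrite -[RHS](@int0 R); apply: ae_eq_int => //; first by apply: measurable_funM; case: h2.
  by apply: (aeS _ hf0) => x ->; rewrite mulr0.
rewrite hartley_parseval// => /eqP; rewrite mulf_eq0 gt_eqF ?mulr_gt0 ?pi_gt0//= => /eqP <-.
by apply: eq_Rintegral => x _; rewrite expr2.
Qed.

Lemma benjamin_initial_unique s u v ut vt (I : set R) : 7 / 2 < s ->
  sobolev_rep s u -> sobolev_rep s v ->
  {ae mu, forall x, ut x + hilbert (u^`(2))%classic x + (u^`(3))%classic x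
     + u x * u^`()%classic x = 0} ->
  {ae mu, forall x, vt x + hilbert (v^`(2))%classic x + (v^`(3))%classic x
     + v x * v^`()%classic x = 0} ->
  open I -> I !=set0 -> (forall x, I x -> u x = v x /\ ut x = vt x) -> u = v.
Proof.
move=> hs us vs eu ev oI I0 uv.
have cancel (x p q y d : R) : x != 0 -> y = - (x ^+ 2 * p) -> y = - (x ^+ 2 * q) ->
    d = p - q -> d = 0.
  move=> x0 -> /oppr_inj /mulfI -> //; last by rewrite sqrf_eq0.
  by rewrite subrr.
have arith (a1 a2 h1 h2 d1 d2 p1 p2 q1 q2 : R) :
      a1 + h1 + d1 + p1 * q1 = 0 -> a2 + h2 + d2 + p2 * q2 = 0 ->
      p1 = p2 -> a1 = a2 -> q1 = q2 -> d1 = d2 -> h1 - h2 = 0.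
    by move=> + + e0 e1 e2 e3; rewrite e0 e1 e2 e3; lra.
have uvI0 x : I x -> u x = v x by move=> /uv[].
have uvI1 := open_eq_derive1 oI uvI0.
have uvI2 : forall x, I x -> (u^`(2))%classic x = (v^`(2))%classic x := open_eq_derive1 oI uvI1.
have uvI3 : forall x, I x -> (u^`(3))%classic x = (v^`(3))%classic x := open_eq_derive1 oI uvI2.
have [u2 cu hu] := sobolev_derive2 hs us.
have [v2 cv hv] := sobolev_derive2 hs vs.
have [hu2 _] := hilbert_hartley u2.
have [hv2 _] := hilbert_hartley v2.
pose f x := (u^`(2))%classic x - (v^`(2))%classic x.
pose g x := hilbert (u^`(2))%classic x - hilbert (v^`(2))%classic x.
have f2 : L2 f by exact: L2B.
have gf : {ae mu, forall x, hartley g x = Num.sg x * hartley f (- x)}.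
  have H1 : {ae mu, forall x, hartley f (- x) =
      hartley (u^`(2))%classic (- x) - hartley (v^`(2))%classic (- x)}.
    by have := ae_opp (hartleyB u2 v2).
  have H2 : {ae mu, forall x, hartley g x =
      hartley (hilbert (u^`(2))%classic) x - hartley (hilbert (v^`(2))%classic) x}.
    exact: hartleyB hu2 hv2.
  have H3 := hartley_hilbert u2; have H4 := hartley_hilbert v2.
  apply: (aeS2 _ (aeI H1 H2) (aeI H3 H4)).
  move=> x [a b] [c d].
  apply: (etrans b).
  have mulB (p q k c1 d1 z : R) : p = k * c1 -> q = k * d1 -> z = c1 - d1 ->
    p - q = k * z by move=> -> -> ->; ring.
  exact: (mulB _ _ _ _ _ _ c d a).
have f0 : f = cst 0.
  apply: (hilbert_unique_continuation f2 (L2B hu2 hv2) gf _ _ oI I0).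
  - by move=> x; apply: cvgB; [exact: cu|exact: cv].
  - move=> x; apply: le_trans (ler_normB _ _) _.
    exact: lerD (sobolev_sup2 hs us x) (sobolev_sup2 hs vs x).
  - by move=> x Ix; rewrite /f (uvI2 _ Ix) subrr.
  - apply: (aeS2 _ eu ev) => x eux evx Ix; rewrite /g.
    exact: (arith _ _ _ _ _ _ _ _ _ _ eux evx (uv _ Ix).1 (uv _ Ix).2 (uvI1 _ Ix) (uvI3 _ Ix)).
have L2u := sobolev_L2 us; have L2v := sobolev_L2 vs.
(* Equal second derivatives give equal transforms after multiplication by x^2, hence equal
   transforms off the origin. No affine function other than 0 is in L^2, so nothing is lost. *)
have h0 : {ae mu, forall x, hartley (fun x => u x - v x) x = 0}.
  have E : (u^`(2))%classic = (v^`(2))%classic.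
    by apply/funext => x; apply/eqP; rewrite -subr_eq0; apply/eqP; exact: (congr1 (@^~ x) f0).
  rewrite E in hu.
  apply: (aeS2 _ (aeI hu hv) (aeI (hartleyB L2u L2v) (aeN0 0))) => x [a b] [c x0].
  exact: (cancel _ _ _ _ _ x0 a b c).
have := hartley_eq0 (L2B L2u L2v) h0 => uv0.
apply: continuous_ae_eq; [by case: us|by case: vs|].
by apply: (aeS _ uv0) => x /eqP; rewrite subr_eq0 => /eqP.
Qed.

End InitialData.

(** * Vanishing integrals in the energy identity *)

Section Energy.
Context {R : realType}.
Notation mu := (@lebesgue_measure R).
Implicit Types (f g u v p w G : R -> R) (a b c x y t : R).

(* G has limits at both infinities, which vanish since G is integrable. *)
Lemma int_derive_eq0 G g : continuous g -> (forall x, is_derive x 1 G (g x)) ->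
  L1 G -> L1 g -> \int[mu]_x g x = 0.
Proof.
move=> cg dG G1 g1; set L := \int[mu]_x g x.
pose far n x := (1 - box (- n%:R) n%:R x) * `|g x|.
have b01 n x : 0 <= 1 - box (- n%:R) n%:R x <= 1.
  by rewrite subr_ge0 box_le1 gerBl box_ge0.
have mfar n : measurable_fun setT (far n).
  apply: measurable_funM; last exact: L1_measurable (L1_norm g1).
  by apply: measurable_funB => //; exact: measurable_box.
have farle n x : `|far n x| <= `|g x|.
  have /andP[b0 b1] := b01 n x.
  by rewrite normrM normr_id ger0_norm// ler_piMl.
have far1 n : L1 (far n) by exact: (le_L1 (mfar n) (L1_norm g1) (farle n)).
have [|||||_] := @dominated_cvg_int R far (fun=> 0) (fun x => `|g x|).
- exact: mfar.
- exact: measurable_cst.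
- exact: L1_norm.
- apply: aeT => x; rewrite -(subrr `|g x|) /far.
  under eq_fun do rewrite mulrBl mul1r.
  by apply: cvgB; [exact: cvg_cst|exact: (@cvg_nat_box R (fun x => `|g x|) x)].
- exact: farle.
rewrite int0 => far0.
pose K x := `|G x| + `|G (- x)|.
have K1 : L1 K by exact: L1D (L1_norm G1) (L1_norm (L1_opp G1)).
(* The integral over [- x, x] is G(x) - G(- x), bounded by K(x); what remains is at most the tail
   beyond n. *)
have LK n x : n%:R <= x -> `|L| <= \int[mu]_x far n x + K x.
  move=> nx; have x0 : - x <= x by rewrite (@le_trans _ _ 0)// ?oppr_le0 (le_trans _ nx).
  have bg1 := L1_box_continuous (- x) x cg.
  have -> : L = \int[mu]_y (g y - box (- x) x y * g y) + (G x - G (- x)).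
    by rewrite intB// (FTC_box x0 cg dG) subrK.
  rewrite (le_trans (ler_normD _ _))// lerD//; last exact: ler_normB.
  have gb1 := L1B g1 bg1.
  rewrite (le_trans (le_norm_int gb1))//; apply: le_int => [||y]; [exact: L1_norm|exact: far1|].
  rewrite -{1}[g y]mul1r -mulrBl normrM /far ler_wpM2r// ger0_norm; last first.
    by rewrite subr_ge0 box_le1.
  rewrite lerD2l lerN2 !boxE ler_nat; case: (boolP (_ <= y <= n%:R)) => //= /andP[ny yn].
  by rewrite (le_trans yn nx) (le_trans _ ny)// lerN2.
(* Otherwise K would be at least c > 0 on all of [n, + oo[, and the integral of K would exceed m c
   for every m. *)
have Lfar n : `|L| <= \int[mu]_x far n x.
  rewrite leNgt; apply/negP => lt.
  set c := `|L| - \int[mu]_x far n x; have c0 : 0 < c by rewrite subr_gt0.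
  have Hm m : m%:R * c <= \int[mu]_x K x.
    have -> : m%:R * c = \int[mu]_x (c * box n%:R (n%:R + m%:R) x).
      rewrite intZ; last exact: L1_box.
      have ab : n%:R <= n%:R + m%:R :> R by rewrite lerDl.
      have c1 : continuous (fun _ : R => 1 : R) by move=> x; exact: cvg_cst.
      have := FTC_box ab c1 (fun x => is_derive_id x 1).
      rewrite [n%:R + m%:R - n%:R]addrAC subrr add0r => H.
      rewrite mulrC; congr (_ * _); apply: (etrans (esym H)).
      by apply: eq_Rintegral => x _; rewrite mulr1.
    apply: le_int => // [|x]; first exact/L1Z/L1_box.
    have K0 : 0 <= K x by rewrite addr_ge0.
    rewrite boxE; case: (boolP (n%:R <= x <= _)) => [/andP[nx _]|_]; last by rewrite mulr0.
    by rewrite mulr1 /c lerBlDl; exact: LK.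
  have [m Hmc] : exists m : nat, (\int[mu]_x K x) / c < m%:R.
    by exists (Num.truncn ((\int[mu]_x K x) / c)).+1; exact: Num.Theory.truncnS_gt.
  by move: Hmc; rewrite ltr_pdivrMr// => /(le_lt_trans (Hm m)); rewrite ltxx.
apply/eqP; rewrite -normr_le0; apply: (cvgr_to_ge far0).
by apply: nearW.
Qed.

(** By Parseval the pairing is a multiple of the integral of m(x) times [hartley w] at x and at - x,
    an odd function. Both dispersive terms are of this kind: m = - x^2 sgn x for the Hilbert
    transform of the second derivative, and m = x^3 for the third derivative. *)
Lemma skew_int_eq0 (m : R -> R) p w : L2 p -> L2 w -> measurable_fun setT m ->
  (forall x, m (- x) = - m x) ->
  {ae mu, forall x, hartley p x = m x * hartley w (- x)} ->
  \int[mu]_x (p x * w x) = 0.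
Proof.
move=> p2 w2 mm modd pw.
have hp2 := hartley_L2 p2; have hw2 := hartley_L2 w2.
pose F x := m x * (hartley w (- x) * hartley w x).
have mF : measurable_fun setT F.
  apply: measurable_funM => //.
  by apply: measurable_funM; [case: (L2_opp hw2)|case: hw2].
have pF : {ae mu, forall x, hartley p x * hartley w x = F x}.
  by apply: (aeS _ pw) => x E; rewrite /F mulrA; congr (_ * _).
have F1 : L1 F by apply: ae_eq_L1 mF pF _; exact: L2M.
have F0 : \int[mu]_x F x = 0.
  suff : \int[mu]_x F x = - \int[mu]_x F x by move/eqP; rewrite -addr_eq0 -mulr2n mulrn_eq0 => /eqP.
  rewrite -intN// -{1}(int_opp mF); apply: eq_Rintegral => x _.
  by rewrite /F modd opprK mulNr [hartley w x * _]mulrC.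
have : \int[mu]_x (hartley p x * hartley w x) = 0.
  rewrite -[RHS]F0; apply: ae_eq_int => //.
  by apply: measurable_funM; [case: hp2|case: hw2].
rewrite hartley_parseval// => /eqP; rewrite mulf_eq0 gt_eqF ?mulr_gt0 ?pi_gt0//= => /eqP.
exact.
Qed.

(** The derivative of v w^2 is v' w^2 + 2 v w w', and its integral vanishes. *)
Lemma int_transport v v' w w' a b : continuous v' -> continuous w' ->
  (forall x, is_derive x 1 v (v' x)) -> (forall x, is_derive x 1 w (w' x)) ->
  L2 w -> L2 w' -> (forall x, `|v x| <= a) -> (forall x, `|v' x| <= b) ->
  L1 (fun x => v x * w x * w' x) /\
  2 * \int[mu]_x (v x * w x * w' x) = - \int[mu]_x (v' x * w x ^+ 2).
Proof.
move=> cv' cw' dv dw w2 w2' va vb.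
have cv : continuous v by move=> x; apply/differentiable_continuous/derivable1_diffP; case: (dv x).
have cw : continuous w by move=> x; apply/differentiable_continuous/derivable1_diffP; case: (dw x).
have mv : measurable_fun setT v by exact: continuous_measurable_fun.
have mv' : measurable_fun setT v' by exact: continuous_measurable_fun.
have vww1 : L1 (fun x => v x * w x * w' x).
  have := L1M_bounded mv va (L2M w2 w2'); congr L1.
  by apply/funext => x; rewrite mulrA.
have vw1 := L1M_bounded mv' vb w2.2.
split => //; apply/eqP; rewrite -addr_eq0 -intZ// -intD//; last exact: L1Z.
apply/eqP; apply: (int_derive_eq0 (G := fun x => v x * w x ^+ 2)).
- move=> x; apply: cvgD; last by apply: cvgM; [exact: cv'|apply: cvgM; exact: cw].
  apply: cvgMl_tmp; apply: cvgM; last exact: cw'.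
  by apply: cvgM; [exact: cv|exact: cw].
- move=> x; have := is_deriveM (dv x) (is_deriveX 2 (dw x)).
  move=> /is_derive_eq; apply; rewrite /GRing.scale/=.
  rewrite (_ : (w ^+ 2) x = w x ^+ 2)//.
  by move: (v x) (v' x) (w x) (w' x) => *; ring.
- exact: L1M_bounded mv va w2.2.
- by apply: L1D => //; exact: L1Z.
Qed.

End Energy.

(** * The energy inequality *)

Section EnergyRate.
Context {R : realType}.
Notation mu := (@lebesgue_measure R).
Implicit Types (u v : R -> R) (a b c x y t : R).

(** With w = u - v the dispersive terms drop out by skewness, and u u_x - v v_x = u_x w + v w_x.
    Twice the first term costs at most 2 C; twice the second is - int v_x w^2 by [int_transport] and
    costs at most C, hence 3 C. *)
Lemma benjamin_energy_rate s u v ut vt C : 7 / 2 < s ->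
  sobolev_rep s u -> sobolev_rep s v -> L2 ut -> L2 vt ->
  {ae mu, forall x, ut x + hilbert (u^`(2))%classic x + (u^`(3))%classic x
     + u x * u^`()%classic x = 0} ->
  {ae mu, forall x, vt x + hilbert (v^`(2))%classic x + (v^`(3))%classic x
     + v x * v^`()%classic x = 0} ->
  (forall x, `|v x| <= C) ->
  (forall x, `|u^`()%classic x| <= C) -> (forall x, `|v^`()%classic x| <= C) ->
  2 * \int[mu]_x ((ut x - vt x) * (u x - v x)) <= 3 * C * \int[mu]_x (u x - v x) ^+ 2.
Proof.
move=> hs us vs ut2 vt2 eu ev vC u'C v'C.
have split_eq (a1 a2 h1 h2 d1 d2 p1 p2 q1 q2 : R) :
    a1 + h1 + d1 + p1 * q1 = 0 -> a2 + h2 + d2 + p2 * q2 = 0 ->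
    (a1 - a2) * (p1 - p2) = - (h1 - h2) * (p1 - p2) - (d1 - d2) * (p1 - p2)
      - (q1 * (p1 - p2) ^+ 2 + p2 * (p1 - p2) * (q1 - q2)).
  move=> e1 e2; have -> : a1 = - (h1 + d1 + p1 * q1) by lra.
  have -> : a2 = - (h2 + d2 + p2 * q2) by lra.
  by ring.
have diffM (k a b c d e : R) : a = b - c -> b = k * d -> c = k * e -> a = k * (d - e).
  by move=> -> -> ->; ring.
have diffM2 (k m a b c d e f : R) : a = b - c -> b = k * - (m * d) -> c = k * - (m * e) ->
    f = d - e -> a = - (k * m) * f by move=> -> -> -> ->; ring.
have u0 := sobolev_L2 us; have v0 := sobolev_L2 vs.
have [u1 cu1 _] := sobolev_derive1 hs us; have [v1 cv1 _] := sobolev_derive1 hs vs.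
have [u2 _ hu2] := sobolev_derive2 hs us; have [v2 _ hv2] := sobolev_derive2 hs vs.
have [u3 _ hu3] := sobolev_derive3 hs us; have [v3 _ hv3] := sobolev_derive3 hs vs.
have [Hu _] := hilbert_hartley u2; have [Hv _] := hilbert_hartley v2.
have HHu := hartley_hilbert u2; have HHv := hartley_hilbert v2.
pose w x := u x - v x; have w2 : L2 w by exact: L2B.
pose w' x := u^`()%classic x - v^`()%classic x; have w'2 : L2 w' by exact: L2B.
pose p x := hilbert (u^`(2))%classic x - hilbert (v^`(2))%classic x.
pose q x := (u^`(3))%classic x - (v^`(3))%classic x.
have p2 : L2 p by exact: L2B.
have q2 : L2 q by exact: L2B.
have hwN : {ae mu, forall x, hartley w (- x) = hartley u (- x) - hartley v (- x)}.
  by have := ae_opp (hartleyB u0 v0).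
have pw0 : \int[mu]_x (p x * w x) = 0.
  apply: (@skew_int_eq0 _ (fun x => - (Num.sg x * x ^+ 2)) _ _ p2 w2).
  - by apply: measurable_funN; apply: measurable_funM; [exact: measurable_sgr|exact: measurable_funX].
  - by move=> x; rewrite sgrN sqrrN mulNr.
  - have hu2N : {ae mu, forall x, hartley (u^`(2))%classic (- x) = - ((- x) ^+ 2 * hartley u (- x))}.
      by have := ae_opp hu2.
    have hv2N : {ae mu, forall x, hartley (v^`(2))%classic (- x) = - ((- x) ^+ 2 * hartley v (- x))}.
      by have := ae_opp hv2.
    have hp : {ae mu, forall x, hartley p x =
       hartley (hilbert (u^`(2))%classic) x - hartley (hilbert (v^`(2))%classic) x}.
      exact: hartleyB.
    have hHu : {ae mu, forall x, hartley (hilbert (u^`(2))%classic) x =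
        Num.sg x * - (x ^+ 2 * hartley u (- x))}.
      by apply: (aeS2 _ HHu hu2N) => x -> ->; rewrite sqrrN.
    have hHv : {ae mu, forall x, hartley (hilbert (v^`(2))%classic) x =
        Num.sg x * - (x ^+ 2 * hartley v (- x))}.
      by apply: (aeS2 _ HHv hv2N) => x -> ->; rewrite sqrrN.
    apply: (aeS2 _ (aeI hp hwN) (aeI hHu hHv)) => x [e1 e2] [e3 e4].
    exact: (diffM2 _ _ _ _ _ _ _ _ e1 e3 e4 e2).
have qw0 : \int[mu]_x (q x * w x) = 0.
  apply: (@skew_int_eq0 _ (fun x => x ^+ 3) _ _ q2 w2).
  - exact: measurable_funX.
  - by move=> x; rewrite exprNn -signr_odd expr1 mulN1r.
  - have hq : {ae mu, forall x, hartley q x =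
       hartley (u^`(3))%classic x - hartley (v^`(3))%classic x} by exact: hartleyB.
    apply: (aeS2 _ (aeI hq hwN) (aeI hu3 hv3)) => x [e1 e2] [e3 e4].
    by have := diffM _ _ _ _ _ _ e1 e3 e4; rewrite e2.
have dw x : is_derive x 1 w (w' x).
  exact: is_deriveB (sobolev_is_derive hs us x) (sobolev_is_derive hs vs x).
have cw' : continuous w' by move=> x; apply: cvgB; [exact: cu1|exact: cv1].
have [T1 TE] := int_transport cv1 cw' (sobolev_is_derive hs vs) dw w2 w'2 vC v'C.
have uw1 : L1 (fun x => u^`()%classic x * w x ^+ 2).
  exact: L1M_bounded u1.1 u'C w2.2.
have vw1 : L1 (fun x => v^`()%classic x * w x ^+ 2).
  exact: L1M_bounded v1.1 v'C w2.2.
have N1 := L1D uw1 T1.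
have pw1 := L2M p2 w2; have qw1 := L2M q2 w2.
have E : \int[mu]_x ((ut x - vt x) * w x) =
    - (\int[mu]_x (u^`()%classic x * w x ^+ 2)) - \int[mu]_x (v x * w x * w' x).
  transitivity (\int[mu]_x (- (p x * w x) - q x * w x -
      (u^`()%classic x * w x ^+ 2 + v x * w x * w' x))).
    apply: ae_eq_int.
    - exact: L1_measurable (L2M (L2B ut2 vt2) w2).
    - exact: L1_measurable (L1B (L1B (L1N pw1) qw1) N1).
    - apply: (aeS2 _ eu ev) => x e1 e2; rewrite -mulNr.
      exact: (split_eq _ _ _ _ _ _ _ _ _ _ e1 e2).
  rewrite (intB (L1B (L1N pw1) qw1) N1) (intB (L1N pw1) qw1) (intN pw1) (intD uw1 T1).
  by rewrite pw0 qw0; ring.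
have w20 := w2.2.
have B1 : - (\int[mu]_x (u^`()%classic x * w x ^+ 2)) <= C * \int[mu]_x w x ^+ 2.
  rewrite -intN// -intZ//; apply: le_int; [exact: L1N|exact: L1Z|move=> x].
  rewrite -mulNr ler_wpM2r ?sqr_ge0//.
  by have := u'C x; rewrite ler_norml => /andP[+ _]; rewrite lerNl.
have B2 : \int[mu]_x (v^`()%classic x * w x ^+ 2) <= C * \int[mu]_x w x ^+ 2.
  rewrite -intZ//; apply: le_int; [exact: vw1|exact: L1Z|move=> x].
  by rewrite ler_wpM2r ?sqr_ge0// (le_trans (ler_norm _)).
move: E TE B1 B2; rewrite -/(w _); set I := \int[mu]_x ((ut x - vt x) * w x).
move: (\int[mu]_x (u^`()%classic x * w x ^+ 2)) (\int[mu]_x (v x * w x * w' x)) => i1 i2.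
move: (\int[mu]_x (v^`()%classic x * w x ^+ 2)) (\int[mu]_x w x ^+ 2) => i3 i4.
clear.
by move=> -> H1 H2 H3; lra.
Qed.

End EnergyRate.

(** * Gronwall's inequality and L^2 limits of curves *)

Section TimeDependence.
Context {R : realType}.
Notation mu := (@lebesgue_measure R).
Implicit Types (a b c x y t : R).

(** The function exp(- K t) E(t) is nonincreasing, nonnegative, and 0 at t = 0. *)
Lemma gronwall_eq0 (E dE : R -> R) T K : 0 < T -> {within `[0, T], continuous E} ->
  (forall t, t \in `]0, T[ -> is_derive t 1 E (dE t) /\ dE t <= K * E t) ->
  (forall t, 0 <= E t) -> E 0 = 0 -> forall t, t \in `[0, T] -> E t = 0.
Proof.
move=> T0 cE dEK E0 E00 t tT.
pose phi t := expR (- K * t) * E t.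
have de (x : R) : is_derive x 1 (fun t : R => expR (- K * t)) (- K * expR (- K * x)).
  have h : is_derive x 1 (fun t : R => - K * t) (- K).
    by have := is_deriveZ (- K) (is_derive_id x (1 : R)); move=> /is_derive_eq; apply; rewrite /GRing.scale/= mulr1.
  have := is_derive1_comp (f := @expR R) (g := fun t : R => - K * t) (x := x) (is_derive_expR _) h.
  by move=> /is_derive_eq; apply; rewrite /GRing.scale/= mulrC.
have D x : x \in `]0, T[ ->
    is_derive x 1 phi (expR (- K * x) * (dE x - K * E x)).
  move=> /dEK[dEx _]; have := is_deriveM (de x) dEx.
  move=> /is_derive_eq; apply; rewrite /GRing.scale/=.
  by move: (expR _) (E x) (dE x) => *; ring.
have cphi : {within `[0, T], continuous phi}.
  move=> x; apply: cvgM; last exact: cE.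
  have : continuous (fun t : R => expR (- K * t)).
    by move=> y; apply: differentiable_continuous; apply/derivable1_diffP; case: (de y).
  by move=> /continuous_subspaceT; apply.
have dec : phi t <= phi 0.
  apply: (ler0_derive1_le_cc _ _ cphi) => //.
  - by move=> x /D[].
  - move=> x xT; rewrite derive1E; have [_ ->] := D x xT.
    rewrite mulr_ge0_le0 ?expR_ge0// subr_le0.
    by have [] := dEK x xT.
  - by rewrite in_itv/= lexx ltW.
  - by move: tT; rewrite in_itv/= => /andP[].
move: dec; rewrite /phi E00 mulr0 pmulr_rle0 ?expR_gt0// => Et.
by apply/eqP; rewrite eq_le Et E0.
Qed.

Section filter.
Context {I : Type} {F : set_system I} {FF : ProperFilter F}.
Implicit Types fn gn : I -> R -> R.

Lemma sobolev_cvg2 s fn : 0 <= s -> (\forall t \near F, L2 (fn t)) ->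
  sobolev_norm s (fn t) @[t --> F] --> 0%E -> \int[mu]_x fn t x ^+ 2 @[t --> F] --> 0.
Proof.
move=> s0 fn2 /(sobolev_norm_cvg0 fn2) [wn2 H].
have p0 : 0 < 2 * pi :> R by rewrite mulr_gt0 ?pi_gt0.
have H' : (2 * pi)^-1 * \int[mu]_x weighted s (fn t) x ^+ 2 @[t --> F] --> 0.
  by rewrite -(mulr0 (2 * pi)^-1); apply: cvgMl_tmp.
apply: (squeeze_cvgr _ (cvg_cst 0) H').
apply: filterS2 fn2 wn2 => t ft wt; rewrite int_sqr_ge0/=.
by rewrite ler_pdivlMl//; exact: int_sqr_weighted.
Qed.

Lemma cvg2B fn gn f g : (\forall t \near F, L2 (fn t) /\ L2 (gn t)) -> L2 f -> L2 g ->
  \int[mu]_x (fn t x - f x) ^+ 2 @[t --> F] --> 0 ->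
  \int[mu]_x (gn t x - g x) ^+ 2 @[t --> F] --> 0 ->
  \int[mu]_x ((fn t x - gn t x) - (f x - g x)) ^+ 2 @[t --> F] --> 0.
Proof.
move=> fg2 f2 g2 Hf Hg.
have H' : 2 * (\int[mu]_x (fn t x - f x) ^+ 2 + \int[mu]_x (gn t x - g x) ^+ 2)
    @[t --> F] --> 0.
  rewrite -(mulr0 2); apply: cvgMl_tmp; rewrite -[X in _ --> X](addr0 0).
  exact: cvgD.
apply: (squeeze_cvgr _ (cvg_cst 0) H').
apply: filterS fg2 => t [ft gt].
rewrite (int_sqr_ge0 (fun x => _ - _))/=.
have := int_sqrD_le (L2B ft f2) (L2N (L2B gt g2)).
under [X in _ <= 2 * (_ + X) -> _]eq_Rintegral do rewrite sqrrN.
apply: le_trans; rewrite le_eqVlt; apply/orP; left; apply/eqP.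
by apply: eq_Rintegral => x _; congr (_ ^+ 2); ring.
Qed.

End filter.

End TimeDependence.

(** * Bounds, continuity and differentiability in time of one solution *)

Section Solution.
Context {R : realType}.
Notation mu := (@lebesgue_measure R).
Context (T s : R) (T0 : 0 < T) (hs : 7 / 2 < s) (u ut : R -> R -> R)
  (S : benjamin_solution T s u ut).
Implicit Types (a b c x y t : R).

Let s0 : 0 <= s. Proof. by have := hs; lra. Qed.
Let s30 : 0 <= s - 3. Proof. by have := hs; lra. Qed.

Lemma solution_L2 t : t \in `[0, T] -> L2 (u t).
Proof. by move=> tT; exact: sobolev_L2 (benjamin_mem S tT). Qed.

Lemma solution_derive_L2 t : t \in `[0, T[ -> L2 (ut t).
Proof. by move=> tT; have [[/Lfun2P]] := benjamin_derive_mem S tT. Qed.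

Let within_proper t : t \in `[0, T] -> ProperFilter (within `[0, T] (nbhs t)).
Proof.
move=> tT; apply: within_nbhs_proper; exact: subset_closure.
Qed.

Lemma solution_cvg2 t0 : t0 \in `[0, T] ->
  \int[mu]_x (u t x - u t0 x) ^+ 2 @[t --> within `[0, T] (nbhs t0)] --> 0.
Proof.
move=> t0T; have P := within_proper t0T.
apply: (sobolev_cvg2 s0 _ (benjamin_continuous S t0T)).
have J : \forall t \near within `[0, T] (nbhs t0), `[0, T]%classic t by exact: withinT.
by apply: filterS J => t tT; apply: L2B; exact: solution_L2.
Qed.

Lemma solution_cvg_weighted t0 : t0 \in `[0, T] ->
  \int[mu]_x weighted s (u t) x ^+ 2 @[t --> within `[0, T] (nbhs t0)] -->
  \int[mu]_x weighted s (u t0) x ^+ 2.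
Proof.
move=> t0T; have P := within_proper t0T.
have J : \forall t \near within `[0, T] (nbhs t0), `[0, T]%classic t by exact: withinT.
have w2 t : t \in `[0, T] -> L2 (weighted s (u t)).
  by move=> tT; exact: sobolev_weighted (benjamin_mem S tT).
apply: cvg2_norm; [by apply: filterS J => t /w2|exact: w2|].
have [|_] := sobolev_norm_cvg0 _ (benjamin_continuous S t0T).
  by apply: filterS J => t tT; apply: L2B; exact: solution_L2.
apply: cvg_trans; apply: near_eq_cvg; apply: filterS J => t tT.
have ut2 := solution_L2 tT; have u02 := solution_L2 t0T.
apply: ae_eq_int.
- by apply: measurable_funX; apply: measurable_weighted; exact: L2B.
- by apply: measurable_funX; apply: measurable_funB; [case: (w2 _ tT)|case: (w2 _ t0T)].
- by apply: (aeS _ (weightedB s ut2 u02)) => x ->.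
Qed.

(** The squared H^s norm is continuous on the compact interval and attains a maximum, at which the
    sup bounds of u and u_x are evaluated. *)
Lemma solution_bounded : exists C, forall t, t \in `[0, T] ->
  forall x, `|u t x| <= C /\ `|(u t)^`()%classic x| <= C.
Proof.
have c : {within `[0, T], continuous (fun t => \int[mu]_x weighted s (u t) x ^+ 2)}.
  by apply/subspace_continuousP => t tT; exact: solution_cvg_weighted.
have [m mT Hm] := EVT_max (ltW T0) c.
exists ((2 * pi)^-1 * (\int[mu]_y bessel_weight (3 - s) y ^+ 2 +
  \int[mu]_x weighted s (u m) x ^+ 2)) => t tT x.
have p0 : 0 <= (2 * pi)^-1 :> R by rewrite invr_ge0 mulr_ge0 ?pi_ge0.
have := Hm t tT; rewrite -(lerD2l (\int[mu]_y bessel_weight (3 - s) y ^+ 2)).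
move=> /(ler_wpM2l p0) H.
split; apply: le_trans H; first exact: sobolev_sup hs (benjamin_mem S tT) x.
exact: sobolev_sup1 hs (benjamin_mem S tT) x.
Qed.

Lemma near_open_itv t0 : t0 \in `]0, T[ -> \forall t \near t0^', t \in `[0, T].
Proof.
move=> t0T; apply: cvg_within.
have : \forall t \near t0, t \in `]0, T[ by exact: near_in_itvoo.
by apply: filterS => t; exact: subset_itv_oo_cc.
Qed.

(** At an interior time, limits within [[0, T]] become two-sided limits. *)
Lemma dnbhs_within (P : set R) t0 : t0 \in `]0, T[ ->
  (\forall t \near within `[0, T] t0^', P t) -> \forall t \near t0^', P t.
Proof.
move=> /near_open_itv; apply: filterS2 => t tT; exact.
Qed.

Lemma solution_cvg2_dnbhs t0 : t0 \in `]0, T[ ->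
  \int[mu]_x (u t x - u t0 x) ^+ 2 @[t --> t0^'] --> 0.
Proof.
move=> t0T A A0; apply: dnbhs_within => //.
have := solution_cvg2 (subset_itv_oo_cc t0T) A0.
rewrite /within/= => H; apply: (@cvg_within _ (nbhs t0)).
exact: H.
Qed.

Lemma solution_derive_dnbhs t0 : t0 \in `]0, T[ ->
  \int[mu]_x ((u t x - u t0 x) / (t - t0) - ut t0 x) ^+ 2 @[t --> t0^'] --> 0.
Proof.
move=> t0T; have t0T1 : t0 \in `[0, T[ by apply: subset_itv t0T; rewrite bnd_simp.
apply: (sobolev_cvg2 s30).
  apply: filterS (near_open_itv t0T) => t tT.
  apply: L2B (solution_derive_L2 t0T1).
  have := L2Z (t - t0)^-1 (L2B (solution_L2 tT) (solution_L2 (subset_itv_oo_cc t0T))).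
  by congr L2; apply/funext => x; rewrite mulrC.
move=> A A0; apply: dnbhs_within => //.
exact: (benjamin_derive S t0T1) A0.
Qed.

End Solution.

(** * The energy of the difference of two solutions *)

Section Uniqueness.
Context {R : realType}.
Notation mu := (@lebesgue_measure R).
Implicit Types (a b c x y t : R).

Lemma is_derive_dnbhs (E : R -> R) t0 l :
  (E t - E t0) / (t - t0) @[t --> t0^'] --> l -> is_derive t0 1 E l.
Proof.
move=> H.
have sh : (h + t0) @[h --> (0:R)^'] --> t0^'.
  move=> A; rewrite /dnbhs /within /= => At0.
  have c : (h + t0) @[h --> (0:R)] --> t0.
    by rewrite -[X in _ --> X]add0r; apply: cvgD; [exact: cvg_id|exact: cvg_cst].
  have : \forall h \near (0 : R), h + t0 != t0 -> A (h + t0) by exact: (c _ At0).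
  by apply: filterS => h + h0; apply; rewrite -subr_eq0 addrK.
have Hc : h^-1 *: ((E \o shift t0) (h *: 1) - E t0) @[h --> (0:R)^'] --> l.
  have := cvg_comp _ _ sh H; apply: cvg_trans; apply: near_eq_cvg.
  by apply: nearW => h /=; rewrite addrK mulrC /GRing.scale/= mulr1.
have dE : derivable E t0 1 by exact: (cvgP _ Hc).
apply: (DeriveDef dE); exact: (cvg_lim _ Hc).
Qed.

Context (T s : R) (T0 : 0 < T) (hs : 7 / 2 < s) (u ut v vt : R -> R -> R)
  (Su : benjamin_solution T s u ut) (Sv : benjamin_solution T s v vt).

Let E t := \int[mu]_x (u t x - v t x) ^+ 2.

Lemma solution_energy_continuous : {within `[0, T], continuous E}.
Proof.
apply/subspace_continuousP => t0 t0T.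
have P : ProperFilter (within `[0, T] (nbhs t0)).
  by apply: within_nbhs_proper; exact: subset_closure.
have J : \forall t \near within `[0, T] (nbhs t0), `[0, T]%classic t by exact: withinT.
have u2 := solution_L2 Su; have v2 := solution_L2 Sv.
apply: cvg2_norm; [|exact: (L2B (u2 _ t0T) (v2 _ t0T))|].
  by apply: filterS J => t tT; exact: (L2B (u2 _ tT) (v2 _ tT)).
apply: cvg2B; [|exact: u2|exact: v2|exact: (solution_cvg2 hs Su t0T)|exact: (solution_cvg2 hs Sv t0T)].
by apply: filterS J => t tT; split; [exact: u2|exact: v2].
Qed.

(** Factor a^2 - b^2 = (a - b)(a + b): the difference quotient of E is the integral of the quotient
    of w = u - v against w(t) + w(t0), and both factors converge in L^2. *)
Lemma solution_energy_derive t0 : t0 \in `]0, T[ ->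
  is_derive t0 1 E (2 * \int[mu]_x ((ut t0 x - vt t0 x) * (u t0 x - v t0 x))).
Proof.
move=> t0T; have t0T1 : t0 \in `[0, T[ by apply: subset_itv t0T; rewrite bnd_simp.
have t0T2 := subset_itv_oo_cc t0T.
have u2 := solution_L2 Su; have v2 := solution_L2 Sv.
have ut2 := solution_derive_L2 Su t0T1; have vt2 := solution_derive_L2 Sv t0T1.
have J := near_open_itv t0T.
pose q (z : R -> R -> R) t x := (z t x - z t0 x) / (t - t0).
have q2 (z : R -> R -> R) : (forall t, t \in `[0, T] -> L2 (z t)) ->
    forall t, t \in `[0, T] -> L2 (q z t).
  move=> z2 t tT; have := L2Z (t - t0)^-1 (L2B (z2 _ tT) (z2 _ t0T2)).
  by congr L2; apply/funext => x; rewrite mulrC.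
pose w t x := u t x - v t x.
have w2 t : t \in `[0, T] -> L2 (w t) by move=> tT; apply: L2B; [exact: u2|exact: v2].
have Hq : \int[mu]_x ((q u t x - q v t x) - (ut t0 x - vt t0 x)) ^+ 2 @[t --> t0^'] --> 0.
  apply: cvg2B => //; [|exact: (solution_derive_dnbhs hs Su t0T)|exact: (solution_derive_dnbhs hs Sv t0T)].
  by apply: filterS J => t tT; split; apply: q2.
have Hw : \int[mu]_x (w t x - w t0 x) ^+ 2 @[t --> t0^'] --> 0.
  apply: cvg2B; [|exact: u2|exact: v2|exact: (solution_cvg2_dnbhs hs Su t0T)|exact: (solution_cvg2_dnbhs hs Sv t0T)].
  by apply: filterS J => t tT; split; [exact: u2|exact: v2].
have qw2 t : t \in `[0, T] -> L2 (fun x => q u t x - q v t x).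
  by move=> tT; apply: L2B; apply: q2.
have utvt2 := L2B ut2 vt2.
have I1 : \int[mu]_x ((q u t x - q v t x) * w t x) @[t --> t0^'] -->
    \int[mu]_x ((ut t0 x - vt t0 x) * w t0 x).
  apply: cvg2_inner => //; last exact: w2.
  by apply: filterS J => t tT; split; [exact: qw2|exact: w2].
have I2 : \int[mu]_x ((q u t x - q v t x) * w t0 x) @[t --> t0^'] -->
    \int[mu]_x ((ut t0 x - vt t0 x) * w t0 x).
  apply: cvg2_inner => //; [|exact: w2|].
    by apply: filterS J => t tT; split; [exact: qw2|exact: w2].
  rewrite (_ : (fun t => _) = fun=> 0); first exact: cvg_cst.
  apply/funext => t; rewrite -[RHS](@int0 R); apply: eq_Rintegral => x _.
  by rewrite subrr expr0n.
have tn : \forall t \near t0^', t != t0 by exact: nbhs_dnbhs_neq.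
apply: is_derive_dnbhs; rewrite mulr2n mulrDl mul1r.
have I12 := cvgD I1 I2.
suff eqE : \forall t \near t0^', \int[mu]_x ((q u t x - q v t x) * w t x) +
    \int[mu]_x ((q u t x - q v t x) * w t0 x) = (E t - E t0) / (t - t0).
  exact: (cvg_trans (near_eq_cvg eqE) (I12 _)).
apply: filterS2 J tn => t tT tt0.
have wt := w2 _ tT; have w0 := w2 _ t0T2; have qt := qw2 _ tT.
rewrite -intD; [|exact: L2M|exact: L2M].
rewrite /E -intB; [|exact: wt.2|exact: w0.2].
have D1 : L1 (fun x => w t x ^+ 2 - w t0 x ^+ 2) by apply: L1B; [exact: wt.2|exact: w0.2].
rewrite [RHS]mulrC -[RHS](intZ _ D1); apply: eq_Rintegral => x _.
rewrite /q /w; move: (u t x) (u t0 x) (v t x) (v t0 x) => a b c d.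
by field; rewrite subr_eq0.
Qed.

Lemma solution_energy_eq0 : u 0 = v 0 -> forall t x, t \in `[0, T] -> u t x = v t x.
Proof.
move=> uv0 t x tT.
have [Cu HCu] := solution_bounded T0 hs Su.
have [Cv HCv] := solution_bounded T0 hs Sv.
pose C := Num.max Cu Cv.
have Et : E t = 0.
  apply: (gronwall_eq0 (K := 3 * C) T0 solution_energy_continuous _ _ _ tT).
  - move=> t0 t0T; split; first exact: solution_energy_derive.
    have t0T1 : t0 \in `[0, T[ by apply: subset_itv t0T; rewrite bnd_simp.
    have t0T2 := subset_itv_oo_cc t0T.
    apply: (benjamin_energy_rate hs (benjamin_mem Su t0T2) (benjamin_mem Sv t0T2)
      (solution_derive_L2 Su t0T1) (solution_derive_L2 Sv t0T1)
      (benjamin_equation Su t0T1) (benjamin_equation Sv t0T1)) => y.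
    + by rewrite le_max (HCv _ t0T2 y).1 orbT.
    + by rewrite le_max (HCu _ t0T2 y).2.
    + by rewrite le_max (HCv _ t0T2 y).2 orbT.
  - by move=> t0; exact: int_sqr_ge0.
  - rewrite /E uv0 -[RHS](@int0 R); apply: eq_Rintegral => y _.
    by rewrite subrr expr0n.
have us := benjamin_mem Su tT; have vs := benjamin_mem Sv tT.
have w2 := L2B (sobolev_L2 us) (sobolev_L2 vs).
suff -> : u t = v t by [].
apply: continuous_ae_eq; [exact: us.2|exact: vs.2|].
by apply: (aeS _ (int_sqr_eq0 w2 Et)) => y /eqP; rewrite subr_eq0 => /eqP.
Qed.

Lemma benjamin_unique (I : set R) : open I -> I !=set0 ->
  (forall x, I x -> u 0 x = v 0 x /\ ut 0 x = vt 0 x) ->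
  forall t x : R, t \in `[0, T] -> u t x = v t x.
Proof.
move=> oI I0 uv t x; apply: solution_energy_eq0.
have T1 : 0 \in `[0, T] by rewrite in_itv/= lexx ltW.
have T2 : 0 \in `[0, T[ by rewrite in_itv/= lexx.
exact: (benjamin_initial_unique hs (benjamin_mem Su T1) (benjamin_mem Sv T1)
  (benjamin_equation Su T2) (benjamin_equation Sv T2) oI I0 uv).
Qed.

End Uniqueness.

(** * The zero function as a solution *)

Section ZeroSolution.
Context {R : realType}.
Notation mu := (@lebesgue_measure R).
Notation zero := (fun _ : R => 0 : R).

Lemma hartley_zero : {ae mu, forall x, hartley zero x = 0}.
Proof.
have := hartleyZ 0 (@L2_0 R); by apply: aeS => x; rewrite !mul0r.
Qed.

(** An almost everywhere statement, since [hilbert] is built on representatives chosen by [xget]. *)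
Lemma hilbert_zero : {ae mu, forall x, hilbert zero x = 0}.
Proof.
have [H2 _] := hilbert_hartley (@L2_0 R); apply: hartley_eq0 => //.
have hN : {ae mu, forall x, hartley zero (- x) = 0} by have := ae_opp hartley_zero.
by apply: (aeS2 _ (hartley_hilbert (@L2_0 R)) hN) => x -> ->; rewrite mulr0.
Qed.

Lemma sobolev_norm_zero s : sobolev_norm s zero = 0%E.
Proof.
have w0 : {ae mu, forall x, 0 = weighted s zero x}.
  by apply: (aeS _ hartley_zero) => x E; rewrite /weighted E mulr0.
have mw := measurable_weighted s (@L2_0 R).
have w2 : L2 (weighted s zero) := ae_eq_L2 mw w0 (@L2_0 R).
rewrite sobolev_norm_sqrt//; last exact: L2_0.
suff -> : \int[mu]_x weighted s zero x ^+ 2 = 0 by rewrite sqrtr0.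
rewrite -[RHS](@int0 R); apply: ae_eq_int => //; first by case: w2.2 => _; exact: measurable_funX.
by apply: (aeS _ w0) => x <-; rewrite expr0n.
Qed.

Lemma sobolev_rep_zero s : sobolev_rep s zero.
Proof.
split; last by move=> x; exact: cvg_cst.
by split; [apply/Lfun2P; exact: L2_0|rewrite sobolev_norm_zero].
Qed.

Lemma benjamin_solution_zero T s : benjamin_solution T s (fun _ => zero) (fun _ => zero).
Proof.
have cont r (J : set R) : sobolev_continuous r J (fun _ => zero).
  move=> t _; rewrite (_ : (fun _ => _) = fun=> 0%E); first exact: cvg_cst.
  apply/funext => t'; rewrite -(sobolev_norm_zero r); congr (sobolev_norm r _).
  by apply/funext => x; rewrite subrr.
split => //.
- by move=> t _; exact: sobolev_rep_zero.
- by move=> t _; exact: sobolev_rep_zero.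
- move=> t _; rewrite /is_sobolev_derive.
  rewrite (_ : (fun _ => _) = fun=> 0%E); first exact: cvg_cst.
  apply/funext => t'; rewrite -(sobolev_norm_zero (s - 3)); congr (sobolev_norm (s - 3) _).
  by apply/funext => x; rewrite subrr mul0r subrr.
- move=> t _.
  have d1 : zero^`()%classic = zero by apply/funext => x; exact: derive1_cst.
  have d2 : (zero^`(2))%classic = zero by rewrite /= !d1.
  have d3 : (zero^`(3))%classic = zero by rewrite /= !d1.
  rewrite d1 d2 d3; apply: (aeS _ hilbert_zero) => x ->.
  by rewrite mulr0 !addr0.
Qed.

End ZeroSolution.

Theorem theorem1p6 (R : realType) (T s : R) (hT : 0 < T) (hs : 7 / 2 < s) :
  (forall (u ut v vt : R -> R -> R),
     benjamin_solution T s u ut -> benjamin_solution T s v vt ->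
     forall I : set R, open I -> I !=set0 ->
     (forall x, I x -> u 0 x = v 0 x /\ ut 0 x = vt 0 x) ->
     forall t x : R, t \in `[0, T] -> u t x = v t x) /\
  (forall (u ut : R -> R -> R),
     benjamin_solution T s u ut ->
     forall I : set R, open I -> I !=set0 ->
     (forall x, I x -> u 0 x = 0 /\ ut 0 x = 0) ->
     forall t x : R, t \in `[0, T] -> u t x = 0).
Proof.
split=> [u ut v vt Su Sv I oI I0 uv|u ut Su I oI I0 u0].
  exact: (benjamin_unique hT hs Su Sv oI I0 uv).
exact: (benjamin_unique hT hs Su (@benjamin_solution_zero R T s) oI I0 u0).
Qed.
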